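(* Let $R$ be an associative unital ring. For every $R$-complex $M$ there exists a pure-minimal semi-flat $R$-complex $F$ isomorphic to $M$ in the derived category over $R$. Furthermore, for every such complex $F$ one has $$\operatorname{flat\,dim}_R M = \sup\{\, i \mid F_i\neq 0\,\}.$$
   Context: $R$-modules are left modules; right $R$-modules are modules over the opposite ring $R^\circ$. An $R$-complex is a (possibly unbounded) chain complex $M$ of $R$-modules, indexed homologically; $Z_i(M)=\operatorname{Ker}(\partial_i^M)$; $\mathcal{C}(R)$ is the category of $R$-complexes and chain maps, with hom-sets $\operatorname{hom}_{\mathcal{C}(R)}(L,M)$. An $R$-complex $F$ is semi-flat if every $F_i$ is flat and the total tensor product functor $-\otimes_R F$ preserves acyclicity of $R^\circ$-complexes. The flat dimension $\operatorname{flat\,dim}_R M\in\mathbb{Z}\cup\{\pm\infty\}$ of an $R$-complex $M$ is the infimum of the integers $n$ such that $M$ is isomorphic in the derived category to a semi-flat $R$-complex $F$ with $F_i=0$ for all $i>n$. Conventions: $\sup\varnothing=-\infty$, $\inf\varnothing=\infty$. An exact sequence of $R$-modules is pure if $\operatorname{Hom}_R(A,-)$ leaves it exact for every finitely presented $R$-module $A$. A subcomplex $L\subseteq M$ is pure if $0\to\operatorname{hom}_{\mathcal{C}(R)}(A,L)\to\operatorname{hom}_{\mathcal{C}(R)}(A,M)\to\operatorname{hom}_{\mathcal{C}(R)}(A,M/L)\to 0$ is exact for every bounded complex $A$ of finitely presented $R$-modules. An $R$-complex $M$ is pure-acyclic if it is acyclic and $0\to Z_i(M)\to M_i\to Z_{i-1}(M)\to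 0$ is a pure exact sequence of $R$-modules for every $i\in\mathbb{Z}$. An $R$-complex is pure-minimal if the zero complex is its only pure-acyclic pure subcomplex. *)

(* Defs.v *)
From HB Require Import structures.
From mathcomp Require Import all_boot all_order all_algebra generic_quotient.
From mathcomp Require Import boolp classical_sets cardinality constructive_ereal.
From mathcomp.multinomials Require Import freeg.

Set Implicit Arguments.
Unset Strict Implicit.
Unset Printing Implicit Defensive.

Import Order.TTheory GRing.Theory Num.Theory.
Local Open Scope ring_scope.
Local Open Scope quotient_scope.

Section Submodules.
Variables (R : pzRingType) (V : lmodType R) (S : submodClosed V).

Record submod := Submod { submod_val : V; _ : submod_val \in S }.

HB.instance Definition _ := [isSub for submod_val].
HB.instance Definition _ := [Choice of submod by <:].
HB.instance Definition _ := [SubChoice_isSubLmodule of submod by <:].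

(* The library does not let a [submodClosed] predicate be used as a
   [zmodClosed] one, which is what [Quotient.quot] expects. *)
Definition submod_pred : {pred V} := fun x => x \in S.

Fact submod_pred_zmod_closed : zmod_closed submod_pred.
Proof.
by split=> [|x y xS yS]; rewrite unfold_in ?rpred0 // -scaleN1r rpredD ?rpredZ.
Qed.

HB.instance Definition _ :=
  GRing.isZmodClosed.Build V submod_pred submod_pred_zmod_closed.

Definition quotmod := Quotient.quot submod_pred.

HB.instance Definition _ := ZmodQuotient.on quotmod.

Definition quotmod_pi (x : V) : quotmod := \pi_quotmod x.

Fact quotmod_eqP x y : reflect (quotmod_pi x = quotmod_pi y) (x - y \in S).
Proof.
by apply: (iffP idP) => [xyS|/eqmodP //]; apply/eqmodP.
Qed.

Definition quotmod_scale (a : R) (u : quotmod) : quotmod :=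
  quotmod_pi (a *: repr u).

Fact quotmod_pi_is_zmod_morphism : zmod_morphism quotmod_pi.
Proof. exact: pi_is_zmod_morphism. Qed.

HB.instance Definition _ := GRing.isZmodMorphism.Build V quotmod quotmod_pi
  quotmod_pi_is_zmod_morphism.

Fact quotmod_piZ a x : quotmod_scale a (quotmod_pi x) = quotmod_pi (a *: x).
Proof.
apply/quotmod_eqP; rewrite -scalerBr rpredZ //; apply/quotmod_eqP.
exact: reprK.
Qed.

Fact quotmod_scaleA a b u :
  quotmod_scale a (quotmod_scale b u) = quotmod_scale (a * b) u.
Proof. by rewrite -[u]reprK -!/(quotmod_pi _) !quotmod_piZ scalerA. Qed.

Fact quotmod_scale1 u : quotmod_scale 1 u = u.
Proof. by rewrite -[u]reprK -!/(quotmod_pi _) !quotmod_piZ scale1r. Qed.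

Fact quotmod_scaleDr a u v :
  quotmod_scale a (u + v) = quotmod_scale a u + quotmod_scale a v.
Proof.
rewrite -[u]reprK -[v]reprK -!/(quotmod_pi _) -raddfD !quotmod_piZ.
by rewrite scalerDr raddfD.
Qed.

Fact quotmod_scaleDl u a b :
  quotmod_scale (a + b) u = quotmod_scale a u + quotmod_scale b u.
Proof.
by rewrite -[u]reprK -!/(quotmod_pi _) !quotmod_piZ scalerDl raddfD.
Qed.

HB.instance Definition _ := GRing.Zmodule_isLmodule.Build R quotmod
  quotmod_scaleA quotmod_scale1 quotmod_scaleDr quotmod_scaleDl.

Fact quotmod_pi_is_scalable : scalable quotmod_pi.
Proof. by move=> a x; rewrite -quotmod_piZ. Qed.

HB.instance Definition _ := GRing.isScalable.Build R V quotmod *:%R quotmod_pi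
  quotmod_pi_is_scalable.

End Submodules.

Section Maps.
Variables (R : pzRingType) (V W : lmodType R) (f : {linear V -> W}).

Definition ker : {pred V} := [pred x | f x == 0].

Fact kerP x : reflect (f x = 0) (x \in ker).
Proof. exact: eqP. Qed.

Fact ker_submod_closed : subsemimod_closed ker.
Proof.
split; first split=> [|x y].
- by apply/kerP; rewrite raddf0.
- by move=> /kerP fx0 /kerP fy0; apply/kerP; rewrite raddfD /= fx0 fy0 addr0.
by move=> a x /kerP fx0; apply/kerP; rewrite linearZ_LR /= fx0 scaler0.
Qed.

HB.instance Definition _ :=
  GRing.isSubSemiModClosed.Build R V ker ker_submod_closed.

End Maps.

(* Exactness of [0 -> K -> M -> N -> 0]. *)
Definition short_exact (K M N : zmodType) (f : K -> M) (g : M -> N) :=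
  [/\ injective f,
      (forall y, g y = 0 <-> exists x, f x = y)
    & (forall z, exists y, g y = z)].

Definition id_lin (R : pzRingType) (V : lmodType R) : {linear V -> V} :=
  [the {linear V -> V} of (idfun : V -> V)].

Section ModuleNotions.
Variable R : pzRingType.

(* Exactness of [R^m -> R^n -> A -> 0] for some [m] and [n]. *)
Definition finitely_presented (A : lmodType R) :=
  exists (m n : nat) (q : {linear 'rV[R]_m -> 'rV[R]_n})
         (p : {linear 'rV[R]_n -> A}),
    (forall v, p v = 0 <-> exists w, q w = v) /\
    (forall a, exists v, p v = a).

(* Exactness of [0 -> Hom(A,K) -> Hom(A,M) -> Hom(A,N) -> 0]. *)
Definition hom_short_exact (A K M N : lmodType R)
    (f : {linear K -> M}) (g : {linear M -> N}) :=
  [/\ (forall u v : {linear A -> K}, f \o u =1 f \o v -> u =1 v),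
      (forall h : {linear A -> M},
         g \o h =1 (fun=> 0) <-> exists u : {linear A -> K}, f \o u =1 h)
    & (forall w : {linear A -> N}, exists h : {linear A -> M}, g \o h =1 w)].

Definition pure_exact (K M N : lmodType R)
    (f : {linear K -> M}) (g : {linear M -> N}) :=
  short_exact f g /\
  forall A : lmodType R, finitely_presented A -> hom_short_exact A f g.

End ModuleNotions.

Section Tensor.
Variables (R : pzRingType) (X : lmodType R^c) (Y : lmodType R).

(* The subgroup generated by the additivity and balancing relations;
   [(r : R^c) *: x] is [x r] for the right module [X]. *)
Inductive tensor_relation : {freeg (X * Y)} -> Prop :=
| TensorAddl x x' y :
    tensor_relation (<< (x + x', y) >> - (<< (x, y) >> + << (x', y) >>))
| TensorAddr x y y' :
    tensor_relation (<< (x, y + y') >> - (<< (x, y) >> + << (x, y') >>))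
| TensorBalance (r : R) x y :
    tensor_relation (<< ((r : R^c) *: x, y) >> - << (x, r *: y) >>)
| Tensor0 : tensor_relation 0
| TensorB z z' :
    tensor_relation z -> tensor_relation z' -> tensor_relation (z - z').

Definition tensor_relations : {pred {freeg (X * Y)}} :=
  fun z => `[< tensor_relation z >].

Fact tensor_relationP z : reflect (tensor_relation z) (z \in tensor_relations).
Proof. exact: asboolP. Qed.

Fact tensor_relations_zmod_closed : zmod_closed tensor_relations.
Proof.
split=> [|z z' /tensor_relationP zP /tensor_relationP z'P].
  exact/tensor_relationP/Tensor0.
exact/tensor_relationP/TensorB.
Qed.

HB.instance Definition _ := GRing.isZmodClosed.Build {freeg (X * Y)}
  tensor_relations tensor_relations_zmod_closed.

Definition tensor : zmodType := Quotient.quot tensor_relations.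

Definition tensor_pi (z : {freeg (X * Y)}) : tensor :=
  \pi_(Quotient.quot tensor_relations) z.

Definition tensor_of (x : X) (y : Y) : tensor := tensor_pi << (x, y) >>.

Fact tensor_pi_is_zmod_morphism : zmod_morphism tensor_pi.
Proof. exact: pi_is_zmod_morphism. Qed.

HB.instance Definition _ := GRing.isZmodMorphism.Build {freeg (X * Y)} tensor
  tensor_pi tensor_pi_is_zmod_morphism.

Fact tensor_eqP z z' :
  reflect (tensor_pi z = tensor_pi z') (z - z' \in tensor_relations).
Proof.
by apply: (iffP idP) => [zz'|/eqmodP //]; apply/eqmodP.
Qed.

Definition tensor_repr (t : tensor) : {freeg (X * Y)} :=
  repr (t : Quotient.quot tensor_relations).

Fact tensor_reprK t : tensor_pi (tensor_repr t) = t.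
Proof. exact: reprK. Qed.

End Tensor.

Section TensorTheory.
Variables (R : pzRingType) (X : lmodType R^c) (Y : lmodType R).

Fact tensor_ofDl (x x' : X) (y : Y) :
  tensor_of (x + x') y = tensor_of x y + tensor_of x' y.
Proof.
by rewrite -raddfD; apply/tensor_eqP/tensor_relationP/TensorAddl.
Qed.

Fact tensor_ofDr (x : X) (y y' : Y) :
  tensor_of x (y + y') = tensor_of x y + tensor_of x y'.
Proof.
by rewrite -raddfD; apply/tensor_eqP/tensor_relationP/TensorAddr.
Qed.

Fact tensor_ofZ (r : R) (x : X) (y : Y) :
  tensor_of ((r : R^c) *: x) y = tensor_of x (r *: y).
Proof. exact/tensor_eqP/tensor_relationP/TensorBalance. Qed.

Fact tensor_of0l (y : Y) : tensor_of (0 : X) y = 0.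
Proof. by apply: (addrI (tensor_of 0 y)); rewrite -tensor_ofDl !addr0. Qed.

Fact tensor_of0r (x : X) : tensor_of x (0 : Y) = 0.
Proof. by apply: (addrI (tensor_of x 0)); rewrite -tensor_ofDr !addr0. Qed.

End TensorTheory.

Section TensorMap.
Variables (R : pzRingType) (X X' : lmodType R^c) (Y Y' : lmodType R).
Variables (f : {linear X -> X'}) (g : {linear Y -> Y'}).

Definition tensor_map_free (z : {freeg (X * Y)}) : {freeg (X' * Y')} :=
  fglift (fun k : X * Y => << (f k.1, g k.2) >> : {freeg (X' * Y')}) z.

(* The map [x (x) y |-> f x (x) g y]. *)
Definition tensor_map (t : tensor X Y) : tensor X' Y' :=
  tensor_pi (tensor_map_free (tensor_repr t)).

Fact tensor_map_free_is_zmod_morphism : zmod_morphism tensor_map_free.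
Proof. exact: lift_is_additive. Qed.

HB.instance Definition _ := GRing.isZmodMorphism.Build {freeg (X * Y)}
  {freeg (X' * Y')} tensor_map_free tensor_map_free_is_zmod_morphism.

Fact tensor_map_freeU x y :
  tensor_map_free << (x, y) >> = << (f x, g y) >>.
Proof. by rewrite /tensor_map_free liftU scale1r. Qed.

Fact tensor_map_free_relation z :
  tensor_relation z -> tensor_relation (tensor_map_free z).
Proof.
elim=> [x x' y|x y y'|r x y||u v _ fu _ fv].
- by rewrite raddfB raddfD /= !tensor_map_freeU raddfD; apply: TensorAddl.
- by rewrite raddfB raddfD /= !tensor_map_freeU raddfD; apply: TensorAddr.
- by rewrite raddfB /= !tensor_map_freeU !linearZ_LR; apply: TensorBalance.
- by rewrite raddf0; apply: Tensor0.
- by rewrite raddfB; apply: TensorB.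
Qed.

Fact tensor_map_pi z : tensor_map (tensor_pi z) = tensor_pi (tensor_map_free z).
Proof.
apply/tensor_eqP/tensor_relationP; rewrite -raddfB /=.
apply/tensor_map_free_relation/tensor_relationP/tensor_eqP.
exact: tensor_reprK.
Qed.

Fact tensor_map_of x y :
  tensor_map (tensor_of x y) = tensor_of (f x) (g y).
Proof. by rewrite /tensor_of tensor_map_pi tensor_map_freeU. Qed.

Fact tensor_map_is_zmod_morphism : zmod_morphism tensor_map.
Proof.
move=> t u; rewrite -[t]tensor_reprK -[u]tensor_reprK -raddfB /=.
by rewrite !tensor_map_pi !raddfB.
Qed.

HB.instance Definition _ := GRing.isZmodMorphism.Build (tensor X Y)
  (tensor X' Y') tensor_map tensor_map_is_zmod_morphism.

End TensorMap.

Fact tensor_ind (R : pzRingType) (X : lmodType R^c) (Y : lmodType R)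
    (P : tensor X Y -> Prop) :
  P 0 -> (forall x y, P (tensor_of x y)) ->
  (forall t u, P t -> P u -> P (t - u)) -> forall t, P t.
Proof.
move=> P0 Pof PB t; rewrite -[t]tensor_reprK; set z := tensor_repr t.
have PN u : P u -> P (- u) by move=> Pu; rewrite -sub0r; apply: PB.
have PD u v : P u -> P v -> P (u + v).
  by move=> Pu Pv; rewrite -[v]opprK; apply/PB/PN.
rewrite -(freeg_sumE z) raddf_sum; elim/big_ind: _ => // -[x y] _.
move: (coeff _ _) => c; have -> : << c *g (x, y) >> = << (x, y) >> *~ c.
  by rewrite freegU_mulz intz.
rewrite raddfMz /=; case: c => n; rewrite ?NegzE ?mulrNz -?pmulrn.
  by elim: n => [|n IHn]; rewrite ?mulr0n // mulrS; apply: PD => //; apply: Pof.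
apply: PN; elim: n.+1 => [|m IHm]; rewrite ?mulr0n // mulrS.
by apply: PD => //; apply: Pof.
Qed.

Section TensorMapComp.
Variables (R : pzRingType) (X1 X2 X3 : lmodType R^c) (Y1 Y2 Y3 : lmodType R).
Variables (f : {linear X1 -> X2}) (f' : {linear X2 -> X3}).
Variables (g : {linear Y1 -> Y2}) (g' : {linear Y2 -> Y3}).

Fact tensor_map_comp0 t :
  (forall x, f' (f x) = 0) \/ (forall y, g' (g y) = 0) ->
  tensor_map f' g' (tensor_map f g t) = 0.
Proof.
move=> fg0; elim/tensor_ind: t => [|x y|t u t0 u0].
- by rewrite !raddf0.
- by rewrite !tensor_map_of; case: fg0 => ->; rewrite ?tensor_of0l ?tensor_of0r.
- by rewrite !raddfB /= t0 u0 subrr.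
Qed.

Fact tensor_map_exchange t :
  tensor_map f (id_lin Y2)
    (tensor_map (id_lin X1) g t) =
  tensor_map (id_lin X2) g
    (tensor_map f (id_lin Y1) t).
Proof.
elim/tensor_ind: t => [|x y|t u IHt IHu]; first by rewrite !raddf0.
  by rewrite !tensor_map_of.
by rewrite !raddfB /= IHt IHu.
Qed.

End TensorMapComp.

Definition flat (R : pzRingType) (Y : lmodType R) :=
  forall (A B : lmodType R^c) (f : {linear A -> B}),
    injective f -> injective (tensor_map f (id_lin Y)).

Section DirectSum.
Variables (I : choiceType) (A : I -> zmodType).

Record dsum := DSum {
  dsum_val :> forall i, A i;
  dsum_finite : finite_set [set i | dsum_val i != 0] }.

HB.instance Definition _ := gen_eqMixin dsum.
HB.instance Definition _ := gen_choiceMixin dsum.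

Fact dsum_eqP (t u : dsum) : (forall i, t i = u i) -> t = u.
Proof.
case: t u => [t tfin] [u ufin] /= tu.
have {}tu : t = u by apply: functional_extensionality_dep.
by case: _ / tu in ufin *; congr DSum; apply: Prop_irrelevance.
Qed.

Fact dsum_zero_finite : finite_set [set i | (0 : A i) != 0].
Proof. by apply: (sub_finite_set _ (finite_set0 I)) => i /=; rewrite eqxx. Qed.

Fact dsum_opp_finite (t : dsum) : finite_set [set i | - t i != 0].
Proof.
apply: sub_finite_set (dsum_finite t) => i /=.
by rewrite oppr_eq0.
Qed.

Fact dsum_add_finite (t u : dsum) : finite_set [set i | t i + u i != 0].
Proof.
have : finite_set ([set i | t i != 0] `|` [set i | u i != 0])%classic.
  by rewrite finite_setU; split; apply: dsum_finite.
apply: sub_finite_set => i /=.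
by case: (eqVneq (t i) 0) => [->|]; [rewrite add0r; right | left].
Qed.

Definition dsum_zero := DSum dsum_zero_finite.
Definition dsum_opp t := DSum (dsum_opp_finite t).
Definition dsum_add t u := DSum (dsum_add_finite t u).

Fact dsum_addA : associative dsum_add.
Proof. by move=> t u v; apply: dsum_eqP => i /=; rewrite addrA. Qed.

Fact dsum_addC : commutative dsum_add.
Proof. by move=> t u; apply: dsum_eqP => i /=; rewrite addrC. Qed.

Fact dsum_add0 : left_id dsum_zero dsum_add.
Proof. by move=> t; apply: dsum_eqP => i /=; rewrite add0r. Qed.

Fact dsum_addN : left_inverse dsum_zero dsum_opp dsum_add.
Proof. by move=> t; apply: dsum_eqP => i /=; rewrite addNr. Qed.

HB.instance Definition _ :=
  GRing.isZmodule.Build dsum dsum_addA dsum_addC dsum_add0 dsum_addN.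

Fact dsum_addE (t u : dsum) i : (t + u) i = t i + u i. Proof. by []. Qed.
Fact dsum_oppE (t : dsum) i : (- t) i = - t i. Proof. by []. Qed.
Fact dsum_zeroE i : (0 : dsum) i = 0. Proof. by []. Qed.

End DirectSum.

(* [zdiff C i] is the differential from degree [i + 1] to degree [i]; as
   [i] ranges over [int], so does [i + 1]. *)
Record zcomplex := ZComplex {
  zobj :> int -> zmodType;
  zdiff : forall i, {additive zobj (i + 1) -> zobj i};
  zdiff_comp : forall i x, zdiff i (zdiff (i + 1) x) = 0 }.

Definition acyclic (C : zcomplex) :=
  forall i (x : C (i + 1)), zdiff C i x = 0 -> exists y, zdiff C (i + 1) y = x.

Record complex (R : pzRingType) := Complex {
  cobj :> int -> lmodType R;
  cdiff : forall i, {linear cobj (i + 1) -> cobj i};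
  cdiff_comp : forall i x, cdiff i (cdiff (i + 1) x) = 0 }.

Definition zcomplex_of (R : pzRingType) (M : complex R) : zcomplex :=
  @ZComplex (fun i => M i : zmodType) (fun i => cdiff M i) (@cdiff_comp R M).

Coercion zcomplex_of : complex >-> zcomplex.

Section TotalTensor.
Variables (R : pzRingType) (X : complex R^c) (F : complex R).

Definition tot_index (n : int) : choiceType := {p : int * int | p.1 + p.2 == n}.

Fact tot_index_left_subproof n (p : tot_index n) :
  ((val p).1 + 1) + (val p).2 == n + 1.
Proof. by rewrite addrAC (eqP (valP p)). Qed.

Fact tot_index_right_subproof n (p : tot_index n) :
  (val p).1 + ((val p).2 + 1) == n + 1.
Proof. by rewrite addrA (eqP (valP p)). Qed.

Definition tot_index_left n (p : tot_index n) : tot_index (n + 1) :=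
  exist _ ((val p).1 + 1, (val p).2) (tot_index_left_subproof p).

Definition tot_index_right n (p : tot_index n) : tot_index (n + 1) :=
  exist _ ((val p).1, (val p).2 + 1) (tot_index_right_subproof p).

(* The direct sum of the [X_i (x) F_j] over [i + j = n]. *)
Definition tot_obj (n : int) : zmodType :=
  dsum (fun p : tot_index n => tensor (X (val p).1) (F (val p).2)).

Definition tot_sign (i : int) : int := (-1) ^+ `|i|%N.

(* The component in [X_i (x) F_j] of the differential of [t], namely
   [(d (x) 1) t_(i+1,j) + (-1)^i (1 (x) d) t_(i,j+1)]. *)
Definition tot_diff_val n (t : tot_obj (n + 1)) (p : tot_index n) :
    tensor (X (val p).1) (F (val p).2) :=
  tensor_map (cdiff X (val p).1) (id_lin (F (val p).2))
    (dsum_val t (tot_index_left p)) +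
  tensor_map (id_lin (X (val p).1)) (cdiff F (val p).2)
    (dsum_val t (tot_index_right p)) *~ tot_sign (val p).1.

Fact tot_index_left_inj n : injective (@tot_index_left n).
Proof.
by move=> p q /(congr1 val) /= [/addIr e1 e2]; apply/val_inj/eqP/andP; rewrite e1 e2.
Qed.

Fact tot_index_right_inj n : injective (@tot_index_right n).
Proof.
by move=> p q /(congr1 val) /= [e1 /addIr e2]; apply/val_inj/eqP/andP; rewrite e1 e2.
Qed.

Fact tot_diff_finite n (t : tot_obj (n + 1)) :
  finite_set [set p | tot_diff_val t p != 0].
Proof.
pose S : set (tot_index (n + 1)) := [set q | dsum_val t q != 0]%classic.
have Sfin : finite_set S by exact: dsum_finite.
have : finite_set ((@tot_index_left n @^-1` S) `|` (@tot_index_right n @^-1` S))%classic.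
  rewrite finite_setU; split; apply: finite_preimage => // p q _ _.
    exact: tot_index_left_inj.
  exact: tot_index_right_inj.
apply: sub_finite_set => p /=; rewrite /tot_diff_val.
case: (eqVneq (dsum_val t (tot_index_left p)) 0) => [->|]; last by left.
case: (eqVneq (dsum_val t (tot_index_right p)) 0) => [->|]; last by right.
by rewrite !raddf0 mul0rz addr0 eqxx.
Qed.

Definition tot_diff_fun n (t : tot_obj (n + 1)) : tot_obj n :=
  DSum (tot_diff_finite t).

Fact tot_diff_is_zmod_morphism n : zmod_morphism (@tot_diff_fun n).
Proof.
move=> t u; apply: dsum_eqP => p; rewrite dsum_addE dsum_oppE /=.
rewrite /tot_diff_val !(dsum_addE, dsum_oppE) !raddfB /= mulrzBl.
by rewrite opprD addrACA.
Qed.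

HB.instance Definition _ n := GRing.isZmodMorphism.Build (tot_obj (n + 1))
  (tot_obj n) (@tot_diff_fun n) (@tot_diff_is_zmod_morphism n).

Definition tot_diff n : {additive tot_obj (n + 1) -> tot_obj n} :=
  @tot_diff_fun n.

Fact tot_sign_addr1 i : tot_sign (i + 1) = - tot_sign i.
Proof.
rewrite /tot_sign; case: i => n; first by rewrite -PoszD addn1 exprS mulN1r.
have -> : Negz n + 1 = - n%:Z by rewrite NegzE -addn1 PoszD opprD addrNK.
by rewrite abszN /= exprS mulN1r opprK.
Qed.

Fact tot_diff_comp n (t : tot_obj (n + 1 + 1)) :
  tot_diff n (tot_diff (n + 1) t) = 0.
Proof.
apply: dsum_eqP => p; rewrite dsum_zeroE /= /tot_diff_val /= /tot_diff_val /=.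
rewrite !raddfD /= !raddfMz /= mulrzDl.
rewrite tensor_map_comp0; last by left=> x; apply: cdiff_comp.
rewrite /tot_index_left /tot_index_right /=.
rewrite (bool_irrelevance (tot_index_left_subproof (tot_index_right p))
  (tot_index_right_subproof (tot_index_left p))).
rewrite add0r tensor_map_exchange.
rewrite [X in _ + (_ + X)](_ : _ = 0) ?addr0; last first.
  by rewrite tensor_map_comp0 ?mul0rz //; right=> y; apply: cdiff_comp.
by rewrite tot_sign_addr1 mulrNz addNr.
Qed.

Definition total_tensor : zcomplex :=
  @ZComplex tot_obj tot_diff tot_diff_comp.

End TotalTensor.

Definition semiflat (R : pzRingType) (F : complex R) :=
  (forall i, flat (F i)) /\
  (forall X : complex R^c, acyclic X -> acyclic (total_tensor X F)).

Section ChainMaps.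
Variable R : pzRingType.

Record chain_map (L M : complex R) := ChainMap {
  cmap :> forall i, {linear L i -> M i};
  cmap_diff : forall i x, cdiff M i (cmap (i + 1) x) = cmap i (cdiff L i x) }.

Definition chain_id (M : complex R) : chain_map M M :=
  @ChainMap M M (fun i => id_lin (M i)) (fun i x => erefl).

Fact chain_comp_diff L M N (g : chain_map M N) (f : chain_map L M) i x :
  cdiff N i ((g (i + 1) \o f (i + 1)) x) = (g i \o f i) (cdiff L i x).
Proof. by rewrite /= !cmap_diff. Qed.

Definition chain_comp L M N (g : chain_map M N) (f : chain_map L M) :
    chain_map L N :=
  @ChainMap L N (fun i => [the {linear L i -> N i} of g i \o f i])
    (chain_comp_diff g f).

Definition chain_eq L M (f g : chain_map L M) := forall i, f i =1 g i.

(* Injectivity and surjectivity, in terms of cycles and boundaries, of the map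
   that [f] induces in homology in degree [i + 1]. *)
Definition quasi_iso L M (f : chain_map L M) := forall i,
  (forall x : L (i + 1), cdiff L i x = 0 ->
     (exists y, cdiff M (i + 1) y = f (i + 1) x) ->
     exists x', cdiff L (i + 1) x' = x) /\
  (forall y : M (i + 1), cdiff M i y = 0 ->
     exists x : L (i + 1), cdiff L i x = 0 /\
       exists y', cdiff M (i + 1) y' = f (i + 1) x - y).

(* The derived category, as the localization of the category of complexes at
   the quasi-isomorphisms: words in chain maps and formal inverses of
   quasi-isomorphisms, modulo the congruence [dhom_eq]. *)
Inductive dhom : complex R -> complex R -> Type :=
| DMap L M of chain_map L M : dhom L M
| DInv L M (f : chain_map L M) of quasi_iso f : dhom M L
| DComp L M N of dhom M N & dhom L M : dhom L N.

Definition did (M : complex R) : dhom M M := DMap (chain_id M).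

Inductive dhom_eq : forall L M, dhom L M -> dhom L M -> Prop :=
| DRefl L M (a : dhom L M) : dhom_eq a a
| DSym L M (a b : dhom L M) : dhom_eq a b -> dhom_eq b a
| DTrans L M (a b c : dhom L M) : dhom_eq a b -> dhom_eq b c -> dhom_eq a c
| DCompEq L M N (a a' : dhom M N) (b b' : dhom L M) :
    dhom_eq a a' -> dhom_eq b b' -> dhom_eq (DComp a b) (DComp a' b')
| DCompA K L M N (a : dhom M N) (b : dhom L M) (c : dhom K L) :
    dhom_eq (DComp a (DComp b c)) (DComp (DComp a b) c)
| DComp1l L M (a : dhom L M) : dhom_eq (DComp (did M) a) a
| DComp1r L M (a : dhom L M) : dhom_eq (DComp a (did L)) a
| DMapEq L M (f g : chain_map L M) :
    chain_eq f g -> dhom_eq (DMap f) (DMap g)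
| DMapComp L M N (g : chain_map M N) (f : chain_map L M) :
    dhom_eq (DComp (DMap g) (DMap f)) (DMap (chain_comp g f))
| DInvl L M (f : chain_map L M) (fq : quasi_iso f) :
    dhom_eq (DComp (DInv fq) (DMap f)) (did L)
| DInvr L M (f : chain_map L M) (fq : quasi_iso f) :
    dhom_eq (DComp (DMap f) (DInv fq)) (did M).

Definition derived_iso (M N : complex R) :=
  exists (a : dhom M N) (b : dhom N M),
    dhom_eq (DComp b a) (did M) /\ dhom_eq (DComp a b) (did N).

End ChainMaps.

Section Subcomplexes.
Variables (R : pzRingType) (M : complex R).

Record subcomplex := Subcomplex {
  sub_carrier :> forall i, submodClosed (M i);
  sub_diff : forall i x,
    x \in sub_carrier (i + 1) -> cdiff M i x \in sub_carrier i }.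

Variable L : subcomplex.

Definition sub_obj i : lmodType R := submod (L i).

Definition sub_diff_fun i (x : sub_obj (i + 1)) : sub_obj i :=
  Submod (sub_diff (valP x)).

Fact sub_diff_is_linear i : linear (@sub_diff_fun i).
Proof. by move=> a x y; apply: val_inj; rewrite /= !linearP. Qed.

HB.instance Definition _ i := GRing.isLinear.Build R (sub_obj (i + 1))
  (sub_obj i) *:%R (@sub_diff_fun i) (@sub_diff_is_linear i).

Fact sub_diff_comp i x : @sub_diff_fun i (@sub_diff_fun (i + 1) x) = 0.
Proof. by apply: val_inj; rewrite /= cdiff_comp. Qed.

Definition sub_complex : complex R :=
  @Complex R sub_obj
    (fun i => [the {linear sub_obj (i + 1) -> sub_obj i} of @sub_diff_fun i])
    sub_diff_comp.

Definition sub_incl : chain_map sub_complex M :=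
  @ChainMap R sub_complex M
    (fun i => [the {linear sub_obj i -> M i} of (val : sub_obj i -> M i)])
    (fun i x => erefl).

Definition quot_obj i : lmodType R := quotmod (L i).

Definition quot_diff_fun i (u : quot_obj (i + 1)) : quot_obj i :=
  quotmod_pi (L i) (cdiff M i (repr (u : quotmod (L (i + 1))))).

Fact quot_diff_pi i (x : M (i + 1)) :
  quot_diff_fun (quotmod_pi (L (i + 1)) x) = quotmod_pi (L i) (cdiff M i x).
Proof.
apply/quotmod_eqP; rewrite -raddfB; apply/sub_diff/quotmod_eqP; exact: reprK.
Qed.

Fact quot_diff_is_linear i : linear (@quot_diff_fun i).
Proof.
move=> a u v; rewrite -[u]reprK -[v]reprK -!/(quotmod_pi _ _) -linearP.
by rewrite !quot_diff_pi linearP linearP.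
Qed.

HB.instance Definition _ i := GRing.isLinear.Build R (quot_obj (i + 1))
  (quot_obj i) *:%R (@quot_diff_fun i) (@quot_diff_is_linear i).

Fact quot_diff_comp i u : @quot_diff_fun i (@quot_diff_fun (i + 1) u) = 0.
Proof.
rewrite -[u]reprK -!/(quotmod_pi _ _) !quot_diff_pi.
by rewrite cdiff_comp raddf0.
Qed.

Definition quot_complex : complex R :=
  @Complex R quot_obj
    (fun i => [the {linear quot_obj (i + 1) -> quot_obj i} of @quot_diff_fun i])
    quot_diff_comp.

Definition quot_proj : chain_map M quot_complex :=
  @ChainMap R M quot_complex
    (fun i => [the {linear M i -> quot_obj i} of quotmod_pi (L i)])
    (fun i x => quot_diff_pi x).

End Subcomplexes.

Section Purity.
Variable R : pzRingType.

Definition bounded (A : complex R) :=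
  exists n : int, forall i (x : A i), n < `|i| -> x = 0.

(* Exactness of [0 -> hom(A,L) -> hom(A,M) -> hom(A,M/L) -> 0] for all bounded
   complexes [A] of finitely presented modules. *)
Definition pure_subcomplex (M : complex R) (L : subcomplex M) :=
  forall A : complex R,
    bounded A -> (forall i, finitely_presented (A i)) ->
  [/\ (forall u v : chain_map A (sub_complex L),
         chain_eq (chain_comp (sub_incl L) u) (chain_comp (sub_incl L) v) ->
         chain_eq u v),
      (forall h : chain_map A M,
         (forall i x, chain_comp (quot_proj L) h i x = 0) <->
         exists u : chain_map A (sub_complex L),
           chain_eq (chain_comp (sub_incl L) u) h)
    & (forall w : chain_map A (quot_complex L),
         exists h : chain_map A M, chain_eq (chain_comp (quot_proj L) h) w)].

(* [Z_(i+1)(M)], by the indexing of [cdiff]. *)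
Definition cycles (M : complex R) i : lmodType R :=
  submod [the submodClosed (M (i + 1)) of ker (cdiff M i)].

Definition cycles_incl (M : complex R) i : {linear cycles M i -> M (i + 1)} :=
  [the {linear cycles M i -> M (i + 1)} of
     (val : cycles M i -> M (i + 1))].

Fact to_cycles_subproof (M : complex R) i (x : M (i + 1 + 1)) :
  cdiff M (i + 1) x \in ker (cdiff M i).
Proof. by apply/kerP; apply: cdiff_comp. Qed.

Definition to_cycles_fun (M : complex R) i (x : M (i + 1 + 1)) : cycles M i :=
  Submod (to_cycles_subproof x).

Fact to_cycles_is_linear (M : complex R) i : linear (@to_cycles_fun M i).
Proof. by move=> a x y; apply: val_inj; rewrite /= linearP. Qed.

HB.instance Definition _ (M : complex R) i := GRing.isLinear.Build R
  (M (i + 1 + 1)) (cycles M i) *:%R (@to_cycles_fun M i)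
  (@to_cycles_is_linear M i).

Definition to_cycles (M : complex R) i : {linear M (i + 1 + 1) -> cycles M i} :=
  [the {linear M (i + 1 + 1) -> cycles M i} of @to_cycles_fun M i].

(* The pure exact sequences are [0 -> Z_(i+2) -> M_(i+2) -> Z_(i+1) -> 0]. *)
Definition pure_acyclic (M : complex R) :=
  acyclic M /\
  forall i, pure_exact (cycles_incl M (i + 1)) (to_cycles M i).

Definition pure_minimal (M : complex R) :=
  forall L : subcomplex M,
    pure_subcomplex L -> pure_acyclic (sub_complex L) ->
    forall i x, x \in L i -> x = 0.

Local Open Scope classical_set_scope.

(* [infimum x0] and [supremum x0] return [x0] on the empty set. *)
Definition flat_dim (M : complex R) : \bar int :=
  infimum +oo%E [set n%:E | n in [set n : int |
    exists F : complex R, [/\ semiflat F, derived_iso M F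
      & forall i, n < i -> forall x : F i, x = 0]]].

Definition sup_degree (F : complex R) : \bar int :=
  supremum -oo%E [set i%:E | i in [set i : int | exists x : F i, x != 0]].

End Purity.

(* Main.v *)
Require Import Defs.
From HB Require Import structures.
From mathcomp Require Import all_boot all_order all_algebra generic_quotient zify.
From mathcomp Require Import boolp classical_sets cardinality constructive_ereal.
From mathcomp.multinomials Require Import freeg.

(** Existence. Every complex has a semi-free, hence semi-flat, resolution [F]
    ([resolution], [semifree_semiflat]). By Zorn's lemma there is a subcomplex [L]
    of [F] that is maximal among those that are acyclic with semi-flat quotient
    ([removable_maximal]); a union of a chain of such subcomplexes is of the same
    kind because an element of a tensor product involves finitely many elements
    only. The projection [F -> F/L] is a quasi-isomorphism. A pure-acyclic pure
    subcomplex of [F/L] has the form [K/L], where [K] is acyclic, and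
    [F/K = (F/L)/(K/L)] is semi-flat, since a pure quotient of a semi-flat complex
    is semi-flat ([pure_quotient_semiflat]). Hence [K = L] by maximality, so that
    [F/L] is pure-minimal.

    The result on pure quotients is usually deduced from the description of
    semi-flat complexes as direct limits of bounded complexes of finitely generated
    free modules. Here it is reduced to the statement that a pure quotient map has
    set-theoretic sections that respect any given finite part of the structure
    ([pure_local_sections]): such a section lifts a cycle of a total tensor product
    to a cycle.

    Flat dimension. Let [F] be pure-minimal and semi-flat, and isomorphic in the
    derived category to a semi-flat complex [G] that vanishes above degree [n]. Let
    [X] be a right module with semi-free resolution [P]. Both [- (x) F] and
    [- (x) G] preserve quasi-isomorphisms ([semiflat_quasi_iso_inj],
    [semiflat_quasi_iso_surj]), and so does [P (x) -] ([semifree_quasi_iso]).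
    Therefore [X (x) F] and [X (x) G] have isomorphic homology, which vanishes above
    [n] ([derived_bounded_tensor]). Consequently the cokernel of [F_(i+1) -> F_i] is
    flat for all [i >= n] ([derived_bounded_flat]), and so is the module [B_i] of
    boundaries, as the kernel of a map between flat modules ([flat_kernel]). Maps
    from a finitely presented module to a flat module lift along surjections
    ([flat_lift]), so the subcomplex [... -> F_(n+2) -> F_(n+1) -> B_n -> 0] is both
    pure and pure-acyclic ([upper_pure], [upper_pure_acyclic]). By minimality it is
    zero, that is, [F] itself vanishes above [n]. *)

Set Implicit Arguments.
Unset Strict Implicit.
Unset Printing Implicit Defensive.

Import Order.TTheory GRing.Theory Num.Theory.
Local Open Scope ring_scope.
Local Open Scope quotient_scope.

(** * Linear algebra over an arbitrary ring *)

Section Builders.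
Variables (R : pzRingType) (V W : lmodType R).

Definition lin_of (f : V -> W) (fl : linear f) : {linear V -> W} :=
  HB.pack f (GRing.isLinear.Build R V W *:%R f fl).

Section Submod.
Variables (P : V -> Prop) (P0 : P 0) (PD : forall x y, P x -> P y -> P (x + y)).
Hypothesis PZ : forall a x, P x -> P (a *: x).

Definition pred_of : {pred V} := fun x => `[< P x >].

Fact pred_of_closed : subsemimod_closed pred_of.
Proof.
split; first split=> [|x y /asboolP xS /asboolP yS].
- by apply/asboolP.
- by apply/asboolP/PD.
by move=> a x /asboolP xS; apply/asboolP/PZ.
Qed.

Definition submod_of : submodClosed V :=
  HB.pack pred_of (GRing.isSubSemiModClosed.Build R V pred_of pred_of_closed).

Lemma submod_ofP x : reflect (P x) (x \in submod_of).
Proof. exact: asboolP. Qed.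

End Submod.

End Builders.

Definition add_of (V W : zmodType) (f : V -> W) (fa : zmod_morphism f) :
  {additive V -> W} := HB.pack f (GRing.isZmodMorphism.Build V W f fa).

Lemma quotmod_piP (R : pzRingType) (V : lmodType R) (S : submodClosed V)
  (u : quotmod S) : exists x, u = quotmod_pi S x.
Proof. by exists (repr u); rewrite /quotmod_pi reprK. Qed.

Lemma quotmod_pi_eq0 (R : pzRingType) (V : lmodType R) (S : submodClosed V) x :
  quotmod_pi S x = 0 <-> x \in S.
Proof.
rewrite -(raddf0 (quotmod_pi S)); split=> [/quotmod_eqP|xS]; first by rewrite subr0.
by apply/quotmod_eqP; rewrite subr0.
Qed.

Lemma raddf_eq (V W : zmodType) (f : {additive V -> W}) :
  (forall x, f x = 0 -> x = 0) -> injective f.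
Proof.
by move=> f0 x y fxy; apply/eqP; rewrite -subr_eq0; apply/eqP/f0; rewrite raddfB fxy subrr.
Qed.

Lemma lin_factor (R : pzRingType) (V A W : lmodType R) (p : {linear V -> A})
    (f : {linear V -> W}) :
  (forall a, exists v, p v = a) -> (forall v, p v = 0 -> f v = 0) ->
  exists h : {linear A -> W}, forall v, h (p v) = f v.
Proof.
move=> /choice[s ps] pf.
have fE v w : p v = p w -> f v = f w.
  move=> pvw; apply/eqP; rewrite -subr_eq0 -raddfB; apply/eqP/pf.
  by rewrite linearB pvw subrr.
have hl : linear (f \o s).
  by move=> a u v /=; rewrite -linearP; apply: fE; rewrite linearP !ps.
by exists (lin_of hl) => v; apply: fE; rewrite ps.
Qed.

(** * Tensor products *)

Section FreeAbelianGroup.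
Variables (K : choiceType) (Z : zmodType).

Definition freeg_lift (f : K -> Z) : {additive {freeg K} -> Z} :=
  add_of (lift_is_additive (f : K -> ssrint.zmodule Z)
    : zmod_morphism (fglift (f : K -> ssrint.zmodule Z) : {freeg K} -> Z)).

Lemma freeg_liftU f k : freeg_lift f << k >> = f k.
Proof. by rewrite /= liftU scale1r. Qed.

Lemma freeg_ind (P : {freeg K} -> Prop) :
  P 0 -> (forall k, P << k >>) -> (forall u v, P u -> P v -> P (u - v)) ->
  forall z, P z.
Proof.
move=> P0 PU PB z.
have PN u : P u -> P (- u) by move=> Pu; rewrite -sub0r; apply: PB.
have PD u v : P u -> P v -> P (u + v).
  by move=> Pu Pv; rewrite -[v]opprK; apply/PB/PN.
rewrite -(freeg_sumE z); elim/big_ind: _ => // k _.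
move: (coeff _ _) => c; have -> : << c *g k >> = << k >> *~ c.
  by rewrite freegU_mulz intz.
case: c => n; rewrite ?NegzE ?mulrNz -?pmulrn.
  by elim: n => [|n IHn]; rewrite ?mulr0n // mulrS; apply: PD.
by apply: PN; elim: n.+1 => [|m IHm]; rewrite ?mulr0n // mulrS; apply: PD.
Qed.

End FreeAbelianGroup.

Section TensorLift.
Variables (R : pzRingType) (X : lmodType R^c) (Y : lmodType R) (Z : zmodType).

Lemma tensor_lift (f : X -> Y -> Z) :
    (forall x x' y, f (x + x') y = f x y + f x' y) ->
    (forall x y y', f x (y + y') = f x y + f x y') ->
    (forall (r : R) x y, f ((r : R^c) *: x) y = f x (r *: y)) ->
  exists F : {additive tensor X Y -> Z}, forall x y, F (tensor_of x y) = f x y.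
Proof.
move=> fDl fDr fZ.
pose GA := freeg_lift (fun k : X * Y => f k.1 k.2).
have GU x y : GA << (x, y) >> = f x y by rewrite freeg_liftU.
have G0 z : tensor_relation z -> GA z = 0.
  elim=> [x x' y|x y y'|r x y||u v _ u0 _ v0].
  - by rewrite raddfB raddfD !GU fDl subrr.
  - by rewrite raddfB raddfD !GU fDr subrr.
  - by rewrite raddfB !GU fZ subrr.
  - exact: raddf0.
  - by rewrite raddfB u0 v0 subrr.
pose F (t : tensor X Y) : Z := GA (tensor_repr t).
have Fpi z : F (tensor_pi z) = GA z.
  apply/eqP; rewrite -subr_eq0 -raddfB G0 ?eqxx //.
  by apply/tensor_relationP/tensor_eqP; rewrite tensor_reprK.
have Fa : zmod_morphism F.
  by move=> t u; rewrite -[t]tensor_reprK -[u]tensor_reprK -raddfB !Fpi raddfB.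
by exists (add_of Fa) => x y; rewrite -GU -Fpi.
Qed.

End TensorLift.

(** The induction principle of the subgroup generated by the pure tensors that
    satisfy [P]. *)
Definition tensor_gen (R : pzRingType) (X : lmodType R^c) (Y : lmodType R)
    (P : X -> Y -> Prop) (t : tensor X Y) :=
  forall Q : tensor X Y -> Prop, Q 0 -> (forall x y, P x y -> Q (tensor_of x y)) ->
    (forall t u, Q t -> Q u -> Q (t - u)) -> Q t.

Lemma tensor_map_surj (R : pzRingType) (X X' : lmodType R^c) (Y Y' : lmodType R)
    (f : {linear X -> X'}) (g : {linear Y -> Y'}) :
  (forall x, exists x', f x' = x) -> (forall y, exists y', g y' = y) ->
  forall t, exists t', tensor_map f g t' = t.
Proof.
move=> fs gs; apply: tensor_ind => [|x y|t u [t' <-] [u' <-]].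
- by exists 0; rewrite raddf0.
- have [x' <-] := fs x; have [y' <-] := gs y.
  by exists (tensor_of x' y'); rewrite tensor_map_of.
- by exists (t' - u'); rewrite raddfB.
Qed.

Lemma tensor_map_sq (R : pzRingType) (X X1 X2 X3 : lmodType R^c)
    (Y Y1 Y2 Y3 : lmodType R)
    (f1 : {linear X -> X1}) (f2 : {linear X1 -> X3})
    (f3 : {linear X -> X2}) (f4 : {linear X2 -> X3})
    (g1 : {linear Y -> Y1}) (g2 : {linear Y1 -> Y3})
    (g3 : {linear Y -> Y2}) (g4 : {linear Y2 -> Y3}) :
  (forall x, f2 (f1 x) = f4 (f3 x)) -> (forall y, g2 (g1 y) = g4 (g3 y)) ->
  forall t, tensor_map f2 g2 (tensor_map f1 g1 t) =
            tensor_map f4 g4 (tensor_map f3 g3 t).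
Proof.
move=> fE gE; apply: tensor_ind => [|x y|t u tE uE]; first by rewrite !raddf0.
  by rewrite !tensor_map_of fE gE.
by rewrite !raddfB /= tE uE.
Qed.

Lemma tensor_map_id (R : pzRingType) (X : lmodType R^c) (Y : lmodType R)
    (f : {linear X -> X}) (g : {linear Y -> Y}) :
  f =1 id -> g =1 id -> tensor_map f g =1 id.
Proof.
move=> fE gE; apply: tensor_ind => [|x y|t u tE uE]; first by rewrite !raddf0.
  by rewrite !tensor_map_of fE gE.
by rewrite !raddfB /= tE uE.
Qed.

Lemma tensor_map_comp (R : pzRingType) (X X1 X2 : lmodType R^c)
    (Y Y1 Y2 : lmodType R)
    (f1 : {linear X -> X1}) (f2 : {linear X1 -> X2}) (f3 : {linear X -> X2})
    (g1 : {linear Y -> Y1}) (g2 : {linear Y1 -> Y2}) (g3 : {linear Y -> Y2}) :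
  (forall x, f2 (f1 x) = f3 x) -> (forall y, g2 (g1 y) = g3 y) ->
  forall t, tensor_map f2 g2 (tensor_map f1 g1 t) = tensor_map f3 g3 t.
Proof.
move=> fE gE; apply: tensor_ind => [|x y|t u tE uE]; first by rewrite !raddf0.
  by rewrite !tensor_map_of fE gE.
by rewrite !raddfB /= tE uE.
Qed.

(** A choice of preimages under [f] and [g] is bilinear modulo the subgroup generated
    by the pure tensors of the stated form, and so it inverts [f (x) g] modulo that
    subgroup. *)
Section RightExact.
Variables (R : pzRingType) (X X' : lmodType R^c) (Y Y' : lmodType R).
Variables (f : {linear X -> X'}) (g : {linear Y -> Y'}).
Hypothesis fs : forall x, exists x', f x' = x.
Hypothesis gs : forall y, exists y', g y' = y.

Lemma tensor_right_exact t :
  tensor_map f g t = 0 -> tensor_gen (fun x y => f x = 0 \/ g y = 0) t.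
Proof.
move=> fgt0.
pose P x y := f x = 0 \/ g y = 0.
pose S : {pred tensor X Y} := fun t => `[< tensor_gen P t >].
have SP u : reflect (tensor_gen P u) (u \in S) by exact: asboolP.
have SC : zmod_closed S.
  split; first by apply/SP=> Q.
  move=> u v /SP uS /SP vS; apply/SP=> Q Q0 QP QB.
  by apply: (QB); [exact: uS | exact: vS].
pose S' : zmodClosed (tensor X Y) := HB.pack S (GRing.isZmodClosed.Build _ S SC).
pose N : zmodType := Quotient.quot S'.
pose p (u : tensor X Y) : N := \pi_(Quotient.quot S') u.
have pa : zmod_morphism p by exact: pi_is_zmod_morphism.
pose pA := add_of pa.
have p0 u : u \in S -> pA u = 0.
  by move=> uS; rewrite -(raddf0 pA); apply/eqmodP; rewrite -[u]subr0 in uS.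
have [sf sfE] := choice fs; have [sg sgE] := choice gs.
pose b x y := pA (tensor_of (sf x) (sg y)).
have b0 x y : P x y -> pA (tensor_of x y) = 0.
  by move=> Pxy; apply/p0/SP => Q _ QP _; apply: QP.
have bl x x' y : f x = f x' -> pA (tensor_of x y) = pA (tensor_of x' y).
  move=> fx; rewrite -[x](subrK x') tensor_ofDl raddfD b0 ?add0r //.
  by left; rewrite linearB fx subrr.
have br x y y' : g y = g y' -> pA (tensor_of x y) = pA (tensor_of x y').
  move=> gy; rewrite -[y](subrK y') tensor_ofDr raddfD b0 ?add0r //.
  by right; rewrite linearB gy subrr.
have [||r x y|F FE] := @tensor_lift _ _ _ _ b.
- move=> x x' y; rewrite /b -raddfD -tensor_ofDl.
  by apply: bl; rewrite linearD !sfE.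
- move=> x y y'; rewrite /b -raddfD -tensor_ofDr.
  by apply: br; rewrite linearD !sgE.
- rewrite /b (bl _ ((r : R^c) *: sf x)); last by rewrite linearZ_LR !sfE.
  by rewrite tensor_ofZ; apply: br; rewrite linearZ_LR !sgE.
have Fp u : F (tensor_map f g u) = pA u.
  elim/tensor_ind: u => [|x y|u v uE vE]; first by rewrite !raddf0.
    rewrite tensor_map_of FE /b (bl _ x) ?sfE //.
    by apply: br; rewrite sgE.
  by rewrite !raddfB /= uE vE.
have pt0 : pA t = pA 0 by rewrite -Fp fgt0 !raddf0.
have /eqmodP tS : t = 0 %[mod Quotient.quot S'] by exact: pt0.
by apply/SP; rewrite -[t]subr0.
Qed.

End RightExact.

(** * Direct sums and free modules *)

Section DirectSumTheory.
Variables (I : choiceType) (A : I -> zmodType).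

Fact dsum_single_finite i (x : A i) :
  finite_set [set j | dfwith (fun j => 0 : A j) x j != 0].
Proof.
apply: (sub_finite_set _ (finite_set1 i)) => j /=.
by case: dfwithP => [//|k _]; rewrite eqxx.
Qed.

Definition dsum_single i (x : A i) : dsum A := DSum (dsum_single_finite x).

Lemma dsum_singleE i (x : A i) : dsum_single x i = x.
Proof. exact: dfwith_in. Qed.

Lemma dsum_single_out i j (x : A i) : i != j -> dsum_single x j = 0.
Proof. exact: dfwith_out. Qed.

Lemma dsum_supp (t : dsum A) :
  exists s : seq I, uniq s /\ forall i, t i != 0 -> i \in s.
Proof.
have /finite_seqP[s sE] := dsum_finite t; exists (undup s); split=> [|i ti].
  exact: undup_uniq.
by rewrite mem_undup; have : [set i | t i != 0]%classic i by []; rewrite sE.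
Qed.

Lemma dsum_ind (P : dsum A -> Prop) :
  P 0 -> (forall i (x : A i), P (dsum_single x)) ->
  (forall t u, P t -> P u -> P (t + u)) -> forall t, P t.
Proof.
move=> P0 P1 PD t; have [s [_ ts]] := dsum_supp t.
elim: s t ts => [|i s IHs] t ts.
  suff -> : t = 0 by [].
  by apply: dsum_eqP => i; apply/eqP; apply: contraT => /ts.
rewrite -[t](subrK (dsum_single (t i))); apply: PD => //.
apply: IHs => j; rewrite dsum_addE dsum_oppE.
have [<-|ij] := eqVneq i j; first by rewrite dsum_singleE subrr eqxx.
rewrite dsum_single_out // subr0 => /ts; rewrite inE eq_sym (negPf ij) //.
Qed.

End DirectSumTheory.

Section DirectSumMap.
Variables (I : choiceType) (A B : I -> zmodType).
Variable (f : forall i, {additive A i -> B i}).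

Fact dsum_map_finite (t : dsum A) : finite_set [set i | f i (t i) != 0].
Proof.
apply: sub_finite_set (dsum_finite t) => i /=.
by apply: contra => /eqP ->; rewrite raddf0.
Qed.

Definition dsum_map_fun (t : dsum A) : dsum B := DSum (dsum_map_finite t).

Fact dsum_map_is_zmod_morphism : zmod_morphism dsum_map_fun.
Proof. by move=> t u; apply: dsum_eqP => i; exact: raddfB. Qed.

Definition dsum_map : {additive dsum A -> dsum B} :=
  add_of dsum_map_is_zmod_morphism.

Lemma dsum_mapE t i : dsum_map t i = f i (t i). Proof. by []. Qed.

Lemma dsum_map_single i (x : A i) : dsum_map (dsum_single x) = dsum_single (f i x).
Proof.
apply: dsum_eqP => j; rewrite dsum_mapE.
have [<-|ij] := eqVneq i j; first by rewrite !dsum_singleE.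
by rewrite !dsum_single_out // raddf0.
Qed.

Lemma dsum_map_surj :
  (forall i y, exists x, f i x = y) -> forall u, exists t, dsum_map t = u.
Proof.
move=> fs; apply: dsum_ind => [|i y|t u [t' <-] [u' <-]].
- by exists 0; rewrite raddf0.
- by have [x <-] := fs i y; exists (dsum_single x); rewrite dsum_map_single.
- by exists (t' + u'); rewrite raddfD.
Qed.

End DirectSumMap.

Section FreeModule.
Variables (R : pzRingType) (I : choiceType).

Definition freemod := dsum (fun _ : I => R : zmodType).
HB.instance Definition _ := GRing.Zmodule.on freemod.

Fact freemod_scale_finite (a : R) (t : freemod) :
  finite_set [set i | a * t i != 0].
Proof.
apply: sub_finite_set (dsum_finite t) => i /=.
by apply: contra => /eqP ->; rewrite mulr0.
Qed.

Definition freemod_scale a t : freemod := DSum (freemod_scale_finite a t).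

Fact freemod_scaleA a b t :
  freemod_scale a (freemod_scale b t) = freemod_scale (a * b) t.
Proof. by apply: dsum_eqP => i /=; rewrite mulrA. Qed.

Fact freemod_scale1 t : freemod_scale 1 t = t.
Proof. by apply: dsum_eqP => i /=; rewrite mul1r. Qed.

Fact freemod_scaleDr a t u :
  freemod_scale a (t + u) = freemod_scale a t + freemod_scale a u.
Proof. by apply: dsum_eqP => i /=; rewrite mulrDr. Qed.

Fact freemod_scaleDl t a b :
  freemod_scale (a + b) t = freemod_scale a t + freemod_scale b t.
Proof. by apply: dsum_eqP => i /=; rewrite mulrDl. Qed.

HB.instance Definition _ := GRing.Zmodule_isLmodule.Build R freemod
  freemod_scaleA freemod_scale1 freemod_scaleDr freemod_scaleDl.

Lemma freemod_addE (t u : freemod) i : (t + u) i = t i + u i.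
Proof. by []. Qed.

Lemma freemod_scaleE a (t : freemod) i : (a *: t) i = a * t i.
Proof. by []. Qed.

Definition fbasis (i : I) : freemod :=
  dsum_single (A := fun _ => R : zmodType) (i := i) (1 : R).

Lemma fbasisE i j : fbasis i j = (i == j)%:R.
Proof.
have [<-|ij] := eqVneq i j; first exact: dsum_singleE.
exact: dsum_single_out.
Qed.

Lemma fsingleE i (a : R) :
  dsum_single (A := fun _ : I => R : zmodType) (i := i) a = a *: fbasis i :> freemod.
Proof.
apply: dsum_eqP => j; rewrite freemod_scaleE fbasisE.
have [<-|ij] := eqVneq i j; first by rewrite mulr1 dsum_singleE.
by rewrite mulr0 dsum_single_out.
Qed.

Lemma freemod_ind (P : freemod -> Prop) :
  P 0 -> (forall i a, P (a *: fbasis i)) ->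
  (forall t u, P t -> P u -> P (t + u)) -> forall t, P t.
Proof.
by move=> P0 P1 PD; apply: dsum_ind => // i a; rewrite fsingleE.
Qed.

Lemma freemod_sum (t : freemod) :
  exists k (c : 'I_k -> R) (s : 'I_k -> I),
    t = \sum_j c j *: fbasis (s j) /\ forall j, t (s j) != 0.
Proof.
have [s0 [s0U s0P]] := dsum_supp t.
pose s := [seq i <- s0 | t i != 0].
have sU : uniq s by exact: filter_uniq.
have sP i : t i != 0 -> i \in s by move=> ti; rewrite mem_filter ti s0P.
have sN i : i \in s -> t i != 0 by rewrite mem_filter => /andP[].
pose T := in_tuple s.
exists (size s), (fun j => t (tnth T j)), (tnth T); split; last first.
  by move=> j; apply: sN; exact: mem_tnth.
have -> : \sum_j t (tnth T j) *: fbasis (tnth T j) = \sum_(i <- s) t i *: fbasis i.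
  by rewrite [RHS](big_tnth _ _ s).
apply: dsum_eqP => i.
have E (r : seq I) :
    (\sum_(i <- r) t i *: fbasis i : freemod) i = \sum_(j <- r) t j * (j == i)%:R.
  elim: r => [|j r IHr]; first by rewrite !big_nil.
  by rewrite !big_cons freemod_addE IHr freemod_scaleE fbasisE.
rewrite E; have [/sP is_|] := boolP (t i != 0).
  rewrite (bigD1_seq i) //= eqxx mulr1 big1 ?addr0 // => j ji.
  by rewrite (negPf ji) mulr0.
rewrite negbK => /eqP ti; rewrite ti big1_seq // => j /= js.
by case: eqVneq => [ji|]; rewrite ?mulr0 // ji ti mul0r.
Qed.

Lemma freemod_lift (W : lmodType R) (u : I -> W) :
  exists F : {linear freemod -> W}, forall i, F (fbasis i) = u i.
Proof.
have [S SP] : exists S : freemod -> seq I, forall t, uniq (S t) /\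
    forall i, t i != 0 -> i \in S t.
  by have /choice[S SP] := @dsum_supp _ (fun _ : I => R : zmodType); exists S.
pose F (t : freemod) : W := \sum_(i <- S t) t i *: u i.
have FE (t : freemod) s : uniq s -> (forall i, t i != 0 -> i \in s) ->
    F t = \sum_(i <- s) t i *: u i.
  move=> sU st; have [SU St] := SP t.
  have E (r : seq I) : \sum_(i <- r) t i *: u i =
      \sum_(i <- [seq i <- r | t i != 0]) t i *: u i.
    rewrite big_filter [LHS]big_mkcond [RHS]big_mkcond; apply: eq_bigr => i _.
    by case: eqP => [->|//]; rewrite scale0r.
  rewrite /F E [RHS]E; apply: perm_big; apply: uniq_perm; rewrite ?filter_uniq //.
  move=> i; rewrite !mem_filter; case: (boolP (t i != 0)) => //= ti.
  by rewrite St ?st.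
have Fl : linear F.
  move=> a t v; pose s := undup (S t ++ S v).
  have sU : uniq s by exact: undup_uniq.
  have ts i : t i != 0 -> i \in s.
    by move=> ti; rewrite mem_undup mem_cat; have [_ ->] := SP t.
  have vs i : v i != 0 -> i \in s.
    by move=> vi; rewrite mem_undup mem_cat; have [_ ->] := SP v; rewrite ?orbT.
  rewrite (FE t s) // (FE v s) // (FE (a *: t + v) s) //; last first.
    move=> i; rewrite -[_ i]/(a * t i + v i).
    have [/vs //|] := boolP (v i != 0); rewrite negbK => /eqP ->; rewrite addr0.
    have [/ts //|] := boolP (t i != 0); rewrite negbK => /eqP ->.
    by rewrite mulr0 eqxx.
  rewrite scaler_sumr -big_split /=; apply: eq_bigr => i _.
  by rewrite scalerDl scalerA.
exists (lin_of Fl) => i /=; rewrite (FE _ [:: i]) //.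
  by rewrite big_seq1 fbasisE eqxx scale1r.
by move=> j; rewrite fbasisE inE; case: (eqVneq i j) => // _; rewrite eqxx.
Qed.

End FreeModule.

(** * Flat modules *)

Section TensorSums.
Variables (R : pzRingType) (V : lmodType R^c) (C : lmodType R).
Variable n : nat.

Lemma tensor_of_suml (F : 'I_n -> V) (y : C) :
  tensor_of (\sum_k F k) y = \sum_k tensor_of (F k) y.
Proof.
apply: (big_morph (fun x => tensor_of x y)) => [u v|]; first exact: tensor_ofDl.
exact: tensor_of0l.
Qed.

Lemma tensor_of_sumr (x : V) (F : 'I_n -> C) :
  tensor_of x (\sum_k F k) = \sum_k tensor_of x (F k).
Proof.
apply: (big_morph (fun y => tensor_of x y)) => [u v|]; first exact: tensor_ofDr.
exact: tensor_of0r.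
Qed.

End TensorSums.

Section Contraction.
Variables (R : pzRingType) (V : lmodType R^c) (C : lmodType R).

Lemma tensor_contract (phi : V -> R) :
    (forall x y, phi (x + y) = phi x + phi y) ->
    (forall (r : R) x, phi ((r : R^c) *: x) = phi x * r) ->
  exists F : {additive tensor V C -> C},
    forall x y, F (tensor_of x y) = phi x *: y.
Proof.
move=> phiD phiZ; apply: tensor_lift => [x x' y|x y y'|r x y].
- by rewrite phiD scalerDl.
- by rewrite scalerDr.
- by rewrite phiZ scalerA.
Qed.

Lemma tensor_contractr (phi : C -> R) :
    (forall x y, phi (x + y) = phi x + phi y) ->
    (forall (r : R) x, phi (r *: x) = r * phi x) ->
  exists F : {additive tensor V C -> V},
    forall x y, F (tensor_of x y) = (phi y : R^c) *: x.
Proof.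
move=> phiD phiZ; apply: tensor_lift => [x x' y|x y y'|r x y].
- by rewrite scalerDr.
- by rewrite phiD -scalerDl.
- by rewrite phiZ scalerA.
Qed.

End Contraction.

(** The map [Q] is injective modulo its kernel, and flatness preserves the injection
    of [V / ker Q] into [V']. *)
Lemma flat_exact (R : pzRingType) (C : lmodType R) (V V' : lmodType R^c)
    (Q : {linear V -> V'}) (t : tensor V C) :
  flat C -> tensor_map Q (id_lin C) t = 0 ->
  tensor_gen (fun v _ => Q v = 0) t.
Proof.
move=> Cflat Qt; pose S := [the submodClosed V of ker Q].
pose p := [the {linear V -> quotmod S} of quotmod_pi S].
have ps a : exists v, p v = a by have [v ->] := quotmod_piP a; exists v.
have p0 v : p v = 0 -> Q v = 0.
  by move=> /quotmod_pi_eq0 /kerP.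
have [Q' Q'p] := lin_factor ps p0.
have Q'inj : injective Q'.
  apply: raddf_eq => u; have [v ->] := quotmod_piP u => /= Q'v.
  by apply/quotmod_pi_eq0/kerP; rewrite -Q'p.
have : tensor_map p (id_lin C) t = 0.
  apply: (Cflat _ _ Q' Q'inj); rewrite raddf0 -[RHS]Qt.
  by apply: tensor_map_comp => //.
move=> /tensor_right_exact H P P0 Pp PB; apply: H => //.
- by move=> y; exists y.
- move=> x y [/p0 /Pp //|]; rewrite /= => ->; by rewrite tensor_of0r.
Qed.

(** This is the equational criterion. The images [c_i] of the generators of [A]
    satisfy the relations [q], which means that the matrix [q] kills the element
    [t0 = sum_i e_i (x) c_i]. By flatness, [t0] is a sum of tensors [k (x) d] with
    [q k = 0]; a lift [g] of [d] then gives the map [e_i |-> k_i g], which respects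
    the relations. *)
Lemma flat_lift (R : pzRingType) (C A G : lmodType R) (p : {linear G -> C})
    (w : {linear A -> C}) :
  flat C -> finitely_presented A -> (forall c, exists g, p g = c) ->
  exists h : {linear A -> G}, forall a, p (h a) = w a.
Proof.
move=> Cflat [m [n [q [pA [pAk pAs]]]]] ps.
pose qq (k : 'I_m) (i : 'I_n) : R := q (delta_mx 0 k) 0 i.
pose V : lmodType R^c := 'rV[R^c]_n; pose V' : lmodType R^c := 'rV[R^c]_m.
pose Qf (v : V) : V' := \row_k (\sum_i qq k i * (v 0 i : R)).
have Ql : linear Qf.
  move=> a u v; apply/rowP => k; rewrite !mxE.
  rewrite [_ * _ in RHS]mulr_suml -big_split; apply: eq_bigr => i _.
  by rewrite !mxE -[(a * _)]/((u 0 i : R) * (a : R)) mulrDr mulrA.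
pose Q := lin_of Ql.
pose e (i : 'I_n) : V := delta_mx 0 i.
pose c i := w (pA (delta_mx 0 i)).
pose t0 : tensor V C := \sum_i tensor_of (e i) (c i).
have qE k : q (delta_mx 0 k) = \sum_i qq k i *: delta_mx 0 i.
  by rewrite {1}[q _]row_sum_delta.
have relc k : \sum_i qq k i *: c i = 0.
  have {2}<- : w (pA (q (delta_mx 0 k))) = 0.
    by have -> : pA (q (delta_mx 0 k)) = 0; [apply/pAk; exists (delta_mx 0 k) | rewrite raddf0].
  by rewrite qE !raddf_sum /=; apply: eq_bigr => i _; rewrite !linearZ_LR.
have Qt0 : tensor_map Q (id_lin C) t0 = 0.
  rewrite raddf_sum /=.
  have -> : \sum_i tensor_map Q (id_lin C) (tensor_of (e i) (c i)) =
      \sum_i \sum_k tensor_of (delta_mx 0 k : V') (qq k i *: c i).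
    apply: eq_bigr => i _; rewrite tensor_map_of /=.
    have -> : Qf (e i) = \sum_k (qq k i : R^c) *: (delta_mx 0 k : V').
      apply/rowP => k; rewrite mxE summxE (bigD1 i) //= big1 ?addr0; last first.
        by move=> j ji; rewrite mxE (negPf ji) andbF mulr0.
      rewrite (bigD1 k) //= big1 ?addr0; last first.
        move=> j jk; rewrite !mxE eq_sym (negPf jk) andbF.
        by rewrite -[_ * _]/((0 : R) * _) mul0r.
      rewrite !mxE !eqxx -[RHS]/((1 : R) * (qq k i)) mul1r /=; exact: (mulr1 (qq k i)).
    by rewrite tensor_of_suml; apply: eq_bigr => k _; rewrite tensor_ofZ.
  rewrite exchange_big /= big1 // => k _.
  by rewrite -tensor_of_sumr relc tensor_of0r.
have /choice[co coE] i : exists F : {additive tensor V C -> C},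
    forall x y, F (tensor_of x y) = (x 0 i : R) *: y.
  have [x y|r x|F FE] := @tensor_contract R V C (fun x : V => x 0 i : R).
  - by rewrite mxE.
  - by rewrite mxE.
  by exists F.
have [h [hq hE]] : exists h : {linear 'rV[R]_n -> G},
    (forall v, h (q v) = 0) /\ forall i, p (h (delta_mx 0 i)) = co i t0.
  pose PQ t := exists h : {linear 'rV[R]_n -> G},
    (forall v, h (q v) = 0) /\ forall i, p (h (delta_mx 0 i)) = co i t.
  suff : PQ t0 by [].
  apply: (flat_exact Cflat Qt0); rewrite /PQ.
  - have l0 : linear (fun _ : 'rV[R]_n => 0 : G).
      by move=> a x y; rewrite scaler0 addr0.
    by exists (lin_of l0); split=> // i /=; rewrite !raddf0.
  - move=> k d Qk; have [g gd] := ps d.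
    have hl : linear (fun v : 'rV[R]_n => (\sum_i v 0 i * (k 0 i : R)) *: g).
      move=> a x y; rewrite scalerA -scalerDl mulr_sumr -big_split; congr (_ *: _).
      by apply: eq_bigr => i _; rewrite !mxE mulrDl mulrA.
    exists (lin_of hl); split=> [v|i] /=.
      have -> : \sum_i q v 0 i * (k 0 i : R) = 0; last by rewrite scale0r.
      rewrite {1}[v]row_sum_delta raddf_sum /=.
      under eq_bigr => i _.
        rewrite summxE mulr_suml.
        under eq_bigr => j _ do rewrite linearZ /= mxE -mulrA.
        over.
      rewrite exchange_big /= big1 // => j _.
      rewrite -mulr_sumr; have /rowP/(_ j) := Qk; rewrite !mxE => ->.
      by rewrite mulr0.
    rewrite linearZ /= gd coE (bigD1 i) //= big1 ?addr0; last first.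
      by move=> j ji; rewrite mxE (negPf ji) andbF mul0r.
    by rewrite mxE !eqxx mul1r.
  - move=> t u [h [hq hE]] [h' [h'q h'E]].
    have hl : linear (fun v => h v - h' v).
      by move=> a x y; rewrite (linearP h) (linearP h') scalerBr opprD addrACA.
    exists (lin_of hl); split=> [v|i] /=; first by rewrite hq h'q subrr.
    by rewrite !raddfB /= hE h'E.
have coc i : co i t0 = c i.
  rewrite /t0 raddf_sum (bigD1 i) //= coE mxE !eqxx scale1r big1 ?addr0 // => j ji.
  by rewrite coE mxE eq_sym (negPf ji) andbF scale0r.
have pAh v : pA v = 0 -> h v = 0 by move=> /pAk[u <-].
have [h' h'E] := lin_factor pAs pAh; exists h' => a.
have [v <-] := pAs a; rewrite h'E.
rewrite [v]row_sum_delta !raddf_sum /=; apply: eq_bigr => i _.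
by rewrite !linearZ /= hE coc.
Qed.

(** * Bases and tensor products *)

(** The field [bspan] says that the vectors span [B], as an induction principle. *)
Record basis (R : pzRingType) (B : lmodType R) (I : choiceType) := Basis {
  bvec : I -> B;
  bco : I -> B -> R;
  bcoD : forall i x y, bco i (x + y) = bco i x + bco i y;
  bcoZ : forall i a x, bco i (a *: x) = a * bco i x;
  bco_vec : forall i j, bco i (bvec j) = (j == i)%:R;
  bspan : forall Q : B -> Prop, Q 0 -> (forall a i, Q (a *: bvec i)) ->
    (forall x y, Q x -> Q y -> Q (x + y)) -> forall x, Q x }.

Definition freemod_basis (R : pzRingType) (I : choiceType) : basis (freemod R I) I :=
  @Basis R (freemod R I) I (@fbasis R I) (fun i t => t i) (fun i x y => erefl)
    (fun i a x => erefl) (fun i j => fbasisE R j i)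
    (fun Q Q0 Q1 QD => freemod_ind Q0 (fun i a => Q1 a i) QD).

Section BasisTensor.
Variables (R : pzRingType) (I : choiceType).

(** Tensoring with a free module amounts to taking finitely supported families of
    coefficients [c]. *)
Lemma basis_tensor_r (X : lmodType R^c) (B : lmodType R) (b : basis B I) :
  exists c : I -> {additive tensor X B -> X},
    (forall i x y, c i (tensor_of x y) = (bco b i y : R^c) *: x) /\
    forall t, exists s : seq I, [/\ uniq s, (forall i, i \notin s -> c i t = 0) &
      t = \sum_(i <- s) tensor_of (c i t) (bvec b i)].
Proof.
have /choice[c cE] i : exists F : {additive tensor X B -> X},
    forall x y, F (tensor_of x y) = (bco b i y : R^c) *: x.
  by have [|r x|F FE] := @tensor_contractr R X B (bco b i);
    [exact: bcoD | exact: bcoZ | exists F].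
exists c; split=> // t.
have [s sP] : exists s : seq I, forall s', uniq s' -> {subset s <= s'} ->
    t = \sum_(i <- s') tensor_of (c i t) (bvec b i).
  pose S u := exists s : seq I, forall s', uniq s' -> {subset s <= s'} ->
    u = \sum_(i <- s') tensor_of (c i u) (bvec b i).
  have SB u v : S u -> S v -> S (u - v).
    move=> [s sP] [s' s'P]; exists (s ++ s') => r rU sr.
    have uE : u = \sum_(i <- r) tensor_of (c i u) (bvec b i).
      by apply: sP => // i si; apply: sr; rewrite mem_cat si.
    have vE : v = \sum_(i <- r) tensor_of (c i v) (bvec b i).
      by apply: s'P => // i si; apply: sr; rewrite mem_cat si orbT.
    transitivity (\sum_(i <- r) tensor_of (c i u) (bvec b i) -
      \sum_(i <- r) tensor_of (c i v) (bvec b i)).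
      exact: (congr2 (fun x y => x - y) uE vE).
    rewrite -sumrB; apply: eq_bigr => i _; apply/eqP.
    by rewrite subr_eq -tensor_ofDl raddfB /= subrK.
  have S0 : S 0.
    by exists [::] => s' _ _; rewrite big1 // => i _; rewrite raddf0 tensor_of0l.
  elim/tensor_ind: t => // x.
  apply: (@bspan _ _ _ b (fun y => S (tensor_of x y))) => [|a i|y y' yS y'S].
  - by rewrite tensor_of0r.
  - exists [:: i] => s' s'U is_; rewrite -tensor_ofZ (bigD1_seq i) //=; last first.
      by apply: is_; rewrite inE.
    rewrite cE bco_vec eqxx scale1r big1 ?addr0 // => j ji.
    by rewrite cE bco_vec eq_sym (negPf ji) scale0r tensor_of0l.
  - rewrite tensor_ofDr -[tensor_of x y']opprK; apply: (SB) => //.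
    by rewrite -sub0r; apply: SB.
exists (undup s); have tE : t = \sum_(i <- undup s) tensor_of (c i t) (bvec b i).
  by apply: sP; [exact: undup_uniq | move=> i; rewrite mem_undup].
split=> //; first exact: undup_uniq.
move=> i is_; rewrite tE raddf_sum big1_seq // => j /= js.
rewrite cE bco_vec; have [ji|_] := eqVneq j i; last by rewrite scale0r.
by rewrite -ji js in is_.
Qed.

Lemma basis_tensor_l (M : lmodType R) (B : lmodType R^c) (b : basis B I) :
  exists c : I -> {additive tensor B M -> M},
    (forall i x y, c i (tensor_of x y) = (bco b i x : R) *: y) /\
    forall t, exists s : seq I, [/\ uniq s, (forall i, i \notin s -> c i t = 0) &
      t = \sum_(i <- s) tensor_of (bvec b i) (c i t)].
Proof.
have /choice[c cE] i : exists F : {additive tensor B M -> M},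
    forall x y, F (tensor_of x y) = (bco b i x : R) *: y.
  have [|r x|F FE] := @tensor_contract R B M (bco b i); first exact: bcoD.
    by have := bcoZ b i (r : R^c) x.
  by exists F.
exists c; split=> // t.
have [s sP] : exists s : seq I, forall s', uniq s' -> {subset s <= s'} ->
    t = \sum_(i <- s') tensor_of (bvec b i) (c i t).
  pose S u := exists s : seq I, forall s', uniq s' -> {subset s <= s'} ->
    u = \sum_(i <- s') tensor_of (bvec b i) (c i u).
  have SB u v : S u -> S v -> S (u - v).
    move=> [s sP] [s' s'P]; exists (s ++ s') => r rU sr.
    have uE : u = \sum_(i <- r) tensor_of (bvec b i) (c i u).
      by apply: sP => // i si; apply: sr; rewrite mem_cat si.
    have vE : v = \sum_(i <- r) tensor_of (bvec b i) (c i v).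
      by apply: s'P => // i si; apply: sr; rewrite mem_cat si orbT.
    transitivity (\sum_(i <- r) tensor_of (bvec b i) (c i u) -
      \sum_(i <- r) tensor_of (bvec b i) (c i v)).
      exact: (congr2 (fun x y => x - y) uE vE).
    rewrite -sumrB; apply: eq_bigr => i _; apply/eqP.
    by rewrite subr_eq -tensor_ofDr raddfB /= subrK.
  have S0 : S 0.
    by exists [::] => s' _ _; rewrite big1 // => i _; rewrite raddf0 tensor_of0r.
  elim/tensor_ind: t => // x y; move: x.
  apply: (@bspan _ _ _ b (fun x => S (tensor_of x y))) => [|a i|x x' xS x'S].
  - by rewrite tensor_of0l.
  - exists [:: i] => s' s'U is_; rewrite tensor_ofZ (bigD1_seq i) //=; last first.
      by apply: is_; rewrite inE.
    rewrite cE bco_vec eqxx scale1r big1 ?addr0 // => j ji.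
    by rewrite cE bco_vec eq_sym (negPf ji) scale0r tensor_of0r.
  - rewrite tensor_ofDl -[tensor_of x' y]opprK; apply: (SB) => //.
    by rewrite -sub0r; apply: SB.
exists (undup s); have tE : t = \sum_(i <- undup s) tensor_of (bvec b i) (c i t).
  by apply: sP; [exact: undup_uniq | move=> i; rewrite mem_undup].
split=> //; first exact: undup_uniq.
move=> i is_; rewrite tE raddf_sum big1_seq // => j /= js.
rewrite cE bco_vec; have [ji|_] := eqVneq j i; last by rewrite scale0r.
by rewrite -ji js in is_.
Qed.

(** Tensoring with a free right module preserves injections, because the
    coordinates are natural. *)
Lemma free_tensor_inj (B : lmodType R^c) (b : basis B I) (M N : lmodType R)
    (f : {linear M -> N}) :
  injective f -> injective (tensor_map (id_lin B) f).
Proof.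
move=> finj; apply: raddf_eq => t /= ft0.
have [c [cE cP]] := basis_tensor_l M b; have [d [dE _]] := basis_tensor_l N b.
have cd i u : d i (tensor_map (id_lin B) f u) = f (c i u).
  elim/tensor_ind: u => [|x y|u v uE vE]; first by rewrite !raddf0.
    by rewrite tensor_map_of dE cE linearZ_LR.
  by rewrite !raddfB /= uE vE.
have [s [_ _ ->]] := cP t; rewrite big1 // => i _.
suff -> : c i t = 0 by rewrite tensor_of0r.
by apply: finj; rewrite raddf0 -cd ft0 raddf0.
Qed.

End BasisTensor.

Lemma id_lin_surj (R : pzRingType) (V : lmodType R) (v : V) :
  exists u, id_lin V u = v.
Proof. by exists v. Qed.

Section KernelFlat.
Variables (R : pzRingType) (K G C : lmodType R).
Variables (f : {linear K -> G}) (p : {linear G -> C}).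
Hypotheses (finj : injective f) (ps : forall c, exists g, p g = c).
Hypothesis fp : forall y, p y = 0 <-> exists x, f x = y.
Hypothesis Cflat : flat C.

(** The vanishing of [Tor_1(X, C)], by a diagram chase over a free cover of [X] with
    kernel [Q]. *)
Lemma flat_quotient_tensor_inj (X : lmodType R^c) :
  injective (tensor_map (id_lin X) f).
Proof.
apply: raddf_eq => t /= ft0.
pose P := freemod R^c X.
have [pi piE] : exists pi : {linear P -> X}, forall x, pi (fbasis R^c x) = x.
  exact: freemod_lift.
have pis x : exists u, pi u = x by exists (fbasis R^c x).
have [u ut] := tensor_map_surj (g := id_lin K) pis (@id_lin_surj _ _) t.
pose Q := submod [the submodClosed P of ker pi].
pose j : {linear Q -> P} := [the {linear Q -> P} of (val : Q -> P)].
have jinj : injective j by exact: val_inj.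
have [q qE] : exists q : tensor Q G, tensor_map j (id_lin G) q = tensor_map (id_lin P) f u.
  have /(tensor_right_exact pis (@id_lin_surj _ _)) gen :
      tensor_map pi (id_lin G) (tensor_map (id_lin P) f u) = 0.
    rewrite -[RHS]ft0 -ut; exact: tensor_map_sq.
  apply: (gen (fun v => exists q, tensor_map j (id_lin G) q = v)) => [|x y|a b [q <-] [q' <-]].
  - by exists 0; rewrite raddf0.
  - case=> [pix|/= ->]; last by exists 0; rewrite raddf0 tensor_of0r.
    have xk : x \in ker pi by apply/kerP.
    by exists (tensor_of (Submod xk : Q) y); rewrite tensor_map_of.
  - by exists (q - q'); rewrite raddfB.
have [k kE] : exists k : tensor Q K, tensor_map (id_lin Q) f k = q.
  have q0 : tensor_map (id_lin Q) p q = 0.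
    apply: (Cflat jinj); rewrite raddf0.
    rewrite tensor_map_exchange qE.
    rewrite (tensor_map_comp (f3 := id_lin P) (g3 := p \o f)) //.
    elim/tensor_ind: (u) => [|x y|a b aE bE]; first by rewrite raddf0.
      rewrite tensor_map_of /=; have -> : p (f y) = 0 by apply/fp; exists y.
      by rewrite tensor_of0r.
    by rewrite raddfB /= aE bE subrr.
  have gen := tensor_right_exact (@id_lin_surj _ Q) ps q0.
  apply: (gen (fun q => exists k, tensor_map (id_lin Q) f k = q)) => [|x y|a b [k <-] [k' <-]].
  - by exists 0; rewrite raddf0.
  - case=> [/= ->|/fp[z <-]]; first by exists 0; rewrite raddf0 tensor_of0l.
    by exists (tensor_of x z); rewrite tensor_map_of.
  - by exists (k - k'); rewrite raddfB.
have uE : u = tensor_map j (id_lin K) k.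
  apply: (free_tensor_inj (freemod_basis R^c X) finj).
  rewrite -/P -qE -kE; exact: tensor_map_exchange.
rewrite -ut uE.
elim/tensor_ind: (k) => [|x y|a b aE bE]; first by rewrite !raddf0.
  rewrite !tensor_map_of /=; have /kerP -> : val x \in ker pi by exact: valP.
  by rewrite tensor_of0l.
by rewrite !raddfB /= aE bE subrr.
Qed.

Lemma flat_kernel : flat G -> flat K.
Proof.
move=> Gflat A B h hinj; apply: raddf_eq => t /= ht0.
apply: (@flat_quotient_tensor_inj A); rewrite raddf0.
apply: (Gflat _ _ h hinj); rewrite raddf0.
by rewrite tensor_map_exchange ht0 raddf0.
Qed.

End KernelFlat.

(** * Total tensor products *)

Lemma dep_choice (I : Type) (T : I -> Type) (P : forall i, T i -> Prop) :
  (forall i, exists x, P i x) -> exists f : forall i, T i, forall i, P i (f i).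
Proof. by move=> /(_ _)/cid-/all_sig[f fP]; exists f. Qed.

Lemma int_succ (i : int) : exists j, i = j + 1.
Proof. by exists (i - 1); rewrite subrK. Qed.

Lemma tot_index_left_surj n (b : tot_index (n + 1)) :
  exists a : tot_index n, b = tot_index_left a.
Proof.
case: b => [[i j] /= ij]; have [k iE] := int_succ i; subst i.
have kj : k + j == n by rewrite -(inj_eq (addIr 1)) addrAC.
by exists (exist _ (k, j) kj); apply: val_inj.
Qed.

Lemma tot_index_right_surj n (b : tot_index (n + 1)) :
  exists a : tot_index n, b = tot_index_right a.
Proof.
case: b => [[i j] /= ij]; have [k jE] := int_succ j; subst j.
have ik : i + k == n by rewrite -(inj_eq (addIr 1)) -addrA.
by exists (exist _ (i, k) ik); apply: val_inj.
Qed.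

Definition surjective_map (R : pzRingType) (L M : complex R) (f : chain_map L M) :=
  forall i y, exists x, f i x = y.

Lemma chain_factor (R : pzRingType) (F G H : complex R) (p : chain_map F G)
    (f : chain_map F H) :
  surjective_map p -> (forall i x, p i x = 0 -> f i x = 0) ->
  exists h : chain_map G H, forall i x, h i (p i x) = f i x.
Proof.
move=> ps pf.
have /dep_choice[h hE] i : exists h : {linear G i -> H i}, forall x, h (p i x) = f i x.
  by apply: lin_factor => [a|x]; [exact: ps | exact: pf].
have hd i x : cdiff H i (h (i + 1) x) = h i (cdiff G i x).
  by have [y <-] := ps (i + 1) x; rewrite hE !cmap_diff hE.
by exists (ChainMap hd).
Qed.

Section TotMap.
Variables (R : pzRingType) (X X' : complex R^c) (F F' : complex R).
Variables (f : chain_map X X') (g : chain_map F F').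

Definition tot_map n : {additive tot_obj X F n -> tot_obj X' F' n} :=
  dsum_map (fun a : tot_index n => tensor_map (f (val a).1) (g (val a).2)
     : {additive _ -> _}).

Lemma tot_mapE n t (a : tot_index n) :
  tot_map n t a = tensor_map (f (val a).1) (g (val a).2) (t a).
Proof. by []. Qed.

Lemma tot_map_diff n (t : tot_obj X F (n + 1)) :
  tot_diff X' F' n (tot_map (n + 1) t) = tot_map n (tot_diff X F n t).
Proof.
apply: dsum_eqP => a; rewrite tot_mapE /= /tot_diff_val !tot_mapE.
rewrite raddfD raddfMz /=; congr (_ + _ *~ _).
  by apply: tensor_map_sq => // x; rewrite cmap_diff.
by apply: tensor_map_sq => // x; rewrite cmap_diff.
Qed.

Lemma tot_map_surj n :
  surjective_map f -> surjective_map g -> forall u, exists t, tot_map n t = u.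
Proof.
by move=> fs gs; apply: dsum_map_surj => a; apply: tensor_map_surj; [exact: fs | exact: gs].
Qed.

End TotMap.

Lemma tot_map_comp (R : pzRingType) (X1 X2 X3 : complex R^c) (F1 F2 F3 : complex R)
    (f : chain_map X1 X2) (f' : chain_map X2 X3) (f'' : chain_map X1 X3)
    (g : chain_map F1 F2) (g' : chain_map F2 F3) (g'' : chain_map F1 F3) n t :
  (forall i x, f' i (f i x) = f'' i x) -> (forall i x, g' i (g i x) = g'' i x) ->
  tot_map f' g' n (tot_map f g n t) = tot_map f'' g'' n t.
Proof.
by move=> fE gE; apply: dsum_eqP => a; rewrite !tot_mapE; apply: tensor_map_comp.
Qed.

Lemma tot_map_id (R : pzRingType) (X : complex R^c) (F : complex R)
    (f : chain_map X X) (g : chain_map F F) n t :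
  (forall i x, f i x = x) -> (forall i x, g i x = x) -> tot_map f g n t = t.
Proof.
by move=> fE gE; apply: dsum_eqP => a; rewrite !tot_mapE; apply: tensor_map_id => x.
Qed.

(** * Closure properties of semi-flat complexes *)

Lemma semiflat_retract (R : pzRingType) (G H : complex R) (u : chain_map G H)
    (v : chain_map H G) :
  (forall i x, u i (v i x) = x) -> semiflat G -> semiflat H.
Proof.
move=> uv [Gflat Gacy]; split=> [i A B h hinj|X Xacy n t t0].
  apply: raddf_eq => t /= ht0.
  rewrite -[t](tensor_map_id (f := id_lin A) (g := id_lin (H i))) //.
  rewrite -(tensor_map_comp (f1 := id_lin A) (g1 := v i) (f2 := id_lin A) (g2 := u i)) //.
  suff -> : tensor_map (id_lin A) (v i) t = 0 by rewrite raddf0.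
  apply: (Gflat i _ _ h hinj); rewrite raddf0.
  by rewrite tensor_map_exchange ht0 raddf0.
have vt0 : tot_diff X G n (tot_map (chain_id X) v (n + 1) t) = 0.
  by rewrite tot_map_diff (t0 : tot_diff X H n t = 0) raddf0.
have [s sE] := Gacy X Xacy n _ vt0.
exists (tot_map (chain_id X) u (n + 1 + 1) s).
apply: (etrans (tot_map_diff _ _ _)).
have {}sE : tot_diff X G (n + 1) s = tot_map (chain_id X) v (n + 1) t := sE.
rewrite sE (tot_map_comp (f'' := chain_id X) (g'' := chain_id H)) //.
exact: tot_map_id.
Qed.

Lemma semiflat_same_kernel (R : pzRingType) (F G H : complex R)
    (p : chain_map F G) (q : chain_map F H) :
  surjective_map p -> surjective_map q -> (forall i x, p i x = 0 <-> q i x = 0) ->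
  semiflat G -> semiflat H.
Proof.
move=> ps qs pq.
have [u uE] := chain_factor ps (fun i x => (pq i x).1).
have [v vE] := chain_factor qs (fun i x => (pq i x).2).
apply: (semiflat_retract (u := u) (v := v)) => i y.
by have [x <-] := qs i y; rewrite vE uE.
Qed.

Definition elements (R : pzRingType) (F : complex R) := seq {i : int & F i}.

Definition kills (R : pzRingType) (F G : complex R) (p : chain_map F G)
    (s : elements F) :=
  forall i (x : F i), Tagged (fun i => F i) x \in s -> p i x = 0.

Section FiniteKernel.
Variables (R : pzRingType) (F G : complex R) (p : chain_map F G).
Hypothesis ps : surjective_map p.

Lemma tensor_kernel_finite (X : lmodType R^c) i (t : tensor X (F i)) :
  tensor_map (id_lin X) (p i) t = 0 ->
  exists s : elements F, kills p s /\ forall (H : complex R) (q : chain_map F H),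
    kills q s -> tensor_map (id_lin X) (q i) t = 0.
Proof.
move=> /(tensor_right_exact (@id_lin_surj _ _) (@ps i)) gen.
apply: (gen (fun t => exists s : elements F, kills p s /\
  forall (H : complex R) (q : chain_map F H), kills q s ->
    tensor_map (id_lin X) (q i) t = 0)) => [|x y pxy|u v [s [ps' sP]] [s' [ps'' s'P]]].
- by exists [::]; split=> // H q _; rewrite raddf0.
- case: pxy => [/= ->|py].
    by exists [::]; split=> // H q _; rewrite tensor_of0l raddf0.
  exists [:: Tagged (fun i => F i) y]; split=> [j z|H q qs].
    rewrite inE => /eqP E; have ij : j = i := congr1 tag E.
    by move: z E; rewrite ij => z /eqP; rewrite eq_Tagged /= => /eqP ->.
  by rewrite tensor_map_of qs ?tensor_of0r // mem_seq1.
exists (s ++ s'); split=> [j z|H q qs].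
  by rewrite mem_cat => /orP[/ps'|/ps''].
rewrite raddfB /= sP ?s'P ?subrr // => j z zs; apply: qs; rewrite mem_cat zs ?orbT //.
Qed.

Lemma tot_kernel_finite (X : complex R^c) n (t : tot_obj X F n) :
  tot_map (chain_id X) p n t = 0 ->
  exists s : elements F, kills p s /\ forall (H : complex R) (q : chain_map F H),
    kills q s -> tot_map (chain_id X) q n t = 0.
Proof.
move=> pt; have [r [_ tr]] := dsum_supp t.
have pta a : tensor_map (id_lin (X (val a).1)) (p (val a).2) (t a) = 0.
  by rewrite -[LHS]/(tot_map (chain_id X) p n t a) pt.
have [s [ks sP]] : exists s : elements F, kills p s /\
    forall (H : complex R) (q : chain_map F H), kills q s ->
    forall a, a \in r -> tensor_map (id_lin (X (val a).1)) (q (val a).2) (t a) = 0.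
  elim: r {tr} => [|a r [s [ks sP]]]; first by exists [::].
  have [s' [ks' s'P]] := tensor_kernel_finite (pta a).
  exists (s' ++ s); split=> [j z|H q qs b].
    by rewrite mem_cat => /orP[/ks'|/ks].
  rewrite inE => /orP[/eqP ->|br].
    by apply: s'P => j z zs; apply: qs; rewrite mem_cat zs.
  by apply: sP => // j z zs; apply: qs; rewrite mem_cat zs orbT.
exists s; split=> // H q qs; apply: dsum_eqP => a; rewrite tot_mapE.
have [ta|] := boolP (t a != 0); first by apply: (sP H q qs); apply: tr.
by rewrite negbK => /eqP ->; rewrite raddf0.
Qed.

(** A direct limit of semi-flat complexes is semi-flat: only finitely many
    elements of the kernel of [p] matter to a given tensor. *)
Lemma semiflat_limit :
  (forall s : elements F, kills p s -> exists (H : complex R) (q : chain_map F H)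
     (h : chain_map H G), [/\ semiflat H, kills q s & forall i x, h i (q i x) = p i x]) ->
  semiflat G.
Proof.
move=> lim; split=> [i A B k kinj|X Xacy n t t0].
  apply: raddf_eq => t /= kt0.
  have [u ut] := tensor_map_surj (@id_lin_surj _ _) (@ps i) t.
  have [|s [ks sP]] := @tensor_kernel_finite B i (tensor_map k (id_lin (F i)) u).
    by rewrite -tensor_map_exchange ut.
  have [H [q [h [[Hflat _] qs hq]]]] := lim s ks.
  suff qu0 : tensor_map (id_lin A) (q i) u = 0.
    by rewrite -ut -(tensor_map_comp (f1 := id_lin A) (g1 := q i) (f2 := id_lin A)
      (g2 := h i)) // qu0 raddf0.
  apply: (Hflat i _ _ k kinj); rewrite raddf0.
  by rewrite tensor_map_exchange sP.
have idX : surjective_map (chain_id X) by move=> i x; exists x.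
have [u ut] := tot_map_surj idX ps t.
have [|s [ks sP]] := @tot_kernel_finite X n (tot_diff X F n u).
  by rewrite -tot_map_diff ut.
have [H [q [h [[_ Hacy] qs hq]]]] := lim s ks.
have qu0 : tot_diff X H n (tot_map (chain_id X) q (n + 1) u) = 0.
  by rewrite tot_map_diff; exact: sP.
have [v vE] := Hacy X Xacy n _ qu0.
exists (tot_map (chain_id X) h (n + 1 + 1) v).
apply: (etrans (tot_map_diff _ _ _)).
have {}vE : tot_diff X H (n + 1) v = tot_map (chain_id X) q (n + 1) u := vE.
by rewrite vE -ut; exact: tot_map_comp.
Qed.

End FiniteKernel.

(** * Quotient maps with local sections *)

Section LocalSections.
Variables (R : pzRingType) (E N : complex R) (p : chain_map E N).

Variant constraint :=
| SectionAdd i of N i & N i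
| SectionScale i of R & N i
| SectionDiff i of N (i + 1).

HB.instance Definition _ := gen_eqMixin constraint.

Definition satisfies (s : forall i, N i -> E i) (c : constraint) :=
  match c with
  | SectionAdd i y y' => s i (y + y') = s i y + s i y'
  | SectionScale i r y => s i (r *: y) = r *: s i y
  | SectionDiff i y => cdiff E i (s (i + 1) y) = s i (cdiff N i y)
  end.

Definition satisfies_all (s : forall i, N i -> E i) (cs : seq constraint) :=
  forall c, c \in cs -> satisfies s c.

Lemma satisfies_all_cat s c c' :
  satisfies_all s (c ++ c') -> satisfies_all s c /\ satisfies_all s c'.
Proof. by move=> sP; split=> d dc; apply: sP; rewrite mem_cat dc ?orbT. Qed.

(** Purity in the form in which it interacts with tensor products: a set-theoretic
    section of [p] can be made to respect any finite part of the structure. *)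
Definition local_sections :=
  forall cs : seq constraint, exists s : forall i, N i -> E i,
    (forall i y, p i (s i y) = y) /\ satisfies_all s cs.

Definition section_lift (X : lmodType R^c) (s : forall i, N i -> E i) i :
    {additive {freeg (X * N i)} -> tensor X (E i)} :=
  freeg_lift (fun k : X * N i => tensor_of k.1 (s i k.2)).



Lemma section_liftU X s i x y :
  section_lift X s i << (x, y) >> = tensor_of x (s i y).
Proof. exact: freeg_liftU. Qed.

(** The derivation of a tensor relation uses finitely many sums and multiples. *)
Lemma section_lift_relation (X : lmodType R^c) i (z : {freeg (X * N i)}) :
  tensor_relation z -> exists cs, forall s, satisfies_all s cs ->
    section_lift X s i z = 0.
Proof.
elim=> [x x' y|x y y'|r x y||u v _ [cs csP] _ [cs' cs'P]].
- exists [::] => s _. rewrite raddfB raddfD !section_liftU.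
  by rewrite tensor_ofDl subrr.
- exists [:: SectionAdd y y'] => s /(_ _ (mem_head _ _)) sE; rewrite /satisfies in sE.
  by rewrite raddfB raddfD !section_liftU sE tensor_ofDr subrr.
- exists [:: SectionScale r y] => s /(_ _ (mem_head _ _)) sE; rewrite /satisfies in sE.
  by rewrite raddfB !section_liftU sE tensor_ofZ subrr.
- by exists [::] => s _; rewrite raddf0.
exists (cs ++ cs') => s /satisfies_all_cat[sP s'P].
by rewrite raddfB csP // cs'P // subrr.
Qed.

Lemma section_lift_diff (X : lmodType R^c) i (z : {freeg (X * N (i + 1))}) :
  exists cs, forall s, satisfies_all s cs ->
    tensor_map (id_lin X) (cdiff E i) (section_lift X s (i + 1) z) =
    section_lift X s i (tensor_map_free (id_lin X) (cdiff N i) z).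
Proof.
elim/freeg_ind: z => [|[x y]|u v [cs csP] [cs' cs'P]].
- by exists [::] => s _; rewrite !raddf0.
- exists [:: SectionDiff y] => s /(_ _ (mem_head _ _)) sE; rewrite /satisfies in sE.
  by rewrite tensor_map_freeU !section_liftU tensor_map_of sE.
exists (cs ++ cs') => s /satisfies_all_cat[sP s'P].
by rewrite !raddfB /= csP // cs'P.
Qed.

Lemma section_lift_map (X X' : lmodType R^c) (f : {linear X -> X'}) s i z :
  tensor_map f (id_lin (E i)) (section_lift X s i z) =
  section_lift X' s i (tensor_map_free f (id_lin (N i)) z).
Proof.
elim/freeg_ind: z => [|[x y]|u v uE vE]; first by rewrite !raddf0.
  by rewrite tensor_map_freeU !section_liftU tensor_map_of.
by rewrite !raddfB /= uE vE.
Qed.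

Lemma section_liftK (X : lmodType R^c) s i z :
  (forall i y, p i (s i y) = y) ->
  tensor_map (id_lin X) (p i) (section_lift X s i z) = tensor_pi z.
Proof.
move=> sp; elim/freeg_ind: z => [|[x y]|u v uE vE]; first by rewrite !raddf0.
  by rewrite section_liftU tensor_map_of sp.
by rewrite !raddfB /= uE vE.
Qed.

Hypothesis psec : local_sections.

Lemma local_sections_flat i : flat (E i) -> flat (N i).
Proof.
move=> Eflat A B h hinj; apply: raddf_eq => t /= ht0.
pose z := tensor_repr t.
have [|cs csP] := @section_lift_relation B i (tensor_map_free h (id_lin (N i)) z).
  by apply/tensor_relationP; rewrite -[tensor_map_free _ _ _]subr0; apply/tensor_eqP;
    rewrite -tensor_map_pi tensor_reprK ht0 raddf0.
have [s [sp sP]] := psec cs.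
rewrite -[t]tensor_reprK -(section_liftK _ sp).
suff -> : section_lift A s i z = 0 by rewrite raddf0.
apply: (Eflat _ _ h hinj); rewrite raddf0.
by rewrite section_lift_map csP.
Qed.

(** A section that respects the finitely many relations that make [t] a cycle lifts
    [t] to a cycle, which is a boundary. *)
Lemma local_sections_semiflat : semiflat E -> semiflat N.
Proof.
move=> [Eflat Eacy]; split=> [i|X Xacy n t t0].
  exact: local_sections_flat.
pose z (a : tot_index (n + 1)) := if t a == 0 then 0 else tensor_repr (t a).
have zE a : tensor_pi (z a) = t a.
  by rewrite /z; case: eqP => [->|_]; rewrite ?raddf0 // tensor_reprK.
have z0 a : t a = 0 -> z a = 0 by move=> ta; rewrite /z ta eqxx.
have [r [_ tr]] := dsum_supp t.
have /choice[lf lfE] := @tot_index_left_surj n.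
have /choice[rf rfE] := @tot_index_right_surj n.
pose bs := map lf r ++ map rf r.
have bsP b : b \notin bs -> z (tot_index_left b) = 0 /\ z (tot_index_right b) = 0.
  rewrite mem_cat negb_or => /andP[bl br]; split; apply: z0.
    apply/eqP; apply: contraNT bl => /tr tb; apply/mapP.
    by exists (tot_index_left b) => //; apply: tot_index_left_inj; rewrite -lfE.
  apply/eqP; apply: contraNT br => /tr tb; apply/mapP.
  by exists (tot_index_right b) => //; apply: tot_index_right_inj; rewrite -rfE.
pose zb (b : tot_index n) :=
  tensor_map_free (cdiff X (val b).1) (id_lin (N (val b).2)) (z (tot_index_left b)) +
  tensor_map_free (id_lin (X (val b).1)) (cdiff N (val b).2) (z (tot_index_right b))
    *~ tot_sign (val b).1.
have zb0 b : tensor_relation (zb b).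
  apply/tensor_relationP; rewrite -[zb b]subr0; apply/tensor_eqP.
  rewrite raddfD raddfMz /= -!tensor_map_pi (zE (tot_index_left b)) (zE (tot_index_right b)) raddf0.
  exact: (congr1 (fun u => dsum_val u b) (t0 : tot_diff X N n t = 0)).
pose lift s (a : tot_index (n + 1)) := section_lift (X (val a).1) s (val a).2 (z a).
have lift_fin s : finite_set [set a | lift s a != 0].
  apply: sub_finite_set (dsum_finite t) => a /=.
  by apply: contra => /eqP/z0 za; rewrite /lift za raddf0.
pose T s : tot_obj X E (n + 1) := DSum (lift_fin s).
(* Outside [bs] the boundary of a lift vanishes for every section. *)
have [cs csP] : exists cs, forall s, satisfies_all s cs ->
    forall b, b \in bs -> tot_diff X E n (T s) b = 0.
  elim: bs {bsP} => [|b bs [cs csP]]; first by exists [::].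
  have [c cP] := section_lift_relation (zb0 b).
  have [d dP] := section_lift_diff (z (tot_index_right b)).
  exists (c ++ d ++ cs) => s /satisfies_all_cat[sc /satisfies_all_cat[sd scs]] b'.
  rewrite inE => /orP[/eqP ->|/(csP s scs)//].
  rewrite -[LHS]/(tot_diff_val (T s) b) /tot_diff_val /= /lift /=.
  by rewrite section_lift_map dP // -raddfMz -raddfD; exact: cP.
have [s [sp /csP sP]] := psec cs.
have T0 : tot_diff X E n (T s) = 0.
  apply: dsum_eqP => b; case: (boolP (b \in bs)) => [/sP //|/bsP[bl br]].
  have T0 a : z a = 0 -> dsum_val (T s) a = 0 by move=> za; rewrite /= /lift za raddf0.
  rewrite -[LHS]/(tot_diff_val (T s) b) /tot_diff_val (T0 _ bl) (T0 _ br).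
  by rewrite !raddf0 mul0rz addr0.
have [u uE] := Eacy X Xacy n _ T0.
exists (tot_map (chain_id X) p (n + 1 + 1) u).
apply: (etrans (tot_map_diff _ _ _)).
have {}uE : tot_diff X E (n + 1) u = T s := uE.
rewrite uE; apply: dsum_eqP => a; rewrite tot_mapE -zE.
exact: section_liftK.
Qed.

End LocalSections.

(** * Pure subcomplexes *)

Section Span.
Variables (R : pzRingType) (n : nat).
Local Notation V := 'rV[R]_n.

Definition span_mx (s : seq V) : 'M[R]_(size s, n) := \matrix_(k < size s) s`_k.

Definition in_span (s : seq V) (v : V) := exists w, v = w *m span_mx s.

Lemma span_mxE s (w : 'rV[R]_(size s)) :
  w *m span_mx s = \sum_k w 0 k *: s`_k.
Proof. by rewrite mulmx_sum_row; apply: eq_bigr => k _; rewrite rowK. Qed.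

Lemma in_span0 s : in_span s 0.
Proof. by exists 0; rewrite mul0mx. Qed.

Lemma in_spanD s u v : in_span s u -> in_span s v -> in_span s (u + v).
Proof. by move=> [w ->] [w' ->]; exists (w + w'); rewrite mulmxDl. Qed.

Lemma in_spanZ s a v : in_span s v -> in_span s (a *: v).
Proof. by move=> [w ->]; exists (a *: w); rewrite -scalemxAl. Qed.

Definition span (s : seq V) : submodClosed V :=
  submod_of (@in_span0 s) (@in_spanD s) (@in_spanZ s).

Lemma mem_span s v : v \in s -> v \in span s.
Proof.
move=> vs; apply/submod_ofP; rewrite -index_mem in vs.
exists (delta_mx 0 (Ordinal vs)); rewrite span_mxE (bigD1 (Ordinal vs)) //=.
rewrite mxE !eqxx scale1r nth_index -?index_mem // big1 ?addr0 // => k ks.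
by rewrite mxE (negPf ks) andbF scale0r.
Qed.

Lemma span_sub (W : lmodType R) (f : {linear V -> W}) (S : submodClosed W) s :
  (forall v, v \in s -> f v \in S) -> forall v, v \in span s -> f v \in S.
Proof.
move=> fs v /submod_ofP[w ->]; rewrite span_mxE raddf_sum rpred_sum // => k _.
by rewrite /= linearZ_LR rpredZ //; apply: fs; rewrite mem_nth.
Qed.

Lemma span_quotient_fp s : finitely_presented (quotmod (span s)).
Proof.
have ql : linear (fun w : 'rV[R]_(size s) => w *m span_mx s).
  by move=> a u v; rewrite mulmxDl -scalemxAl.
exists (size s), n, (lin_of ql), [the {linear V -> quotmod (span s)} of quotmod_pi (span s)].
split=> [v|a]; last by have [v ->] := quotmod_piP a; exists v.
split=> [/quotmod_pi_eq0/submod_ofP[w ->]|[w <-]]; first by exists w.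
by apply/quotmod_pi_eq0/submod_ofP; exists w.
Qed.

End Span.

Section PureSections.
Variables (R : pzRingType) (E : complex R) (K : subcomplex E).
Hypothesis Kpure : pure_subcomplex K.
Local Notation N := (quot_complex K).
Local Notation p := (quot_proj K).

Lemma quot_proj_surj : surjective_map p.
Proof. by move=> i y; have [x ->] := quotmod_piP y; exists x. Qed.

(** A bounded complex of finitely presented modules is obtained from the complex that
    is ['rV_n] in every degree, with differential [delta], by imposing the relations
    [rel] and killing everything in the degrees beyond the bound [m]. The map [W]
    is defined on this quotient, and purity lifts it. *)
Lemma pure_lift_relations (n : nat) (delta : {linear 'rV[R]_n -> 'rV[R]_n})
    (W : forall i, {linear 'rV[R]_n -> N i}) (m : int) (rel : seq (int * 'rV[R]_n)) :
    (forall v, delta (delta v) = 0) ->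
    (forall i v, cdiff N i (W (i + 1) v) = W i (delta v)) ->
    (forall i v, m < `|i| -> W i v = 0) ->
    (forall i v, (i, v) \in rel -> W i v = 0) ->
  exists H : forall i, {linear 'rV[R]_n -> E i},
    [/\ forall i v, p i (H i v) = W i v,
        forall i v, cdiff E i (H (i + 1) v) = H i (delta v)
      & forall i v, (i, v) \in rel -> H i v = 0].
Proof.
move=> deltaK Wd Wm Wrel.
pose r i : seq 'rV[R]_n := [seq x.2 | x <- rel & x.1 == i] ++
  (if m < `|i| then [seq delta_mx 0 k | k : 'I_n] else [::]).
pose l i := r i ++ [seq delta v | v <- r (i + 1)].
have Wr i v : v \in r i -> W i v = 0.
  rewrite mem_cat => /orP[/mapP[[j u]]|].
    by rewrite mem_filter /= => /andP[/eqP -> /Wrel Wu ->].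
  by case: ifP => // mi _; apply: Wm.
have Wl i v : v \in l i -> W i v = 0.
  rewrite mem_cat => /orP[/Wr //|/mapP[u /Wr Wu ->]].
  by rewrite -Wd Wu raddf0.
pose C : complex R := @Complex R (fun _ => 'rV[R]_n : lmodType R) (fun _ => delta)
  (fun _ => deltaK).
have ldiff i (x : C (i + 1)) : x \in span (l (i + 1)) -> cdiff C i x \in span (l i).
  apply: span_sub => v; rewrite mem_cat => /orP[vr|/mapP[u _ ->]] /=.
    by apply: mem_span; rewrite mem_cat map_f ?orbT.
  by rewrite deltaK; apply/asboolP; exact: in_span0.
pose L : subcomplex C := @Subcomplex R C (fun i => span (l i)) ldiff.
pose Wc : chain_map C N := @ChainMap R C N W Wd.
have [w wE] : exists w : chain_map (quot_complex L) N,
    forall i x, w i (quot_proj L i x) = Wc i x.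
  apply: chain_factor => [i y|i x /quotmod_pi_eq0 xl].
    by have [x ->] := quotmod_piP y; exists x.
  apply/eqP; have := span_sub (f := W i) (S := [the submodClosed (N i) of ker (id_lin (N i))]) _ xl.
  apply=> v /Wl ->; exact/kerP.
have Lbounded : bounded (quot_complex L).
  exists m => i x mi; have [v ->] := quotmod_piP x; apply/quotmod_pi_eq0.
  rewrite [v]row_sum_delta rpred_sum // => k _; rewrite rpredZ //.
  by apply: mem_span; rewrite !mem_cat mi map_f ?orbT // mem_enum.
have Lfp i : finitely_presented (quot_complex L i) by exact: span_quotient_fp.
have [_ _ /(_ w)[h hw]] := Kpure Lbounded Lfp.
pose H i := [the {linear 'rV[R]_n -> E i} of h i \o quot_proj L i].
exists H; split=> [i v|i v|i v vr] /=.
- by have := hw i (quot_proj L i v); rewrite wE.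
- apply: (etrans (cmap_diff h _)); congr (h i _).
  exact: (cmap_diff (quot_proj L)).

- have /quotmod_pi_eq0 -> : v \in L i; last by rewrite raddf0.
  apply: mem_span; rewrite !mem_cat.
  suff -> : v \in [seq x.2 | x <- rel & x.1 == i] by [].
  by apply/mapP; exists (i, v) => //; rewrite mem_filter eqxx.
Qed.

Definition mentions (c : constraint N) : elements N :=
  let T i (y : N i) := Tagged (fun i => N i) y in
  match c with
  | SectionAdd i y y' => [:: T i y; T i y'; T i (y + y')]
  | SectionScale i r y => [:: T i y; T i (r *: y)]
  | SectionDiff i y => [:: T (i + 1) y; T i (cdiff N i y)]
  end.

Definition component (i : int) (x : {i : int & N i}) : N i :=
  tagged_as (Tagged (fun i => N i) (0 : N i)) x.

Lemma componentE i (y : N i) : component i (Tagged (fun i => N i) y) = y.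
Proof. exact: (@tagged_asE _ _ (Tagged (fun i => N i) (0 : N i)) y). Qed.

Lemma component_out i x : tag x != i -> component i x = 0.
Proof.
rewrite eq_sym /component /tagged_as /= => xi.
by case: eqP => // e; exfalso; move/eqP: xi; apply.
Qed.

(** The universal source: a generator and its formal boundary for each of the elements
    [S_k] that the constraints mention, subject to the constraints. It has [m]
    generators followed by their [m] boundaries in every degree, the ones of the
    wrong degree being mapped to zero. *)
Lemma pure_local_sections : local_sections p.
Proof.
move=> cs; pose S : elements N := flatten (map mentions cs).
have csS c : c \in cs -> forall x, x \in mentions c -> x \in S.
  by move=> ccs x xc; apply/flattenP; exists (mentions c) => //; apply: map_f.
pose m := size S; pose V : lmodType R := 'rV[R]_(m + m).
pose Sk (k : 'I_m) := tnth (in_tuple S) k.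
have dl : linear (fun v : V => row_mx 0 (lsubmx v) : V).
  by move=> a u v; rewrite linearP scale_row_mx add_row_mx scaler0 addr0.
pose delta : {linear V -> V} := lin_of dl.
have deltaK v : delta (delta v) = 0 by rewrite /= row_mxKl row_mx0.
pose Wf i (v : V) : N i := \sum_k (lsubmx v) 0 k *: component i (Sk k) +
  \sum_k (rsubmx v) 0 k *: cdiff N i (component (i + 1) (Sk k)).
have Wl i : linear (Wf i).
  move=> a u v; rewrite /Wf scalerDr addrACA !scaler_sumr.
  by congr (_ + _); rewrite -big_split /=; apply: eq_bigr => k _;
    rewrite !mxE scalerDl scalerA.
have [W WE] : exists W : forall i, {linear V -> N i}, forall i v, W i v = Wf i v.
  by exists (fun i => lin_of (Wl i)).
have Wd i v : cdiff N i (W (i + 1) v) = W i (delta v).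
  rewrite !WE /Wf raddfD !raddf_sum /= row_mxKl row_mxKr [X in _ + X]big1 ?addr0; last first.
    by move=> k _; rewrite linearZ_LR /= (cdiff_comp (c := N)) scaler0.
  rewrite [X in _ = X + _]big1 ?add0r => [|k _]; last by rewrite mxE scale0r.
  by apply: eq_bigr => k _; rewrite linearZ_LR.
(* In the degrees beyond [b], neither the elements [S_k] nor their boundaries live. *)
pose b : int := \sum_(x <- S) (`|tag x| + 1).
have bP x : x \in S -> `|tag x| + 1 <= b.
  by move=> xS; rewrite /b (big_rem x) //= lerDl sumr_ge0.
have SkS k : Sk k \in S by exact: mem_tnth.
have Wb i v : b < `|i| -> W i v = 0.
  move=> bi; rewrite WE /Wf !big1 ?addr0 // => k _.
    rewrite component_out ?raddf0 ?scaler0 //; apply: contraTneq bi => ki.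
    rewrite -leNgt (le_trans _ (bP _ (SkS k))) // ki.
    by rewrite -{1}[i](addrK 1) (le_trans (ler_normB _ _)).
  rewrite component_out ?scaler0 //; apply: contraTneq bi => ki.
  by rewrite -leNgt -ki (le_trans _ (bP _ (SkS k))) // lerDl.
pose e (x : {i : int & N i}) : V :=
  row_mx (\row_(k < m) (k == index x S :> nat)%:R) 0.
pose T i (y : N i) := Tagged (fun i => N i) y.
have We i (y : N i) : T i y \in S -> W i (e (T i y)) = y.
  move=> xS; pose x := T i y; rewrite WE /Wf row_mxKl row_mxKr.
  rewrite [X in _ + X]big1 ?addr0 => [|k _]; last by rewrite mxE scale0r.
  have xm : (index x S < m)%N by rewrite index_mem.
  rewrite (bigD1 (Ordinal xm)) //= mxE eqxx scale1r big1 ?addr0 => [|k kx].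
    by rewrite /Sk (tnth_nth x) /= nth_index // componentE.
  by rewrite mxE -[index x S]/(val (Ordinal xm)) (inj_eq val_inj) (negPf kx) scale0r.
pose rel_of (c : constraint N) : int * V := match c with
  | SectionAdd i y y' => (i, e (T i (y + y')) - (e (T i y) + e (T i y')))
  | SectionScale i r y => (i, e (T i (r *: y)) - r *: e (T i y))
  | SectionDiff i y => (i, e (T i (cdiff N i y)) - delta (e (T (i + 1) y)))
  end.
pose rel := map rel_of cs.
have Wrel i v : (i, v) \in rel -> W i v = 0.
  move=> /mapP[c /csS cS cE]; case: c cS cE => [j y y'|j r y|j y] cS [-> ->].
  - by rewrite linearB linearD !We ?subrr //; apply: cS; rewrite !inE eqxx ?orbT.
  - by rewrite linearB linearZ_LR !We ?subrr //; apply: cS; rewrite !inE eqxx ?orbT.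
  - by rewrite linearB -Wd !We ?subrr //; apply: cS; rewrite !inE eqxx ?orbT.
have [H [pH Hd Hrel]] := pure_lift_relations deltaK Wd Wb Wrel.
have /dep_choice[g gE] i : exists g : N i -> E i, forall y, p i (g y) = y.
  by have /choice[g gE] := @quot_proj_surj i; exists g.
pose s i (y : N i) : E i := if T i y \in S then H i (e (T i y)) else g i y.
exists s; split=> [i y|]; first by rewrite /s; case: ifP => [yS|_]; rewrite ?gE // pH We.
move=> c cc; have cS := csS c cc.
have : rel_of c \in rel by exact: map_f.
have sE i y : T i y \in mentions c -> s i y = H i (e (T i y)) by move=> /cS; rewrite /s => ->.
case: c cS cc sE => [i y y'|i r y|i y] cS cc sE /Hrel H0.
- rewrite /satisfies !sE ?inE ?eqxx ?orbT // -linearD.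
  by apply/eqP; rewrite -subr_eq0 -linearB H0.
- rewrite /satisfies !sE ?inE ?eqxx ?orbT // -linearZ_LR.
  by apply/eqP; rewrite -subr_eq0 -linearB H0.
- rewrite /satisfies !sE ?inE ?eqxx ?orbT // Hd.
  by apply/esym/eqP; rewrite -subr_eq0 -linearB H0.
Qed.

Lemma pure_quotient_semiflat : semiflat E -> semiflat N.
Proof. exact: local_sections_semiflat pure_local_sections. Qed.

End PureSections.

(** * Semi-free complexes *)

(** Elimination of the coefficients of [t] one at a time, by decreasing height: the
    correction that makes the coefficient at [k] vanish may spoil other coefficients
    of smaller height only. *)
Lemma height_elimination (S : Type) (K : eqType) (ht : K -> nat)
    (vanish : K -> S -> Prop) (good : S -> Prop) :
  (forall t, (forall k, vanish k t) -> good t) ->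
  (forall t, exists L : seq K, forall k, k \notin L -> vanish k t) ->
  (forall t k, (forall k', (ht k < ht k')%N -> vanish k' t) ->
    exists t', [/\ good t' -> good t, vanish k t' &
      forall k', k' != k -> (ht k <= ht k')%N -> vanish k' t -> vanish k' t']) ->
  forall t, good t.
Proof.
move=> good0 fin elim1.
have goodh h : forall t, (forall k, (h <= ht k)%N -> vanish k t) -> good t.
  elim: h => [|h IHh] t th; first by apply: good0 => k; apply: th.
  have [L tL] := fin t.
  have {tL} : forall k, ht k = h -> k \notin L -> vanish k t by move=> k _ /tL.
  elim: L t th => [|k L IHL] t th tL.
    apply: IHh => k; rewrite leq_eqVlt => /orP[/eqP/esym kh|/th //].
    exact: tL.
  have [kh|kh] := eqVneq (ht k) h; last first.
    apply: IHL => // k' k'h k'L; apply: tL => //.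
    rewrite inE negb_or k'L andbT.
    by apply: contra kh => /eqP <-; apply/eqP.
  have [|t' [tt' kt' t'k]] := elim1 t k; first by move=> k'; rewrite kh => /th.
  apply/tt'/IHL => k'; last move=> k'L; [move=> hk'|move=> k'L'].
    apply: t'k; last exact: th.
      by apply: contraTneq hk' => ->; rewrite kh ltnn.
    by rewrite kh ltnW.
  have [->//|kk'] := eqVneq k' k.
  by apply: t'k => //; [rewrite kh k'L | apply: tL; rewrite // inE negb_or kk'].
move=> t; have [L tL] := fin t.
apply: (goodh (\max_(k <- L) ht k).+1) => k hk; apply: tL.
apply/negP => kL; move: hk; rewrite ltnNge => /negP; apply.
exact: (@leq_bigmax_seq _ L xpredT ht).
Qed.

(** The heights filter [F] by subcomplexes whose successive quotients are free with
    zero differential. *)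
Record semifree (R : pzRingType) (F : complex R) := Semifree {
  sgen : int -> choiceType;
  sbasis : forall i, basis (F i) (sgen i);
  sheight : forall i, sgen i -> nat;
  sheight_diff : forall i (g : sgen (i + 1)) (g' : sgen i),
    bco (sbasis i) g' (cdiff F i (bvec (sbasis (i + 1)) g)) != 0 ->
    (sheight g' < sheight g)%N }.

Section SemifreeLeft.
Variables (R : pzRingType) (F : complex R) (sf : semifree F).
Local Notation gen := (sgen sf).
Local Notation e j := (bvec (sbasis sf j)).

Lemma semifree_flat i : flat (F i).
Proof.
move=> A B f finj; apply: raddf_eq => t /= ft0.
have [c [cE cP]] := basis_tensor_r A (sbasis sf i).
have [d [dE _]] := basis_tensor_r B (sbasis sf i).
have cd g u : d g (tensor_map f (id_lin (F i)) u) = f (c g u).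
  elim/tensor_ind: u => [|x y|u v uE vE]; first by rewrite !raddf0.
    by rewrite tensor_map_of dE cE linearZ_LR.
  by rewrite !raddfB /= uE vE.
have [s [_ _ ->]] := cP t; rewrite big1 // => g _.
suff -> : c g t = 0 by rewrite tensor_of0l.
by apply: finj; rewrite raddf0 -cd ft0 raddf0.
Qed.

(** In a cycle, the coefficient of a generator [g] of maximal height is a cycle of
    [X], hence the boundary of some [y], and subtracting the boundary of [y (x) g]
    removes it. *)
Lemma semifree_tensor_acyclic (X : complex R^c) : acyclic X -> acyclic (total_tensor X F).
Proof.
move=> Xacy n t0 t0_cycle.
pose coordinates i j (c : gen j -> {additive tensor (X i) (F j) -> X i}) :=
  (forall g x y, c g (tensor_of x y) = (bco (sbasis sf j) g y : R^c) *: x) /\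
  forall t, exists s : seq (gen j), [/\ uniq s, (forall g, g \notin s -> c g t = 0) &
    t = \sum_(g <- s) tensor_of (c g t) (e j g)].
have /dep_choice[c cP] i : exists c, forall j, coordinates i j (c j).
  by apply: dep_choice => j; exact: basis_tensor_r.
have cE i j g x y : c i j g (tensor_of x y) = (bco (sbasis sf j) g y : R^c) *: x.
  by have [-> _] := cP i j.
have csum i j t : exists s, [/\ uniq s, (forall g, g \notin s -> c i j g t = 0) &
    t = \sum_(g <- s) tensor_of (c i j g t) (e j g)].
  by have [_] := cP i j.
have c_left i j g u : c i j g (tensor_map (cdiff X i) (id_lin (F j)) u) =
    cdiff X i (c (i + 1) j g u).
  elim/tensor_ind: u => [|x y|u v uE vE]; first by rewrite !raddf0.
    by rewrite tensor_map_of !cE linearZ_LR.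
  by rewrite !raddfB /= uE vE.
have c_right i j g u :
    (forall g', (sheight g < sheight g')%N -> c i (j + 1) g' u = 0) ->
    c i j g (tensor_map (id_lin (X i)) (cdiff F j) u) = 0.
  move=> u0; have [s [_ _ uE]] := csum i (j + 1) u.
  rewrite {1}uE !raddf_sum big1 // => g' _ /=; rewrite tensor_map_of cE.
  have [->|/sheight_diff gg'] :=
    eqVneq (bco (sbasis sf j) g (cdiff F j (e (j + 1) g'))) 0; first by rewrite scale0r.
  by rewrite u0 // raddf0.
pose S := {t : tot_obj X F (n + 1) | tot_diff X F n t = 0}.
pose K : eqType := {a : tot_index (n + 1) & gen (val a).2}.
pose vanish (k : K) (t : S) := c (val (tag k)).1 (val (tag k)).2 (tagged k) (sval t (tag k)) = 0.
pose good (t : S) := exists s, tot_diff X F (n + 1) s = sval t.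
suff : forall t, good t by move=> /(_ (exist _ t0 t0_cycle)).
apply: (@height_elimination S K (fun k => sheight (tagged k)) vanish).
- move=> [t tP] t0'; exists 0; rewrite raddf0; apply/esym/dsum_eqP => a.
  have [s [_ _ ->]] := csum (val a).1 (val a).2 (t a); rewrite big1 // => g _.
  by have := t0' (Tagged (fun a => gen (val a).2) g); rewrite /vanish /= => ->; rewrite tensor_of0l.
- move=> [t tP]; have [r [_ tr]] := dsum_supp t.
  have /dep_choice[s sP] (a : tot_index (n + 1)) := csum (val a).1 (val a).2 (t a).
  exists (flatten [seq [seq Tagged (fun a => gen (val a).2) g | g <- s a] | a <- r]).
  case=> a g agL; rewrite /vanish /=; have [_ cs _] := sP a.
  have [ta|] := boolP (t a != 0); last by rewrite negbK => /eqP ->; rewrite raddf0.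
  apply: cs; apply: contra agL => gs; apply/flattenP.
  exists [seq Tagged (fun a => gen (val a).2) g | g <- s a]; last exact: map_f.
  by apply: (map_f (fun a => [seq Tagged (fun a => gen (val a).2) g | g <- s a])); exact: tr.
move=> [t tP] [b g]; rewrite /vanish /=; have [a bE] := tot_index_left_surj b; subst b.
move=> high; have dx : cdiff X (val a).1 (c _ _ g (t (tot_index_left a))) = 0.
  have /(congr1 (fun u => c (val a).1 (val a).2 g (dsum_val u a))) := tP.
  rewrite raddf0 -[X in c _ _ _ X]/(tot_diff_val t a) /tot_diff_val raddfD raddfMz.
  have -> := c_left (val a).1 (val a).2 g.
  rewrite c_right ?mul0rz ?addr0 // => g' gg'.
  exact: (high (Tagged (fun a => gen (val a).2) (g' : gen (val (tot_index_right a)).2))).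
have [y yE] := Xacy _ _ dx.
pose single (q : tot_index (n + 1 + 1)) (g : gen (val q).2) (y : X (val q).1) :
    tot_obj X F (n + 1 + 1) :=
  dsum_single (A := fun p => tensor (X (val p).1) (F (val p).2)) (i := q) (tensor_of y (e _ g)).
have lower q (g1 : gen (val q).2) y1 b (g' : gen (val b).2) : (sheight g1 <= sheight g')%N ->
    c (val b).1 (val b).2 g' (tensor_map (id_lin (X (val b).1)) (cdiff F (val b).2)
      (single q g1 y1 (tot_index_right b))) = 0.
  move=> gg'; rewrite /single; have [ab|ab] := eqVneq q (tot_index_right b); last first.
    by rewrite dsum_single_out // !raddf0.
  subst q; rewrite dsum_singleE /= tensor_map_of cE.
  have [->|/sheight_diff] :=
    eqVneq (bco (sbasis sf (val b).2) g' (cdiff F _ (e _ g1))) 0; first by rewrite scale0r.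
  by rewrite ltnNge gg'.
pose q := tot_index_left (tot_index_left a).
pose s := single q g y.
have s_left b (g' : gen (val b).2) :
    c (val b).1 (val b).2 g' (tensor_map (cdiff X (val b).1) (id_lin (F (val b).2))
      (s (tot_index_left b))) =
    if Tagged (fun a => gen (val a).2) g' ==
       Tagged (fun a => gen (val a).2) (g : gen (val (tot_index_left a)).2)
    then c (val b).1 (val b).2 g' (t b) else 0.
  have [ab|ab] := eqVneq q (tot_index_left b); last first.
    rewrite /s /single dsum_single_out // !raddf0; case: eqP => // E.
    by move: ab; rewrite /q; have /= <- := congr1 tag E; rewrite eqxx.
  have {}ab := tot_index_left_inj ab; subst b.
  rewrite /s /single dsum_singleE eq_Tagged /= tensor_map_of cE bco_vec /= eq_sym.
  by case: eqP => [->|_]; rewrite ?scale0r // scale1r -yE.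
have sE b (g' : gen (val b).2) : (sheight g <= sheight g')%N ->
    c (val b).1 (val b).2 g' (tot_diff X F (n + 1) s b) =
    if Tagged (fun a => gen (val a).2) g' ==
       Tagged (fun a => gen (val a).2) (g : gen (val (tot_index_left a)).2)
    then c (val b).1 (val b).2 g' (t b) else 0.
  move=> gg'; rewrite -[X in c _ _ _ X]/(tot_diff_val s b) /tot_diff_val raddfD raddfMz.
  by rewrite s_left lower // mul0rz addr0.
have t'P : tot_diff X F n (t - tot_diff X F (n + 1) s) = 0.
  by rewrite raddfB tP tot_diff_comp subrr.
have sub b g' : c _ _ g' ((t - tot_diff X F (n + 1) s) b) =
    c _ _ g' (t b) - c _ _ g' (tot_diff X F (n + 1) s b).
  exact: (raddfB (c (val b).1 (val b).2 g')).
exists (exist _ (t - tot_diff X F (n + 1) s) t'P); split.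
- by move=> [u uE]; exists (u + s); rewrite raddfD uE /= subrK.
- by rewrite /vanish; apply: (etrans (sub _ _)); rewrite sE // eqxx subrr.
- case=> b g' kk' gg' tb; rewrite /vanish; apply: (etrans (sub _ _)).
  by rewrite sE // (negPf kk') subr0.
Qed.

Lemma semifree_semiflat : semiflat F.
Proof. by split=> [i|X]; [exact: semifree_flat | exact: semifree_tensor_acyclic]. Qed.

End SemifreeLeft.

(** The statement that the mapping cone of a quasi-isomorphism is acyclic. *)
Lemma quasi_iso_lift (R : pzRingType) (M N : complex R) (f : chain_map M N) i
    (m : M (i + 1)) (v : N (i + 1 + 1)) :
  quasi_iso f -> cdiff M i m = 0 -> cdiff N (i + 1) v = f (i + 1) m ->
  exists (m' : M (i + 1 + 1)) (v' : N (i + 1 + 1 + 1)),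
    cdiff M (i + 1) m' = m /\ v = f _ m' + cdiff N _ v'.
Proof.
move=> fq dm dv; have [x xm] : exists x, cdiff M (i + 1) x = m.
  by apply: (fq i).1 => //; exists v.
have dy : cdiff N (i + 1) (v - f _ x) = 0 by rewrite linearB dv cmap_diff xm subrr.
have [x' [dx' [y' y'E]]] := (fq (i + 1)).2 _ dy.
exists (x + x'), (- y'); rewrite linearD xm dx' addr0; split=> //.
by rewrite linearN y'E linearD opprB addrACA subrr addr0 addrC subrK.
Qed.

Section SemifreeRight.
Variables (R : pzRingType) (P : complex R^c) (sf : semifree P).
Local Notation gen := (sgen sf).
Local Notation e i := (bvec (sbasis sf i)).
Local Notation ht := (@sheight _ _ sf _).

Lemma semifree_coordinates (M : complex R) :
  exists c : forall i j, gen i -> {additive tensor (P i) (M j) -> M j},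
  [/\ forall i j g x y, c i j g (tensor_of x y) = (bco (sbasis sf i) g x : R) *: y,
      forall i j t, exists s : seq (gen i), [/\ uniq s, (forall g, g \notin s -> c i j g t = 0)
        & t = \sum_(g <- s) tensor_of (e i g) (c i j g t)],
      forall i j g u, c i j g (tensor_map (id_lin (P i)) (cdiff M j) u) =
        cdiff M j (c i (j + 1) g u)
    & forall i j g u, (forall g', (ht g < ht g')%N -> c (i + 1) j g' u = 0) ->
        c i j g (tensor_map (cdiff P i) (id_lin (M j)) u) = 0].
Proof.
pose coordinates i j (c : gen i -> {additive tensor (P i) (M j) -> M j}) :=
  (forall g x y, c g (tensor_of x y) = (bco (sbasis sf i) g x : R) *: y) /\
  forall t, exists s : seq (gen i), [/\ uniq s, (forall g, g \notin s -> c g t = 0) &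
    t = \sum_(g <- s) tensor_of (e i g) (c g t)].
have /dep_choice[c cP] i : exists c, forall j, coordinates i j (c j).
  by apply: dep_choice => j; exact: basis_tensor_l.
have cE i j g x y : c i j g (tensor_of x y) = (bco (sbasis sf i) g x : R) *: y.
  by have [-> _] := cP i j.
have csum i j t : exists s, [/\ uniq s, (forall g, g \notin s -> c i j g t = 0) &
    t = \sum_(g <- s) tensor_of (e i g) (c i j g t)].
  by have [_] := cP i j.
exists c; split=> // i j g u.
  elim/tensor_ind: u => [|x y|u v uE vE]; first by rewrite !raddf0.
    by rewrite tensor_map_of !cE linearZ_LR.
  by rewrite !raddfB /= uE vE.
move=> u0; have [s [_ _ uE]] := csum (i + 1) j u.
rewrite {1}uE !raddf_sum big1 // => g' _ /=; rewrite tensor_map_of cE.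
have [->|/sheight_diff gg'] :=
  eqVneq (bco (sbasis sf i) g (cdiff P i (e (i + 1) g'))) 0; first exact: scale0r.
by rewrite u0 // raddf0.
Qed.

Definition tot_single (M : complex R) n (q : tot_index n) (g : gen (val q).1)
    (y : M (val q).2) : tot_obj P M n :=
  dsum_single (A := fun p : tot_index n => tensor (P (val p).1) (M (val p).2))
    (i := q) (tensor_of (e _ g) y).

Section Single.
Variables (M : complex R).
Variable c : forall i j, gen i -> {additive tensor (P i) (M j) -> M j}.
Arguments c : clear implicits.
Hypothesis cE : forall i j g x y,
  c i j g (tensor_of x y) = (bco (sbasis sf i) g x : R) *: y.
Hypothesis c_right : forall i j g u,
  c i j g (tensor_map (id_lin (P i)) (cdiff M j) u) = cdiff M j (c i (j + 1) g u).
Local Notation T := (Tagged (fun p => gen (val p).1)).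

Lemma tot_single_same n (q : tot_index n) g y : c _ _ g (@tot_single M n q g y q) = y.
Proof. by rewrite /tot_single dsum_singleE cE bco_vec eqxx; exact: scale1r. Qed.

Lemma tot_single_other n (q p : tot_index n) (g : gen (val q).1) (g' : gen (val p).1) y :
  T g' != T g -> c _ _ g' (@tot_single M n q g y p) = 0.
Proof.
rewrite /tot_single; have [qp|qp] := eqVneq q p; last by rewrite dsum_single_out // raddf0.
subst p; rewrite dsum_singleE cE bco_vec eq_Tagged eq_sym => /negPf /= ->.
exact: scale0r.
Qed.

Lemma tot_single_diff n (q : tot_index (n + 1)) (g : gen (val q).1) y
    (b : tot_index n) (g' : gen (val b).1) :
  (ht g <= ht g')%N ->
  c _ _ g' (tot_diff P M n (@tot_single M (n + 1) q g y) b) =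
  cdiff M _ (c _ _ g' (@tot_single M (n + 1) q g y (tot_index_right b)))
    *~ tot_sign (val b).1.
Proof.
move=> gg'; rewrite -[X in c _ _ _ X]/(tot_diff_val _ b) /tot_diff_val raddfD raddfMz c_right.
rewrite [X in X + _](_ : _ = 0) ?add0r //; rewrite /tot_single.
have [qb|qb] := eqVneq q (tot_index_left b); last by rewrite dsum_single_out // !raddf0.
subst q; rewrite dsum_singleE tensor_map_of cE.
have [->|/sheight_diff] :=
  eqVneq (bco (sbasis sf (val b).1) g' (cdiff P _ (e _ g))) 0; first exact: scale0r.
by rewrite ltnNge gg'.
Qed.

End Single.

Lemma tot_sign_sq i : tot_sign i * tot_sign i = 1.
Proof. by rewrite /tot_sign -expr2 sqrr_sign. Qed.

(** The mapping cone of [P (x) f] is acyclic, by elimination of the pairs formed by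
    the coefficients of [t] and [u] at a generator: [quasi_iso_lift] applies to those
    of maximal height. *)
Lemma semifree_quasi_iso (M N : complex R) (f : chain_map M N) n
    (t : tot_obj P M (n + 1)) (u : tot_obj P N (n + 1 + 1)) :
  quasi_iso f -> tot_diff P M n t = 0 ->
  tot_diff P N (n + 1) u = tot_map (chain_id P) f (n + 1) t ->
  exists t' u', tot_diff P M (n + 1) t' = t /\
    u = tot_map (chain_id P) f _ t' + tot_diff P N _ u'.
Proof.
move=> fq t_cycle u_bound.
have [c [cE csum c_right c_left]] := semifree_coordinates M.
have [d [dE dsum' d_right d_left]] := semifree_coordinates N.
have dc i j g w : d i j g (tensor_map (id_lin (P i)) (f j) w) = f j (c i j g w).
  elim/tensor_ind: w => [|x y|w v wE vE]; first by rewrite !raddf0.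
    by rewrite tensor_map_of cE dE linearZ_LR.
  by rewrite !raddfB /= wE vE.
pose S := {tu : tot_obj P M (n + 1) * tot_obj P N (n + 1 + 1) |
  tot_diff P M n tu.1 = 0 /\
  tot_diff P N (n + 1) tu.2 = tot_map (chain_id P) f (n + 1) tu.1}.
pose K : eqType := {a : tot_index (n + 1) & gen (val a).1}.
pose T (a : tot_index (n + 1)) (g : gen (val a).1) : K := Tagged (fun a => gen (val a).1) g.
pose vanish (k : K) (tu : S) :=
  c (val (tag k)).1 (val (tag k)).2 (tagged k) ((sval tu).1 (tag k)) = 0 /\
  d (val (tag k)).1 ((val (tag k)).2 + 1) (tagged k) ((sval tu).2 (tot_index_right (tag k))) = 0.
pose good (tu : S) := exists t' u', tot_diff P M (n + 1) t' = (sval tu).1 /\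
    (sval tu).2 = tot_map (chain_id P) f _ t' + tot_diff P N _ u'.
suff : forall tu, good tu by move=> /(_ (exist _ (t, u) (conj t_cycle u_bound))).
move=> {t u t_cycle u_bound}.
apply: (@height_elimination S K (fun k => ht (tagged k)) vanish).
- move=> [[t u] tuP] tu0; exists 0, 0; rewrite !raddf0 addr0; split; apply/esym/dsum_eqP => a.
    have [s [_ _ ->]] := csum _ _ (t a); rewrite big1 // => g _.
    by have [/= -> _] := tu0 (T a g); rewrite tensor_of0r.
  have [b ->] := tot_index_right_surj a.
  have [s [_ _ ->]] := dsum' _ _ (u (tot_index_right b)); rewrite big1 // => g _.
  by have [_ /= ->] := tu0 (T b g); rewrite tensor_of0r.
- move=> [[t u] tuP]; have [r [_ tr]] := dsum_supp t; have [q [_ uq]] := dsum_supp u.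
  have /dep_choice[s sP] (a : tot_index (n + 1)) := csum _ _ (t a).
  have /dep_choice[s' s'P] (a : tot_index (n + 1)) := dsum' _ _ (u (tot_index_right a)).
  have /choice[rf rfE] := @tot_index_right_surj (n + 1).
  exists (flatten [seq [seq T a g | g <- s a ++ s' a] | a <- r ++ map rf q]).
  case=> a g agL; have {}agL : a \in r ++ map rf q -> g \notin s a ++ s' a.
    move=> ar; apply: contra agL => gs; apply/flattenP.
    exists [seq T a g | g <- s a ++ s' a]; last exact: map_f.
    exact: (map_f (fun a => [seq T a g | g <- s a ++ s' a])).
  have [_ cs _] := sP a; have [_ ds _] := s'P a; split=> /=.
    have [/tr ta|] := boolP (t a != 0); last by rewrite negbK => /eqP ->; rewrite raddf0.
    apply: cs; have := agL; rewrite !mem_cat ta => /(_ isT).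
    by rewrite negb_or => /andP[].
  have [/uq ua|] := boolP (u (tot_index_right a) != 0); last first.
    by rewrite negbK => /eqP ->; rewrite raddf0.
  apply: ds; have : a \in r ++ map rf q.
    rewrite mem_cat; apply/orP; right; apply/mapP; exists (tot_index_right a) => //.
    by apply: tot_index_right_inj; rewrite -rfE.
  by move=> /agL; rewrite mem_cat negb_or => /andP[].
move=> [[t u] [t0' uE']] [b g]; have [a bE] := tot_index_right_surj b; subst b.
have t0 : tot_diff P M n t = 0 := t0'.
have uE : tot_diff P N (n + 1) u = tot_map (chain_id P) f (n + 1) t := uE'.
pose sg := tot_sign (val a).1.
have sgK (V : zmodType) (x : V) : x *~ sg *~ sg = x by rewrite -mulrzA tot_sign_sq.
move=> high.
pose m := c _ _ g (t (tot_index_right a)).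
pose v := d _ _ g (u (tot_index_right (tot_index_right a))).
have dm : cdiff M (val a).2 m = 0.
  have : c _ _ g (tot_diff P M n t a) = 0 by rewrite t0 raddf0.
  rewrite -[X in c _ _ _ X]/(tot_diff_val t a) /tot_diff_val raddfD raddfMz.
  rewrite c_left ?add0r => [|g' gg']; last first.
    by have [] := high (T (tot_index_left a) g') gg'.
  by rewrite c_right -/sg => /(congr1 (fun x => x *~ sg)); rewrite sgK mul0rz.
have dv : cdiff N _ (v *~ sg) = f _ m.
  have : d _ _ g (tot_diff P N (n + 1) u (tot_index_right a)) =
      d _ _ g (tot_map (chain_id P) f (n + 1) t (tot_index_right a)) by rewrite uE.
  rewrite tot_mapE dc -[X in d _ _ _ X]/(tot_diff_val u _) /tot_diff_val raddfD raddfMz.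
  rewrite d_left ?add0r => [|g' gg']; last first.
    have [_] := high (T (tot_index_left a) g') gg'.
    rewrite /= /tot_index_left /tot_index_right /=.
    by rewrite (bool_irrelevance (tot_index_left_subproof (tot_index_right a))
      (tot_index_right_subproof (tot_index_left a))).
  by rewrite d_right raddfMz.
have [m' [v' [dm' vE]]] := quasi_iso_lift fq dm dv.
have cancel w : w *~ sg = f _ m' + cdiff N _ v' ->
    w - f _ (m' *~ sg) - cdiff N _ v' *~ sg = 0.
  move=> wE; rewrite -[w]sgK wE raddfMz mulrzDl.
  by rewrite [LHS]addrAC addrK subrr.
pose q := tot_index_right (tot_index_right a).
pose x := @tot_single M _ q g (m' *~ sg).
pose y := @tot_single N _ (tot_index_right q) g v'.
have st0 : tot_diff P M n (t - tot_diff P M (n + 1) x) = 0.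
  by rewrite raddfB t0 tot_diff_comp subrr.
pose u' := u - tot_map (chain_id P) f _ x - tot_diff P N _ y.
have su : tot_diff P N (n + 1) u' = tot_map (chain_id P) f (n + 1) (t - tot_diff P M (n + 1) x).
  by rewrite /u' 2!raddfB uE raddfB tot_map_diff tot_diff_comp subr0.
exists (exist _ (t - tot_diff P M (n + 1) x, u') (conj st0 su)).
have subt b g' : c _ _ g' ((t - tot_diff P M (n + 1) x) b) =
    c _ _ g' (t b) - c _ _ g' (tot_diff P M (n + 1) x b).
  exact: (raddfB (c (val b).1 (val b).2 g')).
have subu b g' : d _ _ g' (u' b) = d _ _ g' (u b) -
    f _ (c _ _ g' (x b)) - d _ _ g' (tot_diff P N _ y b).
  by rewrite -dc -!raddfB.
split.
- move=> [w [w' [wE w'E]]]; exists (w + x), (w' + y); split.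
    apply: (etrans (raddfD _ _ _)).
    by rewrite (wE : tot_diff P M (n + 1) w = t - tot_diff P M (n + 1) x) subrK.
  have {}w'E : u - tot_map (chain_id P) f _ x - tot_diff P N _ y =
    tot_map (chain_id P) f _ w + tot_diff P N _ w' := w'E.
  transitivity (tot_map (chain_id P) f _ w + tot_diff P N _ w' +
    tot_diff P N _ y + tot_map (chain_id P) f _ x).
    by rewrite -w'E !subrK.
  by rewrite !raddfD addrACA [X in _ = _ + X]addrC addrA.
- split; [apply: (etrans (subt _ _)) | apply: (etrans (subu q g))].
    rewrite (tot_single_diff cE c_right) // tot_single_same //.
    apply/eqP; rewrite subr_eq0 eq_sym raddfMz; apply/eqP.
    exact: (etrans (sgK _ _) dm').
  have xq : c (val q).1 (val q).2 g (x q) = m' *~ sg by exact: tot_single_same.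
  have yq : d (val q).1 (val q).2 g (tot_diff P N _ y q) = cdiff N _ v' *~ sg.
    rewrite (tot_single_diff dE d_right) //; congr (cdiff N _ _ *~ _).
    exact: (tot_single_same dE (q := tot_index_right q)).
  apply: (etrans (congr2 (fun a b => v - f _ a - b) xq yq)).
  exact: cancel vE.
case=> b g' kk' gg' [tb ub].
have neq : Tagged (fun p : tot_index (n + 1 + 1) => gen (val p).1)
    (g' : gen (val (tot_index_right b)).1) !=
    Tagged (fun p : tot_index (n + 1 + 1) => gen (val p).1) (g : gen (val q).1).
  apply: contra kk' => /eqP E; have /= := congr1 tag E.
  move=> /tot_index_right_inj bE; subst b.
  by rewrite (eq_from_Tagged E).
have neq' : Tagged (fun p : tot_index (n + 1 + 1 + 1) => gen (val p).1)
    (g' : gen (val (tot_index_right (tot_index_right b))).1) !=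
    Tagged (fun p : tot_index (n + 1 + 1 + 1) => gen (val p).1)
      (g : gen (val (tot_index_right q)).1).
  apply: contra kk' => /eqP E; have /= := congr1 tag E.
  move=> /tot_index_right_inj/tot_index_right_inj bE; subst b.
  by rewrite (eq_from_Tagged E).
split; [apply: (etrans (subt _ _)) | apply: (etrans (subu (tot_index_right b) g'))].
  by rewrite (tot_single_diff cE c_right) // tot_single_other // raddf0 mul0rz subr0.
have ub' : d (val b).1 ((val b).2 + 1) g' (u (tot_index_right b)) = 0 := ub.
have xb : c (val b).1 ((val b).2 + 1) g' (x (tot_index_right b)) = 0.
  exact: (tot_single_other cE (p := tot_index_right b)).
have yb : d (val b).1 ((val b).2 + 1) g' (tot_diff P N _ y (tot_index_right b)) = 0.
  apply: (etrans (tot_single_diff dE d_right (b := tot_index_right b) _ _)) => //.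
  by rewrite (tot_single_other dE (p := tot_index_right (tot_index_right b))) // raddf0 mul0rz.
apply: (etrans (congr2 (fun r s => r - s) (congr2 (fun r s => r - f _ s) ub' xb) yb)).
by rewrite raddf0 !subr0.
Qed.

End SemifreeRight.

(** * Semi-free resolutions *)

Section Resolution.
Variables (R : pzRingType) (M : complex R).

(** A generator is a tree that records its degree [n], its image [m] in [M], and
    its boundary, which is the combination with coefficients [c] of its immediate
    subtrees [s]. All trees are allowed at first; those that really define
    generators are selected by [sound]. *)
Inductive tree := Tree (n : int) (m : M n) (k : nat) (c : 'I_k -> R) (s : 'I_k -> tree).

HB.instance Definition _ := gen_eqMixin tree.
HB.instance Definition _ := gen_choiceMixin tree.

Definition tree_deg (g : tree) := let: Tree n _ _ _ _ := g in n.

Fixpoint tree_height (g : tree) : nat :=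
  let: Tree _ _ k _ s := g in (\max_(j < k) tree_height (s j)).+1.

Definition tree_image i (g : tree) : M i :=
  let: Tree n m _ _ _ := g in
  tagged_as (Tagged (fun i => M i) (0 : M i)) (Tagged (fun i => M i) m).

Lemma tree_imageE i (m : M i) k c s : tree_image i (@Tree i m k c s) = m.
Proof. exact: (@tagged_asE _ _ (Tagged (fun i => M i) (0 : M i)) m). Qed.

Definition tree_bound (g : tree) : freemod R tree :=
  let: Tree _ _ k c s := g in \sum_(j < k) c j *: fbasis R (s j).

Definition forest_diff : {linear freemod R tree -> freemod R tree} :=
  sval (cid (freemod_lift tree_bound)).

Lemma forest_diffE g : forest_diff (fbasis R g) = tree_bound g.
Proof. exact: (svalP (cid (freemod_lift tree_bound))). Qed.

Definition forest_image i : {linear freemod R tree -> M i} :=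
  sval (cid (freemod_lift (tree_image i))).

Lemma forest_imageE i g : forest_image i (fbasis R g) = tree_image i g.
Proof. exact: (svalP (cid (freemod_lift (tree_image i)))). Qed.

(** The subtrees must have the right degree, the boundary must be a cycle, and its
    image must be the boundary of [m]. The differential applies to [m] once [n] is
    written as [i + 1]; the equation between tagged elements says this without a
    transport. *)
Fixpoint sound (g : tree) : Prop :=
  let: Tree n m k c s := g in
  let z : freemod R tree := \sum_(j < k) c j *: fbasis R (s j) in
  [/\ forall j, sound (s j), forall j, tree_deg (s j) + 1 = n, forest_diff z = 0 &
      forall i (m' : M (i + 1)), Tagged (fun i => M i) m' = Tagged (fun i => M i) m ->
        cdiff M i m' = forest_image i z].

Definition generator i (g : tree) := sound g /\ tree_deg g = i.

Definition forest_degree i (x : freemod R tree) := forall g, x g != 0 -> generator i g.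

Fact forest_degree0 i : forest_degree i 0.
Proof. by move=> g /eqP. Qed.

Fact forest_degreeD i x y :
  forest_degree i x -> forest_degree i y -> forest_degree i (x + y).
Proof.
move=> xi yi g; rewrite freemod_addE; have [/xi //|] := boolP (x g != 0).
by rewrite negbK => /eqP ->; rewrite add0r => /yi.
Qed.

Fact forest_degreeZ i a x : forest_degree i x -> forest_degree i (a *: x).
Proof.
move=> xi g ax; apply: xi; apply: contra ax => /eqP xg.
by rewrite freemod_scaleE xg mulr0.
Qed.

Definition forests i : submodClosed (freemod R tree) :=
  submod_of (@forest_degree0 i) (@forest_degreeD i) (@forest_degreeZ i).

Lemma mem_fbasis i g : generator i g -> fbasis R g \in forests i.
Proof.
move=> gi; apply/submod_ofP => g'; rewrite fbasisE.
by have [<-//|_] := eqVneq g g'; rewrite eqxx.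
Qed.

Lemma forest_sum i x : x \in forests i -> exists k (c : 'I_k -> R) (s : 'I_k -> tree),
  x = \sum_j c j *: fbasis R (s j) /\ forall j, generator i (s j).
Proof.
move=> /submod_ofP xi; have [k [c [s [xE sP]]]] := freemod_sum x.
by exists k, c, s; split=> // j; apply: xi.
Qed.

Lemma forest_diff_degree i x : x \in forests (i + 1) -> forest_diff x \in forests i.
Proof.
move=> /forest_sum[k [c [s [-> sP]]]]; rewrite linear_sum rpred_sum // => j _.
rewrite linearZ_LR rpredZ // forest_diffE; have [] := sP j.
case: (s j) => n m l c' s' [ss' degs' _ _] ni.
rewrite /tree_bound rpred_sum // => j' _.
rewrite rpredZ //; apply: mem_fbasis; split; first exact: ss'.
by apply: (addIr 1); rewrite degs'.
Qed.

Definition forest_cdiff_fun i (x : submod (forests (i + 1))) : submod (forests i) :=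
  Submod (forest_diff_degree (valP x)).

Fact forest_cdiff_linear i : linear (@forest_cdiff_fun i).
Proof. by move=> a x y; apply: val_inj; rewrite /= linearP. Qed.

Definition forest_cdiff i := lin_of (@forest_cdiff_linear i).

Fact forest_cdiff_comp i x : forest_cdiff i (forest_cdiff (i + 1) x) = 0.
Proof.
apply: val_inj => /=; have [k [c [s [-> sP]]]] := forest_sum (valP x).
rewrite !raddf_sum big1 // => j _ /=; rewrite !linearZ_LR /= forest_diffE.
by have [] := sP j; case: (s j) => n m l c' s' [_ _ /= -> _] _; rewrite scaler0.
Qed.

Definition resolution : complex R := @Complex R _ forest_cdiff forest_cdiff_comp.

Lemma resolution_image_diff i (x : resolution (i + 1)) :
  cdiff M i (forest_image (i + 1) (val x)) = forest_image i (val (cdiff resolution i x)).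
Proof.
rewrite /=; have [k [c [s [-> sP]]]] := forest_sum (valP x).
rewrite !raddf_sum; apply: eq_bigr => j _ /=.
rewrite !linearZ_LR /= forest_diffE forest_imageE; congr (_ *: _).
have [] := sP j; case: (s j) => n m l c' s' [_ _ _ mP] /= ni; subst n.
exact: mP (congr1 (Tagged (fun i => M i)) (tree_imageE m c' s')).
Qed.

Definition resolution_map : chain_map resolution M :=
  @ChainMap R resolution M
    (fun i => [the {linear resolution i -> M i} of forest_image i \o val])
    resolution_image_diff.

(** The tree with image [y] and boundary [z]. *)
Lemma new_generator i (y : M (i + 1)) (z : resolution i) :
  (forall j (z' : resolution (j + 1)),
     Tagged (fun i => resolution i) z = Tagged (fun i => resolution i) z' ->
     cdiff resolution j z' = 0) ->
  resolution_map i z = cdiff M i y ->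
  exists x : resolution (i + 1), cdiff resolution i x = z /\ resolution_map (i + 1) x = y.
Proof.
move=> dz fz; have [k [c [s [zE sP]]]] := forest_sum (valP z).
have gP : generator (i + 1) (Tree y c s).
  split=> //; split.
  - by move=> j; have [] := sP j.
  - by move=> j; have [_ ->] := sP j.
  - rewrite -zE; have [l iE] := int_succ i; subst i.
    exact: (congr1 val (dz l z erefl)).
  - move=> j m' /esym E; have ij : i = j by have /= /addIr := congr1 tag E.
    by subst j; rewrite -(eq_from_Tagged E) -zE -fz.
exists (Submod (mem_fbasis gP)); split.
  by apply: val_inj; rewrite /= forest_diffE /= -zE.
by rewrite /= forest_imageE tree_imageE.
Qed.

(** A cycle that maps to a boundary is the boundary of a new generator; a cycle of [M]
    is the image of a generator with boundary zero. *)
Lemma resolution_quasi_iso : quasi_iso resolution_map.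
Proof.
move=> i; split=> [x dx [y yE]|y dy].
  have [||x' [x'E _]] := @new_generator (i + 1) y x; last by exists x'.
    move=> j z' E; have /addIr ij : i + 1 = j + 1 := congr1 tag E; subst j.
    by rewrite -(eq_from_Tagged E).
  by rewrite yE.
have [||x [dx xE]] := @new_generator i y 0.
- move=> j z' E; have ij : i = j + 1 := congr1 tag E; subst i.
  by rewrite -(eq_from_Tagged E); exact: raddf0.
- by rewrite dy; exact: raddf0.
by exists x; split=> //; exists 0; rewrite xE subrr; exact: raddf0.
Qed.

Definition generators i : choiceType := {g : tree | `[< generator i g >]}.

Lemma generatorsP i (g : generators i) : generator i (val g).
Proof. exact/asboolP/(valP g). Qed.

Definition resolution_vec i (g : generators i) : resolution i :=
  Submod (mem_fbasis (generatorsP g)).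

Lemma resolution_span i (Q : resolution i -> Prop) : Q 0 ->
  (forall a g, Q (a *: resolution_vec g)) ->
  (forall x y, Q x -> Q y -> Q (x + y)) -> forall x, Q x.
Proof.
move=> Q0 Q1 QD x; have [k [c [s [xE sP]]]] := forest_sum (valP x).
have sg j : `[< generator i (s j) >] by apply/asboolP.
have -> : x = \sum_j c j *: resolution_vec (exist _ (s j) (sg j)).
  by apply: val_inj; rewrite xE raddf_sum.
by elim/big_ind: _.
Qed.

Definition resolution_basis i : basis (resolution i) (generators i).
Proof.
apply: (@Basis R (resolution i) (generators i) (@resolution_vec i)
  (fun g x => (val x : freemod R tree) (val g))) => //.
- by move=> g g'; rewrite fbasisE (inj_eq val_inj).
- exact: resolution_span.
Defined.

Lemma resolution_height i (g : generators (i + 1)) (g' : generators i) :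
  bco (resolution_basis i) g' (cdiff resolution i (bvec (resolution_basis (i + 1)) g)) != 0 ->
  (tree_height (val g') < tree_height (val g))%N.
Proof.
rewrite /= forest_diffE; case: (val g) => n m k c s /=.
elim/big_rec: _ => [/eqP //|j x _ IHx].
rewrite freemod_addE freemod_scaleE fbasisE.
have [<- _|_] := eqVneq (s j) (val g'); last by rewrite mulr0 add0r.
by rewrite ltnS; exact: (leq_bigmax (F := fun j => tree_height (s j))).
Qed.

Definition resolution_semifree : semifree resolution :=
  @Semifree R resolution generators resolution_basis
    (fun i g => tree_height (val g)) resolution_height.

End Resolution.

(** * Semi-flat complexes preserve quasi-isomorphisms *)

Section Cone.
Variables (R : pzRingType) (P X : complex R) (f : chain_map P X).

(** The mapping cone, shifted by one degree so that no index needs to be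
    decremented. *)
Definition cone_obj (i : int) : lmodType R := (X (i + 1)%R * P i)%type.

Definition cone_diff_fun i (c : cone_obj (i + 1)) : cone_obj i :=
  (f (i + 1) c.2 - cdiff X (i + 1) c.1, cdiff P i c.2).

Fact cone_diff_linear i : linear (@cone_diff_fun i).
Proof.
move=> a [x p] [x' p']; rewrite /cone_diff_fun /= !linearP.
congr (_, _); rewrite addrACA /=.
by congr (_ + _); rewrite -scalerDr.
Qed.

Definition cone_diff i := lin_of (@cone_diff_linear i).

Fact cone_diff_comp i c : cone_diff i (cone_diff (i + 1) c) = 0.
Proof.
rewrite /= /cone_diff_fun /= linearB cmap_diff !cdiff_comp subr0 subrr //.
Qed.

Definition cone : complex R := @Complex R cone_obj cone_diff cone_diff_comp.

Lemma cone_acyclic : quasi_iso f -> acyclic cone.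
Proof.
move=> fq i [x p] /= [/eqP]; rewrite subr_eq0 => /eqP/esym dx dp.
have [p' [x' [dp' xE]]] := quasi_iso_lift fq dp dx.
exists (- x', p'); rewrite /= /cone_diff_fun /= linearN opprK dp' -xE //.
Qed.

Definition cone_inl i : {linear X (i + 1) -> cone i} :=
  lin_of (f := fun x => (x, 0) : cone i)
    (fun a x y => congr1 (pair _) (esym (etrans (addr0 _) (scaler0 _ _)))).

Definition cone_inr i : {linear P i -> cone i} :=
  lin_of (f := fun p => (0, p) : cone i)
    (fun a x y => congr1 (pair^~ _) (esym (etrans (addr0 _) (scaler0 _ _)))).

Definition cone_fst i : {linear cone i -> X (i + 1)} :=
  lin_of (f := fun c : cone i => c.1) (fun a x y => erefl).

Definition cone_snd i : {linear cone i -> P i} :=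
  lin_of (f := fun c : cone i => c.2) (fun a x y => erefl).

End Cone.

Section ConeTensor.
Variables (R : pzRingType) (P X : complex R^c) (f : chain_map P X) (F : complex R).
Local Notation C := (cone f).

(** The total tensor product of the cone with [F] is the cone of the map [f (x) F], up
    to the sign in [tot_inl_diff]. *)
Definition tot_inr n : {additive tot_obj P F n -> tot_obj C F n} :=
  dsum_map (fun a : tot_index n =>
    tensor_map (cone_inr f (val a).1) (id_lin (F (val a).2)) : {additive _ -> _}).

Fact tot_inl_finite n (x : tot_obj X F (n + 1)) :
  finite_set [set a : tot_index n | tensor_map (cone_inl f (val a).1)
    (id_lin (F (val a).2)) (x (tot_index_left a)) != 0].
Proof.
have := dsum_finite x => /(finite_preimage (f := @tot_index_left n)) fin.
apply: sub_finite_set (fin _) => [a /=|a b _ _].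
  by apply: contra => /eqP ->; rewrite raddf0.
exact: tot_index_left_inj.
Qed.

Definition tot_inl_fun n (x : tot_obj X F (n + 1)) : tot_obj C F n :=
  DSum (tot_inl_finite x).

Fact tot_inl_is_zmod_morphism n : zmod_morphism (@tot_inl_fun n).
Proof. by move=> x y; apply: dsum_eqP => a; exact: raddfB. Qed.

Definition tot_inl n : {additive tot_obj X F (n + 1) -> tot_obj C F n} :=
  add_of (@tot_inl_is_zmod_morphism n).

Lemma tot_inlE n x a : tot_inl n x a =
  tensor_map (cone_inl f (val a).1) (id_lin (F (val a).2)) (x (tot_index_left a)).
Proof. by []. Qed.

Lemma tot_inrE n x a : tot_inr n x a =
  tensor_map (cone_inr f (val a).1) (id_lin (F (val a).2)) (x a).
Proof. by []. Qed.

Lemma tot_diffE (A : complex R^c) n (t : tot_obj A F (n + 1)) (a : tot_index n) :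
  tot_diff A F n t a =
  tensor_map (cdiff A (val a).1) (id_lin (F (val a).2)) (t (tot_index_left a)) +
  tensor_map (id_lin (A (val a).1)) (cdiff F (val a).2) (t (tot_index_right a))
    *~ tot_sign (val a).1.
Proof. by []. Qed.

Lemma tot_inr_diff n (p : tot_obj P F (n + 1)) :
  tot_diff C F n (tot_inr (n + 1) p) =
  tot_inl n (tot_map f (chain_id F) (n + 1) p) + tot_inr n (tot_diff P F n p).
Proof.
apply: dsum_eqP => a; rewrite dsum_addE tot_diffE !tot_inrE tot_inlE tot_diffE tot_mapE /=.
rewrite raddfD raddfMz addrA; congr (_ + _ *~ _) => /=; last exact/esym/tensor_map_exchange.
elim/tensor_ind: (p _) => [|x y|u v uE vE]; first by rewrite !raddf0 addr0.
  rewrite !tensor_map_of -tensor_ofDl; apply: (congr2 (@tensor_of _ _ _)) => //.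
  apply: (congr2 pair); last exact: esym (add0r _).
  by apply: (etrans _ (esym (addr0 _))); rewrite /= linear0 subr0.
by rewrite !raddfB /= uE vE opprD addrACA.
Qed.

Lemma tot_inl_diff n (x : tot_obj X F (n + 1 + 1)) :
  tot_diff C F n (tot_inl (n + 1) x) = - tot_inl n (tot_diff X F (n + 1) x).
Proof.
apply: dsum_eqP => a; rewrite dsum_oppE tot_diffE !tot_inlE tot_diffE /=.
rewrite raddfD raddfMz tot_sign_addr1 mulrNz opprB [LHS]addrC; congr (_ *~ _ + _) => /=.
  rewrite tensor_map_exchange /tot_index_left /tot_index_right /=.
  by rewrite (bool_irrelevance (tot_index_left_subproof (tot_index_right a))
    (tot_index_right_subproof (tot_index_left a))).
elim/tensor_ind: (x _) => [|y z|u v uE vE]; first by rewrite !raddf0.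
  rewrite !tensor_map_of; apply/eqP; rewrite -addr_eq0 -tensor_ofDl.
  apply/eqP; rewrite -[RHS](tensor_of0l (cone f (val a).1 : lmodType _) z).
  apply: (congr2 (@tensor_of _ _ _)) => //; apply: (congr2 pair).
    by rewrite /= linear0 sub0r; exact: addNr.
  by rewrite /= linear0; exact: addr0.
by rewrite !raddfB /= uE vE.
Qed.

Lemma tot_cone_decompose n (c : tot_obj C F n) :
  exists x p, c = tot_inl n x + tot_inr n p.
Proof.
elim/dsum_ind: c => [|a c|c c' [x [p ->]] [x' [p' ->]]].
- by exists 0, 0; rewrite !raddf0 addr0.
- exists (dsum_single (A := fun a => tensor (X (val a).1) (F (val a).2)) (i := tot_index_left a)
    (tensor_map (cone_fst f (val a).1) (id_lin (F (val a).2)) c)),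
    (dsum_single (A := fun a => tensor (P (val a).1) (F (val a).2)) (i := a)
    (tensor_map (cone_snd f (val a).1) (id_lin (F (val a).2)) c)).
  apply: dsum_eqP => b; rewrite dsum_addE tot_inlE tot_inrE.
  have [ab|ab] := eqVneq a b; last first.
    rewrite !dsum_single_out // ?raddf0 ?addr0 //.
    by apply: contra ab => /eqP/tot_index_left_inj ->.
  subst b; rewrite !dsum_singleE.
  elim/tensor_ind: c => [|[x p] z|u v uE vE]; first by rewrite !raddf0 addr0.
    rewrite !tensor_map_of -tensor_ofDl; apply: (congr2 (@tensor_of _ _ _)) => //.
    by apply: (congr2 pair); [exact: esym (addr0 _) | exact: esym (add0r _)].
  by rewrite !raddfB /= {1}uE {1}vE opprD addrACA.
by exists (x + x'), (p + p'); rewrite !raddfD addrACA.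
Qed.

Lemma tot_cone_inj n x p : tot_inl n x + tot_inr n p = 0 -> x = 0 /\ p = 0.
Proof.
move=> xp0; have xpa a : tensor_map (cone_inl f (val a).1) (id_lin (F (val a).2))
    (x (tot_index_left a)) +
    tensor_map (cone_inr f (val a).1) (id_lin (F (val a).2)) (p a) = 0.
  by rewrite -tot_inlE -tot_inrE -dsum_addE xp0.
split; apply: dsum_eqP => a.
  have [b ->] := tot_index_left_surj a.
  have /(congr1 (tensor_map (cone_fst f (val b).1) (id_lin (F (val b).2)))) := xpa b.
  have z : tensor_map (cone_fst f (val b).1) (id_lin (F (val b).2))
      (tensor_map (cone_inr f (val b).1) (id_lin (F (val b).2)) (p b)) = 0.
    by apply: tensor_map_comp0; left.
  rewrite raddf0 raddfD /= z addr0.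
  by rewrite (tensor_map_comp (f3 := id_lin _) (g3 := id_lin _)) // tensor_map_id.
have /(congr1 (tensor_map (cone_snd f (val a).1) (id_lin (F (val a).2)))) := xpa a.
have z : tensor_map (cone_snd f (val a).1) (id_lin (F (val a).2))
    (tensor_map (cone_inl f (val a).1) (id_lin (F (val a).2)) (x (tot_index_left a))) = 0.
  by apply: tensor_map_comp0; left.
rewrite raddf0 raddfD /= z add0r.
by rewrite (tensor_map_comp (f3 := id_lin _) (g3 := id_lin _)) // tensor_map_id.
Qed.

Lemma tot_cone_eq n x p x' p' : tot_inl n x + tot_inr n p = tot_inl n x' + tot_inr n p' ->
  x = x' /\ p = p'.
Proof.
move=> E; have [|xE pE] := @tot_cone_inj n (x - x') (p - p').
  by rewrite !raddfB addrACA -opprD E subrr.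
by split; apply/eqP; rewrite -subr_eq0 ?xE ?pE.
Qed.

Hypotheses (Fsemi : semiflat F) (fq : quasi_iso f).

Lemma semiflat_quasi_iso_inj n (t : tot_obj P F (n + 1)) (w : tot_obj X F (n + 1 + 1)) :
  tot_diff P F n t = 0 -> tot_diff X F (n + 1) w = tot_map f (chain_id F) (n + 1) t ->
  exists s, tot_diff P F (n + 1) s = t.
Proof.
move=> t0 wE.
have c0 : tot_diff C F n (tot_inl (n + 1) w + tot_inr (n + 1) t) = 0.
  by rewrite raddfD tot_inl_diff tot_inr_diff t0 wE raddf0 addr0 addNr.
have [c cE] := Fsemi.2 C (cone_acyclic fq) n _ c0.
have [x [p cxp]] := tot_cone_decompose c.
have {}cE : tot_diff C F (n + 1) c = tot_inl (n + 1) w + tot_inr (n + 1) t := cE.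
exists p; move: cE; rewrite cxp raddfD tot_inl_diff tot_inr_diff addrA -raddfN -raddfD.
by move=> /tot_cone_eq[].
Qed.

Lemma semiflat_quasi_iso_surj n (x : tot_obj X F (n + 1 + 1)) :
  tot_diff X F (n + 1) x = 0 ->
  exists t, tot_diff P F (n + 1) t = 0 /\
    exists w, tot_diff X F _ w = tot_map f (chain_id F) _ t - x.
Proof.
move=> x0.
have c0 : tot_diff C F n (tot_inl (n + 1) x) = 0 by rewrite tot_inl_diff x0 raddf0 oppr0.
have [c cE] := Fsemi.2 C (cone_acyclic fq) n _ c0.
have [w [t cwt]] := tot_cone_decompose c.
have {}cE : tot_diff C F (n + 1) c = tot_inl (n + 1) x + tot_inr (n + 1) 0.
  by rewrite raddf0 addr0; exact: cE.
move: cE; rewrite cwt raddfD tot_inl_diff tot_inr_diff addrA -raddfN -raddfD.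
move=> /tot_cone_eq[xE t0]; exists t; split=> //; exists w.
by rewrite -xE opprD addrCA subrr addr0 opprK.
Qed.

End ConeTensor.

(** * Invariance under isomorphism in the derived category *)

Lemma subrACA (V : zmodType) (a b c d : V) : (a - b) - (c - d) = (a - c) - (b - d).
Proof. by rewrite opprD addrACA -opprD. Qed.

Section DerivedInvariance.
Variables (R : pzRingType) (T : complex R -> zcomplex).
Variable Tmap : forall L M : complex R, chain_map L M -> forall i, {additive T L i -> T M i}.
Hypothesis Tmap_diff : forall L M (f : chain_map L M) i x,
  zdiff (T M) i (Tmap f (i + 1) x) = Tmap f i (zdiff (T L) i x).
Hypothesis Tmap_id : forall L (f : chain_map L L), (forall i x, f i x = x) ->
  forall i x, Tmap f i x = x.
Hypothesis Tmap_comp : forall L M N (f : chain_map L M) (g : chain_map M N)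
  (h : chain_map L N), (forall i x, g i (f i x) = h i x) ->
  forall i x, Tmap g i (Tmap f i x) = Tmap h i x.
Variable n : int.

Local Notation cycle L x := (zdiff (T L) n x = 0).
Definition boundary L (x : T L (n + 1)) := exists z, zdiff (T L) (n + 1) z = x.

Hypothesis Tmap_inj : forall L M (f : chain_map L M), quasi_iso f ->
  forall x, cycle L x -> boundary (Tmap f (n + 1) x) -> boundary x.
Hypothesis Tmap_surj : forall L M (f : chain_map L M), quasi_iso f ->
  forall y, cycle M y -> exists x, cycle L x /\ boundary (Tmap f (n + 1) x - y).

Lemma boundary0 L : boundary (0 : T L (n + 1)).
Proof. by exists 0; rewrite raddf0. Qed.

Lemma boundaryB L (x y : T L (n + 1)) : boundary x -> boundary y -> boundary (x - y).
Proof. by move=> [z <-] [z' <-]; exists (z - z'); rewrite raddfB. Qed.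

Lemma boundaryN L (x : T L (n + 1)) : boundary x -> boundary (- x).
Proof. by rewrite -sub0r; apply: boundaryB; exact: boundary0. Qed.

Lemma boundaryD L (x y : T L (n + 1)) : boundary x -> boundary y -> boundary (x + y).
Proof. by move=> xb /boundaryN yb; rewrite -[y]opprK; exact: boundaryB. Qed.

Lemma boundary_map L M (f : chain_map L M) x : boundary x -> boundary (Tmap f (n + 1) x).
Proof. by move=> [z <-]; exists (Tmap f _ z); rewrite Tmap_diff. Qed.

Lemma cycle_map L M (f : chain_map L M) x : cycle L x -> cycle M (Tmap f (n + 1) x).
Proof. by move=> x0; rewrite Tmap_diff x0 raddf0. Qed.

(** The graph of the map induced in homology by a morphism of the derived category;
    a relation, so that formal inverses need no choice of preimages. *)
Fixpoint homology_rel (L M : complex R) (a : dhom L M) :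
    T L (n + 1) -> T M (n + 1) -> Prop :=
  match a in dhom L M return T L (n + 1) -> T M (n + 1) -> Prop with
  | DMap L M f => fun x y => boundary (Tmap f (n + 1) x - y)
  | DInv L M f _ => fun x y => boundary (Tmap f (n + 1) y - x)
  | DComp L M N a b => fun x y =>
      exists z, [/\ cycle M z, homology_rel b x z & homology_rel a z y]
  end.

Lemma homology_rel_total L M (a : dhom L M) x :
  cycle L x -> exists y, cycle M y /\ homology_rel a x y.
Proof.
elim: a x => {L M} [L M f|L M f fq|L M N a IHa b IHb] x x0.
- exists (Tmap f _ x); split; first exact: cycle_map.
  by rewrite /= subrr; exact: boundary0.
- exact: Tmap_surj.
have [y [y0 xy]] := IHb x x0; have [z [z0 yz]] := IHa y y0.
by exists z; split=> //; exists y.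
Qed.

Lemma homology_relB L M (a : dhom L M) x y x' y' :
  homology_rel a x y -> homology_rel a x' y' -> homology_rel a (x - x') (y - y').
Proof.
elim: a x y x' y' => {L M} [L M f|L M f fq|L M N a IHa b IHb] x y x' y' /=.
- by move=> h h'; rewrite raddfB subrACA; exact: boundaryB.
- by move=> h h'; rewrite raddfB subrACA; exact: boundaryB.
move=> [z [z0 xz zy]] [z' [z'0 x'z z'y]]; exists (z - z'); split.
- by rewrite raddfB z0 z'0 subrr.
- exact: IHb.
- exact: IHa.
Qed.

Lemma homology_rel_boundary L M (a : dhom L M) x y :
  cycle L x -> cycle M y -> homology_rel a x y -> boundary x -> boundary y.
Proof.
elim: a x y => {L M} [L M f|L M f fq|L M N a IHa b IHb] x y x0 y0 /=.
- move=> h /(boundary_map f) xb; have := boundaryB xb h.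
  by rewrite opprB addrCA subrr addr0.
- move=> h xb; apply: (Tmap_inj fq) => //.
  by have := boundaryD h xb; rewrite subrK.
by move=> [z [z0 xz zy]] xb; apply: IHa zy _ => //; exact: IHb xz _.
Qed.

Lemma homology_rel0 L M (a : dhom L M) y : boundary y -> homology_rel a 0 y.
Proof.
elim: a y => {L M} [L M f|L M f fq|L M N a IHa b IHb] y yb /=.
- by rewrite raddf0 sub0r; exact: boundaryN.
- by rewrite subr0; exact: boundary_map.
exists 0; split; [exact: raddf0 | exact/IHb/boundary0 | exact: IHa].
Qed.

Lemma homology_rel_eq L M (a b : dhom L M) : dhom_eq a b ->
  forall x y, cycle L x -> cycle M y -> homology_rel a x y <-> homology_rel b x y.
Proof.
have hr L' M' (c : dhom L' M') x y y' : homology_rel c x y -> boundary (y - y') ->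
    homology_rel c x y'.
  move=> h yb; have := homology_relB h (homology_rel0 c yb).
  by rewrite subr0 opprB addrCA subrr addr0.
elim=> {L M a b}
  [L M a|L M a b _ IH|L M a b c _ IH _ IH'|L M N a a' b b' _ IHa _ IHb|K L M N a b c|
   L M a|L M a|L M f g fg|L M N g f|L M f fq|L M f fq] x y x0 y0 //=.
- by rewrite IH.
- by rewrite IH // IH'.
- split=> -[z [z0 xz zy]]; exists z; split=> //.
  + by rewrite -IHb.
  + by rewrite -IHa.
  + by rewrite IHb.
  + by rewrite IHa.
- split.
    by move=> [z [z0 [w [w0 xw wz] zy]]]; exists w; split=> //; exists z.
  by move=> [w [w0 xw [z [z0 wz zy]]]]; exists z; split=> //; exists w.
- split=> [[z [z0 xz]]|xy]; last first.
    by exists y; rewrite Tmap_id // subrr; split=> //; exact: boundary0.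
  by rewrite Tmap_id //; exact: hr.
- split=> [[z [z0]]|xy]; last first.
    by exists x; rewrite Tmap_id // subrr; split=> //; exact: boundary0.
  rewrite Tmap_id // => xz zy.
  have [w [w0 xw]] := homology_rel_total a x0.
  have d := homology_relB zy xw.
  apply: hr xw _; rewrite -opprB; apply: boundaryN.
  apply: homology_rel_boundary d _; rewrite ?raddfB ?x0 ?z0 ?w0 ?y0 ?subrr //.
  by rewrite -opprB; exact: boundaryN.
- have -> // : Tmap f (n + 1) x = Tmap g (n + 1) x.
  rewrite -[RHS](Tmap_id (f := chain_id M)) //.
  by rewrite (Tmap_comp (h := f)) // => i z; rewrite fg.
- split=> [[z [z0 xz zy]]|xy].
    have := boundaryD (boundary_map g xz) zy; rewrite raddfB (Tmap_comp (h := chain_comp g f)) //.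
    by rewrite addrA subrK.
  exists (Tmap f _ x); split; first exact: cycle_map.
    by rewrite subrr; exact: boundary0.
  by rewrite (Tmap_comp (h := chain_comp g f)).
- rewrite Tmap_id //; split=> [[z [z0 xz yz]]|xy].
    apply: (Tmap_inj fq); first by rewrite raddfB x0 y0 subrr.
    have := boundaryB xz yz; rewrite raddfB opprB addrA subrK //.
  exists (Tmap f _ x); split; first exact: cycle_map.
    by rewrite subrr; exact: boundary0.
  by rewrite -raddfB; apply: boundary_map; rewrite -opprB; exact: boundaryN.
- rewrite Tmap_id //; split=> [[z [z0 zx zy]]|xy].
    by have := boundaryB zy zx; rewrite opprB addrC addrA subrK.
  have [z [z0 zx]] := Tmap_surj fq x0; exists z; split=> //.
  by have := boundaryD zx xy; rewrite addrA subrK.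
Qed.

Lemma derived_iso_homology (M N : complex R) :
  derived_iso M N -> (forall y, cycle N y -> boundary y) ->
  forall x, cycle M x -> boundary x.
Proof.
move=> [a [b [ba _]]] N0 x x0.
have [y [y0 xy]] := homology_rel_total a x0.
have [z [z0 yz]] := homology_rel_total b y0.
have zb : boundary z by apply: homology_rel_boundary yz (N0 y y0).
have /(homology_rel_eq ba x0 z0) /= : homology_rel (DComp b a) x z by exists y.
by rewrite Tmap_id // => xz; have := boundaryD xz zb; rewrite subrK.
Qed.

End DerivedInvariance.

Lemma chain_map_homology (R : pzRingType) (M N : complex R) i :
  derived_iso M N -> (forall y : N (i + 1), cdiff N i y = 0 -> exists z, cdiff N (i + 1) z = y) ->
  forall x : M (i + 1), cdiff M i x = 0 -> exists z, cdiff M (i + 1) z = x.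
Proof.
apply: (@derived_iso_homology R (@zcomplex_of R) (fun L M f i => f i : {additive _ -> _})).
- by move=> *; exact: cmap_diff.
- by [].
- by [].
- by move=> L K f fq x x0; exact: (fq i).1.
- by move=> L K f fq y y0; exact: (fq i).2.
Qed.

Lemma semifree_homology (R : pzRingType) (P : complex R^c) (sf : semifree P)
    (M N : complex R) i :
  derived_iso M N ->
  (forall y, tot_diff P N i y = 0 -> exists z, tot_diff P N (i + 1) z = y) ->
  forall x, tot_diff P M i x = 0 -> exists z, tot_diff P M (i + 1) z = x.
Proof.
apply: (@derived_iso_homology R (total_tensor P) (fun L M f i => tot_map (chain_id P) f i)).
- by move=> L K f j x; exact: tot_map_diff.
- by move=> L f fE j x; exact: tot_map_id.
- by move=> L K J f g h gf j x; exact: tot_map_comp.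
- move=> L K f fq x x0 [u uE].
  by have [t' [_ [t'E _]]] := semifree_quasi_iso sf fq x0 uE; exists t'.
- move=> L K f fq; have [j ->] := int_succ i => y y0.
  have [|t' [u' [t'E yE]]] := semifree_quasi_iso (t := 0) (u := y) sf fq (raddf0 _).
    by rewrite raddf0.
  exists t'; split=> //; exists (- u'); rewrite raddfN.
  by apply/eqP; rewrite eq_sym subr_eq yE addrCA addNr addr0.
Qed.

(** * Flatness of cokernels *)

Lemma tensor_zero (R : pzRingType) (X : lmodType R^c) (Y : lmodType R) (t : tensor X Y) :
  (forall x : X, x = 0) \/ (forall y : Y, y = 0) -> t = 0.
Proof.
move=> xy0; elim/tensor_ind: t => // [x y|t u -> ->]; last exact: subrr.
by case: xy0 => z0; [rewrite (z0 x) tensor_of0l | rewrite (z0 y) tensor_of0r].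
Qed.

Section Concentrated.
Variables (R : pzRingType) (X : lmodType R).

Definition concentrated_obj (i : int) : lmodType R :=
  if i is Posz 0 then X else 'rV[R]_0.

Fact zero_linear (V W : lmodType R) : linear (fun _ : V => 0 : W).
Proof. by move=> a x y; rewrite scaler0 addr0. Qed.

Definition concentrated : complex R :=
  @Complex R concentrated_obj (fun i => lin_of (@zero_linear _ _)) (fun i x => erefl).

Lemma concentrated_eq0 i (x : concentrated i) : i != 0 -> x = 0.
Proof. by case: i x => [[|n]|n] // x _; exact: thinmx0. Qed.

End Concentrated.

Section FlatCokernel.
Variables (R : pzRingType) (F G : complex R) (n : int).
Hypotheses (Fsemi : semiflat F) (Gsemi : semiflat G) (FG : derived_iso F G).
Hypothesis G0 : forall i, n < i -> forall x : G i, x = 0.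

Lemma derived_bounded_acyclic i (x : F (i + 1)) :
  n < i + 1 -> cdiff F i x = 0 -> exists y, cdiff F (i + 1) y = x.
Proof.
move=> ni; apply: chain_map_homology FG _ x => y _.
by exists 0; rewrite [y]G0 // raddf0.
Qed.

(** The homology of [X (x) F] can be computed after replacing [X] by a semi-free
    resolution [P], and then [F] may be replaced by [G]. *)
Lemma derived_bounded_tensor (X : lmodType R^c) i (t : tensor X (F (i + 1))) :
  n < i + 1 -> tensor_map (id_lin X) (cdiff F i) t = 0 ->
  exists s, tensor_map (id_lin X) (cdiff F (i + 1)) s = t.
Proof.
move=> ni dt; pose X0 := concentrated X; pose P := resolution X0.
have epsq : quasi_iso (resolution_map X0) := resolution_quasi_iso X0.
have totG0 (u : tot_obj X0 G (i + 1)) : u = 0.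
  apply: dsum_eqP => -[[p q] /= pq]; apply: tensor_zero.
  have [p0|p0] := eqVneq p 0; last by left=> x; exact: concentrated_eq0.
  by right; apply: G0; move: pq; rewrite p0 add0r => /eqP ->.
have PG y : tot_diff P G i y = 0 -> exists z, tot_diff P G (i + 1) z = y.
  move=> y0; apply: (semiflat_quasi_iso_inj (w := 0) Gsemi epsq y0).
  by rewrite raddf0 [RHS]totG0.
have PF := semifree_homology (resolution_semifree X0) FG PG.
have [j iE] := int_succ i; subst i.
pose b0 : tot_index (j + 1) := exist _ (0, j + 1) (introT eqP (add0r _)).
pose a := tot_index_right b0.
pose T (b : tot_index (j + 1 + 1)) := tensor (X0 (val b).1) (F (val b).2).
pose u : tot_obj X0 F (j + 1 + 1) := dsum_single (A := T) (i := a) t.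
have d0 p q (v : tensor (X0 (p + 1)) (F q)) :
    tensor_map (cdiff X0 p) (id_lin (F q)) v = 0.
  elim/tensor_ind: v => [|x y|v w vE wE]; first by rewrite raddf0.
    by rewrite tensor_map_of tensor_of0l.
  by rewrite raddfB /= vE wE subrr.
have u0 : tot_diff X0 F (j + 1) u = 0.
  apply: dsum_eqP => b; rewrite tot_diffE d0 add0r.
  rewrite {}/u; have [ab|ab] := eqVneq a (tot_index_right b); last first.
    by rewrite dsum_single_out // raddf0 mul0rz.
  have bE : b = b0 by apply: tot_index_right_inj; rewrite -ab.
  by subst b; rewrite dsum_singleE dt mul0rz.
have [v [v0 [w wE]]] := semiflat_quasi_iso_surj Fsemi epsq u0.
have [z zE] := PF v v0.
pose s := tot_map (resolution_map X0) (chain_id F) _ z - w.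
have su : tot_diff X0 F (j + 1 + 1) s = u.
  by rewrite raddfB tot_map_diff zE wE opprB addrCA subrr addr0.
have := congr1 (fun x => dsum_val x a) su; rewrite [RHS]dsum_singleE tot_diffE d0 add0r.
by rewrite /= => sE; exists (s (tot_index_right a)); rewrite -[RHS]sE.
Qed.

(** The chase that proves the injectivity of [A (x) N -> B (x) N] from the vanishing of
    the homology of [(B/A) (x) F] in degree [i + 1]. *)
Lemma derived_bounded_flat i (N : lmodType R) (g : {linear F i -> N}) :
  n <= i -> (forall y, exists x, g x = y) ->
  (forall x, g x = 0 <-> exists y, cdiff F i y = x) -> flat N.
Proof.
move=> ni gs gk A B f finj; apply: raddf_eq => t /= ft0.
have ni1 : n < i + 1 by rewrite ltzD1.
have [t' t'E] := tensor_map_surj (@id_lin_surj _ _) gs t.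
have imf0 : exists x, f x = 0 by exists 0; rewrite raddf0.
have imfD x y : (exists z, f z = x) -> (exists z, f z = y) -> exists z, f z = x + y.
  by move=> [z <-] [z' <-]; exists (z + z'); rewrite raddfD.
have imfZ a x : (exists z, f z = x) -> exists z, f z = a *: x.
  by move=> [z <-]; exists (a *: z); rewrite linearZ.
pose imf := submod_of imf0 imfD imfZ.
pose X := quotmod imf.
pose p := [the {linear B -> X} of quotmod_pi imf].
have ps x : exists b, p b = x by have [b ->] := quotmod_piP x; exists b.
have pk b : p b = 0 <-> exists a, f a = b.
  split=> [/quotmod_pi_eq0/submod_ofP //|fb].
  by apply/quotmod_pi_eq0/submod_ofP.
have [s sE] : exists s, tensor_map (id_lin B) (cdiff F i) s = tensor_map f (id_lin (F i)) t'.
  have /(tensor_right_exact (@id_lin_surj _ _) gs) gen :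
      tensor_map (id_lin B) g (tensor_map f (id_lin (F i)) t') = 0.
    by rewrite -tensor_map_exchange t'E ft0.
  apply: (gen (fun u => exists s, tensor_map (id_lin B) (cdiff F i) s = u)).
  - by exists 0; rewrite raddf0.
  - move=> x y [/= ->|/gk[z <-]]; first by exists 0; rewrite raddf0 tensor_of0l.
    by exists (tensor_of x z); rewrite tensor_map_of.
  - by move=> u v [s <-] [s' <-]; exists (s - s'); rewrite raddfB.
have [r rE] : exists r, tensor_map (id_lin X) (cdiff F (i + 1)) r =
    tensor_map p (id_lin (F (i + 1))) s.
  apply: derived_bounded_tensor => //.
  rewrite -tensor_map_exchange sE.
  elim/tensor_ind: (t') => [|x y|u v uE vE]; first by rewrite !raddf0.
    rewrite !tensor_map_of (_ : p (f x) = 0) ?tensor_of0l //.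
    by apply/pk; exists x.
  by rewrite !raddfB /= uE vE subrr.
have [r' r'E] := tensor_map_surj ps (@id_lin_surj _ (F (i + 1 + 1))) r.
pose s1 := s - tensor_map (id_lin B) (cdiff F (i + 1)) r'.
have [s' s'E] : exists s', tensor_map f (id_lin (F (i + 1))) s' = s1.
  have /(tensor_right_exact ps (@id_lin_surj _ _)) gen :
      tensor_map p (id_lin (F (i + 1))) s1 = 0.
    by rewrite raddfB /= tensor_map_exchange r'E rE subrr.
  apply: (gen (fun u => exists s', tensor_map f (id_lin (F (i + 1))) s' = u)).
  - by exists 0; rewrite raddf0.
  - move=> x y [/pk[z <-]|/= ->]; last by exists 0; rewrite raddf0 tensor_of0r.
    by exists (tensor_of z y); rewrite tensor_map_of.
  - by move=> u v [w <-] [w' <-]; exists (w - w'); rewrite raddfB.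
have t'_boundary : tensor_map (id_lin A) (cdiff F i) s' = t'.
  apply: (Fsemi.1 i _ _ f finj); rewrite tensor_map_exchange s'E raddfB /= sE.
  by rewrite tensor_map_comp0 ?subr0 //; right; exact: cdiff_comp.
rewrite -t'E -t'_boundary tensor_map_comp0 //; right => y.
by apply/gk; exists y.
Qed.

(** A map from a finitely presented module to the boundaries lifts, as these form a
    flat module, being the kernel of a map between flat modules. *)
Lemma derived_bounded_lift i (A : lmodType R) (h : {linear A -> F i}) :
  n <= i -> finitely_presented A -> (forall a, exists y, cdiff F i y = h a) ->
  exists h' : {linear A -> F (i + 1)}, forall a, cdiff F i (h' a) = h a.
Proof.
move=> ni Afp hb.
have imd0 : exists x, cdiff F i x = 0 by exists 0; rewrite raddf0.
have imdD x y : (exists z, cdiff F i z = x) -> (exists z, cdiff F i z = y) ->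
    exists z, cdiff F i z = x + y.
  by move=> [z <-] [z' <-]; exists (z + z'); rewrite raddfD.
have imdZ a x : (exists z, cdiff F i z = x) -> exists z, cdiff F i z = a *: x.
  by move=> [z <-]; exists (a *: z); rewrite linearZ.
pose B := submod_of imd0 imdD imdZ.
have BP x : x \in B <-> exists y, cdiff F i y = x.
  exact: iff_sym (rwP (submod_ofP imd0 imdD imdZ x)).
pose g := [the {linear F i -> quotmod B} of quotmod_pi B].
have gs y : exists x, g x = y by have [x ->] := quotmod_piP y; exists x.
have gk x : g x = 0 <-> exists y, cdiff F i y = x.
  by rewrite -BP; exact: quotmod_pi_eq0.
pose v := [the {linear submod B -> F i} of (val : submod B -> F i)].
have Bflat : flat (submod B).
  apply: (@flat_kernel _ _ _ _ v g) => //.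
  - exact: val_inj.
  - move=> y; rewrite gk -BP; split=> [yB|[x <-]]; last exact: valP.
    by exists (Submod yB).
  - exact: derived_bounded_flat gs gk.
  - exact: Fsemi.1.
have dB x : cdiff F i x \in B by apply/BP; exists x.
have dl : linear (fun x => Submod (dB x) : submod B).
  by move=> a x y; apply: val_inj; rewrite /= linearP.
have hB a : h a \in B by apply/BP.
have hl : linear (fun a => Submod (hB a) : submod B).
  by move=> a x y; apply: val_inj; rewrite /= linearP.
have [|h' h'E] := @flat_lift _ _ _ _ (lin_of dl) (lin_of hl) Bflat Afp.
  move=> c; have /BP[y yE] := valP c; exists y; exact: val_inj.
by exists h' => a; have /(congr1 val) := h'E a.
Qed.

End FlatCokernel.

(** * Pure-minimal semi-flat complexes have no superfluous degrees *)

(** The functor [hom(A, -)] is left exact, so only the surjectivity is at stake. *)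
Lemma pure_subcomplex_lift (R : pzRingType) (M : complex R) (L : subcomplex M) :
  (forall A : complex R, bounded A -> (forall i, finitely_presented (A i)) ->
    forall w : chain_map A (quot_complex L),
    exists h : chain_map A M, chain_eq (chain_comp (quot_proj L) h) w) ->
  pure_subcomplex L.
Proof.
move=> lift A Abounded Afp; split; last exact: lift.
  by move=> u v uv i x; apply: val_inj; exact: uv.
move=> h; split=> [h0|[u uh] i x]; last first.
  by rewrite /= -uh; apply/quotmod_pi_eq0; exact: valP.
have hL i x : h i x \in L i by apply/quotmod_pi_eq0; exact: h0.
have ul i : linear (fun x => Submod (hL i x) : sub_complex L i).
  by move=> a x y; apply: val_inj; rewrite /= linearP.
have ud i x : cdiff (sub_complex L) i (lin_of (ul (i + 1)) x) = lin_of (ul i) (cdiff A i x).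
  by apply: val_inj; rewrite /= cmap_diff.
by exists (ChainMap ud).
Qed.

(** Again, left exactness leaves only the lifting of maps to be checked. *)
Lemma acyclic_pure (R : pzRingType) (C : complex R) :
  acyclic C ->
  (forall (A : lmodType R) i (w : {linear A -> C (i + 1)}), finitely_presented A ->
    (forall a, cdiff C i (w a) = 0) ->
    exists h : {linear A -> C (i + 1 + 1)}, forall a, cdiff C (i + 1) (h a) = w a) ->
  pure_acyclic C.
Proof.
move=> Cacy lift; split=> // i.
have ker_in (y : C (i + 1 + 1)) : to_cycles C i y = 0 -> y \in ker (cdiff C (i + 1)).
  by move=> /(congr1 val) dy; exact/kerP.
split.
  split=> [x y|y|z]; first exact: val_inj.
    split=> [yk|[x <-]]; first by exists (Submod (ker_in y yk)).
    by apply: val_inj; have /kerP := valP x.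
  have /kerP dz := valP z; have [y yz] := Cacy i _ dz.
  by exists y; apply: val_inj.
move=> A Afp; split.
- by move=> u v uv a; apply: val_inj; exact: uv.
- move=> h; split=> [h0|[u uh] a]; last first.
    by rewrite /= -uh; apply: val_inj; have /kerP := valP (u a).
  have ul : linear (fun a => Submod (ker_in _ (h0 a)) : cycles C (i + 1)).
    by move=> r a b; apply: val_inj; rewrite /= linearP.
  by exists (lin_of ul).
- move=> w; have [|h hw] := lift A i [the {linear A -> C (i + 1)} of cycles_incl C i \o w] Afp.
    by move=> a; have /kerP := valP (w a).
  by exists h => a; apply: val_inj; exact: hw.
Qed.

Section Minimal.
Variables (R : pzRingType) (F G : complex R) (n : int).
Hypotheses (Fsemi : semiflat F) (Gsemi : semiflat G) (FG : derived_iso F G).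
Hypothesis G0 : forall i, n < i -> forall x : G i, x = 0.

(** The subcomplex [... -> F_(n+2) -> F_(n+1) -> B_n -> 0]. *)
Definition in_upper i (x : F i) :=
  n < i \/ exists y, (i < n -> y = 0) /\ cdiff F i y = x.

Fact in_upper0 i : in_upper (0 : F i).
Proof. by right; exists 0; rewrite raddf0. Qed.

Fact in_upperD i (x y : F i) : in_upper x -> in_upper y -> in_upper (x + y).
Proof.
move=> [ni|[x' [x'0 <-]]]; first by left.
move=> [ni|[y' [y'0 <-]]]; first by left.
right; exists (x' + y'); rewrite raddfD; split=> // i_n.
by rewrite x'0 // y'0 // addr0.
Qed.

Fact in_upperZ i a (x : F i) : in_upper x -> in_upper (a *: x).
Proof.
move=> [ni|[x' [x'0 <-]]]; first by left.
by right; exists (a *: x'); rewrite linearZ; split=> // i_n; rewrite x'0 // scaler0.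
Qed.

Definition upper_carrier i : submodClosed (F i) :=
  submod_of (@in_upper0 i) (@in_upperD i) (@in_upperZ i).

Lemma upperP i (x : F i) : reflect (in_upper x) (x \in upper_carrier i).
Proof. exact: submod_ofP. Qed.

Fact upper_diff i x : x \in upper_carrier (i + 1) -> cdiff F i x \in upper_carrier i.
Proof.
move=> /upperP xU; apply/upperP; right; have [i_n|ni] := ltP i n; last by exists x.
exists 0; rewrite raddf0; split=> //.
case: xU => [|[y [_ <-]]]; last by rewrite cdiff_comp.
by rewrite ltzD1 leNgt i_n.
Qed.

Definition upper : subcomplex F := @Subcomplex R F upper_carrier upper_diff.

Lemma upper_high i (x : F i) : n < i -> x \in upper i.
Proof. by move=> ni; apply/upperP; left. Qed.

Lemma upper_low i (x : F i) : i < n -> x \in upper i -> x = 0.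
Proof.
move=> i_n /upperP[|[y [/(_ i_n) -> <-]]]; last by rewrite raddf0.
by move=> /(lt_trans i_n); rewrite ltxx.
Qed.

Lemma upper_middle (x : F n) : x \in upper n <-> exists y, cdiff F n y = x.
Proof.
split=> [/upperP[|[y [_ <-]]]|[y <-]]; first by rewrite ltxx.
  by exists y.
by apply/upperP; right; exists y; rewrite ltxx.
Qed.

Local Notation Q := (quot_complex upper).
Local Notation pi := (quot_proj upper).

Lemma upper_quot_high i (y : Q i) : n < i -> y = 0.
Proof. by move=> ni; have [x ->] := quotmod_piP y; apply/quotmod_pi_eq0/upper_high. Qed.

Lemma upper_quot_low i (x : F i) : i < n -> pi i x = 0 -> x = 0.
Proof. by move=> i_n /quotmod_pi_eq0; exact: upper_low. Qed.

Lemma upper_lift i (A : lmodType R) (w : {linear A -> Q i}) : finitely_presented A ->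
  exists h : {linear A -> F i}, forall a, pi i (h a) = w a.
Proof.
move=> Afp; have pis y : exists x, pi i x = y by exact: quot_proj_surj.
have [i_n|ni|i_n] := ltgtP i n; last subst i.
- have [|s sE] := @lin_factor R (F i) (Q i) (F i) (pi i) (id_lin (F i)) pis.
    by move=> x; exact: upper_quot_low.
  exists [the {linear A -> F i} of s \o w] => a /=.
  by have [x <-] := pis (w a); rewrite sE.
- exists (lin_of (@zero_linear R A (F i))) => a.
  by rewrite [RHS]upper_quot_high // [LHS]upper_quot_high.
have nflat : flat (Q n).
  apply: (derived_bounded_flat Fsemi Gsemi FG G0 (lexx n) (g := pi n)).
    by move=> y; exact: quot_proj_surj.
  by move=> x; rewrite -upper_middle; exact: quotmod_pi_eq0.
exact: flat_lift nflat Afp pis.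
Qed.

(** In degree [n] this holds because [w] vanishes above [n], and in higher degrees
    because [F] is acyclic there. *)
Lemma upper_step (A : complex R) (w : chain_map A Q) (h : forall i, {linear A i -> F i}) j :
  n <= j -> (forall i x, pi i (h i x) = w i x) ->
  (forall i x, i < j -> cdiff F i (h (i + 1) x) = h i (cdiff A i x)) ->
  forall a, exists y, cdiff F j y = h j (cdiff A j a).
Proof.
rewrite le_eqVlt => /orP[/eqP nj|nj] hw hd a.
  subst j; apply/upper_middle/quotmod_pi_eq0; apply: (etrans (hw _ _)).
  by rewrite -cmap_diff [w _ _]upper_quot_high ?raddf0 // ltzD1.
have [i jE] := int_succ j; subst j; apply: (derived_bounded_acyclic FG G0) => //.
by rewrite hd ?cdiff_comp ?raddf0 // ltzD1.
Qed.

Lemma upper_pure : pure_subcomplex upper.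
Proof.
apply: pure_subcomplex_lift => A [N AN] Afp w.
(* The lifts are corrected one degree after the other, starting above [n]; as [A] is
   bounded, finitely many corrections suffice. *)
have lift k : exists h : forall i, {linear A i -> F i},
    (forall i x, pi i (h i x) = w i x) /\
    forall i x, i < n + k%:Z -> cdiff F i (h (i + 1) x) = h i (cdiff A i x).
  elim: k => [|k [h [hw hd]]].
    have /dep_choice[h hw] i : exists h : {linear A i -> F i}, forall a, pi i (h a) = w i a.
      exact: upper_lift.
    exists h; split=> // i x; rewrite addr0 => i_n.
    apply/eqP; rewrite -subr_eq0; apply/eqP/(upper_quot_low i_n).
    rewrite raddfB /= [X in _ - X]hw -[X in X - _]/(pi i _) -(cmap_diff pi) hw cmap_diff.
    exact: subrr.
  pose j := n + k%:Z.
  have nj : n <= j by rewrite lerDl.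
  have [h' h'E] := derived_bounded_lift Fsemi Gsemi FG G0
    (h := [the {linear A (j + 1) -> F j} of h j \o cdiff A j])
    nj (Afp _) (upper_step nj hw hd).
  pose hh : forall i, {linear A i -> F i} := dfwith h h'.
  have hhj : hh (j + 1) = h' by exact: dfwith_in.
  have hhN i : j + 1 != i -> hh i = h i by exact: dfwith_out.
  exists hh; split=> [i x|i x].
    have [ji|ji] := eqVneq (j + 1) i; last by rewrite hhN.
    have ni : n < i by rewrite -ji ltzD1.
    by rewrite [LHS]upper_quot_high // [RHS]upper_quot_high.
  rewrite -addn1 PoszD addrA ltzD1 -/j => ij.
  rewrite (hhN i); last by rewrite gt_eqF // ltzD1.
  have [ij'|ij'] := eqVneq i j.
    by subst i; rewrite hhj; exact: h'E.
  rewrite hhN ?hd //; first by rewrite lt_neqAle ij' ij.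
  by rewrite (inj_eq (addIr 1)) eq_sym.
have [h [hw hd]] := lift (`|N|%N + `|n|%N)%N.+1.
have hd' i x : cdiff F i (h (i + 1) x) = h i (cdiff A i x).
  have [/hd //|iN] := ltP i (n + (`|N|%N + `|n|%N)%N.+1%:Z).
  have -> : x = 0; last by rewrite !raddf0.
  by apply: AN; lia.
by exists (ChainMap hd').
Qed.

Lemma upper_acyclic : acyclic (sub_complex upper).
Proof.
move=> i x /(congr1 val) /= dx.
have [ni|i_n] := ltP n (i + 1).
  have [y yx] := derived_bounded_acyclic FG G0 ni dx.
  have yU : y \in upper (i + 1 + 1) by apply: upper_high; rewrite (lt_trans ni) // ltzD1.
  by exists (Submod yU); apply: val_inj.
have /upperP[|[y [y0 yx]]] := valP x; first by rewrite ltNge i_n.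
have yU : y \in upper (i + 1 + 1).
  have [/y0 ->|ni] := ltP (i + 1) n; first exact/upperP/in_upper0.
  by apply: upper_high; rewrite ltzD1.
by exists (Submod yU); apply: val_inj.
Qed.

Lemma upper_pure_acyclic : pure_acyclic (sub_complex upper).
Proof.
apply: (acyclic_pure upper_acyclic) => A i w Afp dw.
have [i_n|ni] := ltP (i + 1) n.
  exists (lin_of (@zero_linear R A (sub_complex upper (i + 1 + 1)))) => a.
  have w0 : val (w a) = 0 by apply: upper_low i_n (valP (w a)).
  by apply: val_inj; rewrite /= raddf0 w0.
have ni2 : n < i + 1 + 1 by rewrite ltzD1.
have [|h hE] := derived_bounded_lift Fsemi Gsemi FG G0
    (h := [the {linear A -> F (i + 1)} of val \o w]) ni Afp.
  move=> a; have [y yw] := upper_acyclic (dw a).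
  by exists (val y); rewrite /= -yw.
have hl : linear (fun a => Submod (upper_high (h a) ni2) : sub_complex upper (i + 1 + 1)).
  by move=> r a b; apply: val_inj; rewrite /= linearP.
by exists (lin_of hl) => a; apply: val_inj; exact: hE.
Qed.

Lemma pure_minimal_bounded : pure_minimal F -> forall i, n < i -> forall x : F i, x = 0.
Proof.
move=> Fmin i ni x.
exact: Fmin upper_pure upper_pure_acyclic i x (upper_high x ni).
Qed.

End Minimal.

(** * Existence of pure-minimal semi-flat replacements *)

Section MaximalSubcomplex.
Variables (R : pzRingType) (F : complex R).
Hypothesis Fsemi : semiflat F.

(** These conditions stand in for the purity and pure-acyclicity of [L], because they
    pass to unions of chains and to preimages; the first one says that [L] is
    acyclic. *)
Definition removable (L : subcomplex F) :=
  (forall i (x : F (i + 1)), x \in L (i + 1) -> cdiff F i x = 0 ->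
     exists y, y \in L (i + 1 + 1) /\ cdiff F (i + 1) y = x) /\
  semiflat (quot_complex L).

Definition subcomplex_of (P : forall i, F i -> Prop) (P0 : forall i, P i 0)
    (PD : forall i x y, P i x -> P i y -> P i (x + y))
    (PZ : forall i a x, P i x -> P i (a *: x))
    (Pd : forall i x, P (i + 1) x -> P i (cdiff F i x)) : subcomplex F :=
  @Subcomplex R F (fun i => submod_of (P0 i) (PD i) (PZ i))
    (fun i x xP => introT (submod_ofP (P0 i) (PD i) (PZ i) _)
       (Pd i x (elimT (submod_ofP (P0 _) (PD _) (PZ _) _) xP))).

Lemma subcomplex_ofE P P0 PD PZ Pd i x :
  x \in @subcomplex_of P P0 PD PZ Pd i <-> P i x.
Proof. exact: iff_sym (rwP (submod_ofP (P0 i) (PD i) (PZ i) x)). Qed.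

Lemma removable_zero : exists L, removable L.
Proof.
have [L LP] : exists L : subcomplex F, forall i x, x \in L i <-> x = 0.
  have P0 i : (0 : F i) = 0 by [].
  have PD i (x y : F i) : x = 0 -> y = 0 -> x + y = 0 by move=> -> ->; rewrite addr0.
  have PZ i a (x : F i) : x = 0 -> a *: x = 0 by move=> ->; rewrite scaler0.
  have Pd i (x : F (i + 1)) : x = 0 -> cdiff F i x = 0 by move=> ->; rewrite raddf0.
  exists (subcomplex_of P0 PD PZ Pd) => i x.
  exact: subcomplex_ofE.
exists L; split=> [i x /LP -> _|].
  by exists 0; rewrite raddf0; split=> //; apply/LP.
apply: (semiflat_same_kernel (p := chain_id F) (q := quot_proj L)) => //.
- by move=> i y; exists y.
- exact: quot_proj_surj.
- by move=> i x; rewrite [quot_proj L i x = 0]quotmod_pi_eq0 LP.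
Qed.

Definition sub_le (L L' : subcomplex F) := forall i x, x \in L i -> x \in L' i.

Lemma removable_union (A : set (subcomplex F)) (L0 : subcomplex F) :
  A L0 -> (forall L, A L -> removable L) ->
  (forall L L', A L -> A L' -> sub_le L L' \/ sub_le L' L) ->
  exists U, removable U /\ forall L, A L -> sub_le L U.
Proof.
move=> AL0 AP Atot.
pose P i (x : F i) := exists L, A L /\ x \in L i.
have P0 i : P i 0 by exists L0; rewrite rpred0.
have PD i (x y : F i) : P i x -> P i y -> P i (x + y).
  move=> [L [AL xL]] [L' [AL' yL']]; have [LL'|L'L] := Atot _ _ AL AL'.
    by exists L'; rewrite rpredD // LL'.
  by exists L; rewrite rpredD // L'L.
have PZ i a (x : F i) : P i x -> P i (a *: x).
  by move=> [L [AL xL]]; exists L; rewrite rpredZ.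
have Pd i (x : F (i + 1)) : P (i + 1) x -> P i (cdiff F i x).
  by move=> [L [AL xL]]; exists L; rewrite sub_diff.
pose U := subcomplex_of P0 PD PZ Pd.
have UP i x : x \in U i <-> P i x.
  exact: subcomplex_ofE.
exists U; split; last by move=> L AL i x xL; apply/UP; exists L.
split=> [i x /UP[L [AL xL]] dx|].
  have [y [yL yx]] := (AP L AL).1 i x xL dx.
  by exists y; split=> //; apply/UP; exists L.
apply: (semiflat_limit (p := quot_proj U)); first exact: quot_proj_surj.
move=> s sU; have [L [AL Ls]] : exists L, A L /\ kills (quot_proj L) s.
  elim: s sU => [|[j y] s IHs] sU; first by exists L0.
  have [|L [AL Ls]] := IHs; first by move=> i x xs; apply: sU; rewrite inE xs orbT.
  have /quotmod_pi_eq0/UP[L' [AL' yL']] : quot_proj U j y = 0 by apply: sU; exact: mem_head.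
  have [M [AM LM L'M]] : exists M, [/\ A M, sub_le L M & sub_le L' M].
    have [LL'|L'L] := Atot _ _ AL AL'; [exists L' | exists L]; split=> //; by move=> i x.
  exists M; split=> // i x; rewrite inE => /orP[/eqP E|/Ls/quotmod_pi_eq0/LM xM].
    have ij : i = j := congr1 tag E; subst j.
    by rewrite (eq_from_Tagged E); apply/quotmod_pi_eq0/L'M.
  exact/quotmod_pi_eq0.
have [h hE] : exists h : chain_map (quot_complex L) (quot_complex U),
    forall i x, h i (quot_proj L i x) = quot_proj U i x.
  apply: chain_factor; first exact: quot_proj_surj.
  by move=> i x /quotmod_pi_eq0 xL; apply/quotmod_pi_eq0/UP; exists L.
by exists (quot_complex L), (quot_proj L), h; split=> //; have [] := AP L AL.
Qed.

Lemma removable_maximal : exists L, removable L /\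
  forall L', removable L' -> sub_le L L' -> sub_le L' L.
Proof.
have [L0 L0P] := removable_zero.
pose T := {L : subcomplex F | removable L}.
pose le (L L' : T) := `[< sub_le (sval L) (sval L') >].
have [||A Atot|[L LP] Lmax] := @ZL_preorder T (exist _ L0 L0P) le.
- by move=> L; apply/asboolP.
- move=> L L' L'' /asboolP LL' /asboolP L'L''; apply/asboolP => i x /LL'; exact: L'L''.
- have [[[L1 L1P] AL1]|A0] := pselect (exists L, A L); last first.
    by exists (exist _ L0 L0P) => L AL; case: A0; exists L.
  pose B : set (subcomplex F) := [set L | exists LP : removable L, A (exist _ L LP)]%classic.
  have [|||U [UP BU]] := @removable_union B L1.
  + by exists L1P.
  + by move=> L [].
  + by move=> L L' [LP AL] [L'P AL']; have [/asboolP|/asboolP] := Atot _ _ AL AL'; [left|right].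
  by exists (exist _ U UP) => -[L LP] AL; apply/asboolP/BU; exists LP.
exists L; split=> // L' L'P LL'.
by apply/asboolP/(Lmax (exist _ L' L'P))/asboolP.
Qed.

(** The preimage of [K] has the same quotient as [K], which is semi-flat as a pure
    quotient. *)
Lemma removable_preimage (L : subcomplex F) (K : subcomplex (quot_complex L)) :
  removable L -> pure_subcomplex K -> acyclic (sub_complex K) ->
  exists L', [/\ removable L', sub_le L L' &
    forall i x, x \in L' i <-> quot_proj L i x \in K i].
Proof.
move=> [Lacy Lsemi] Kpure Kacy; pose P i (x : F i) := quot_proj L i x \in K i.
have P0 i : P i 0 by rewrite /P raddf0 rpred0.
have PD i (x y : F i) : P i x -> P i y -> P i (x + y).
  by rewrite /P raddfD; exact: rpredD.
have PZ i a (x : F i) : P i x -> P i (a *: x) by rewrite /P linearZ; exact: rpredZ.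
have Pd i (x : F (i + 1)) : P (i + 1) x -> P i (cdiff F i x).
  by rewrite /P -(cmap_diff (quot_proj L)); exact: sub_diff.
pose L' := subcomplex_of P0 PD PZ Pd.
have LP i x : x \in L' i <-> quot_proj L i x \in K i.
  exact: subcomplex_ofE.
exists L'; split=> //; last first.
  by move=> i x xL; apply/LP; rewrite (_ : quot_proj L i x = 0) ?rpred0 //; apply/quotmod_pi_eq0.
split=> [i x /LP xK dx|].
  have [|k /(congr1 val) /= kE] := Kacy i (Submod xK : sub_complex K (i + 1)).
    by apply: val_inj; rewrite /= quot_diff_pi dx raddf0.
  have [y yE] := quotmod_piP (val k).
  have /quotmod_pi_eq0 xyL : quot_proj L (i + 1) (x - cdiff F (i + 1) y) = 0.
    by rewrite raddfB /= -quot_diff_pi -yE kE subrr.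
  have [|l [lL lE]] := Lacy i _ xyL; first by rewrite raddfB /= dx cdiff_comp subrr.
  exists (y + l); split; last by rewrite linearD lE addrCA subrr addr0.
  have l0 : quot_proj L _ l = 0 by exact/quotmod_pi_eq0.
  apply/LP; have -> : quot_proj L _ (y + l) = val k by rewrite linearD l0 addr0 yE.
  exact: valP.
apply: (semiflat_same_kernel (p := chain_comp (quot_proj K) (quot_proj L)) (q := quot_proj L')).
- move=> i z; have [y <-] := quot_proj_surj z; have [x <-] := quot_proj_surj y.
  by exists x.
- exact: quot_proj_surj.
- move=> i x; rewrite [quot_proj L' i x = 0]quotmod_pi_eq0 LP.
  exact: quotmod_pi_eq0.
- exact: pure_quotient_semiflat.
Qed.

Lemma removable_quasi_iso (L : subcomplex F) : removable L -> quasi_iso (quot_proj L).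
Proof.
move=> [Lacy _] i; split=> [x dx [z zE]|z dz].
  have [y yz] := quotmod_piP z.
  have /quotmod_pi_eq0 xyL : quot_proj L (i + 1) (x - cdiff F (i + 1) y) = 0.
    by rewrite raddfB /= -quot_diff_pi -yz -zE subrr.
  have [|l [lL lE]] := Lacy i _ xyL; first by rewrite raddfB /= dx cdiff_comp subrr.
  by exists (y + l); rewrite linearD lE addrCA subrr addr0.
have [y yz] := quotmod_piP z; have [j iE] := int_succ i; subst i.
have dyL : cdiff F (j + 1) y \in L (j + 1).
  by apply/quotmod_pi_eq0; rewrite -quot_diff_pi -yz.
have [|l [lL lE]] := Lacy j _ dyL; first exact: cdiff_comp.
have l0 : quot_proj L _ l = 0 by exact/quotmod_pi_eq0.
exists (y - l); rewrite raddfB /= lE subrr; split=> //; exists 0.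
by rewrite raddf0 linearB l0 subr0 yz subrr.
Qed.

Lemma semiflat_pure_minimal_quotient : exists E (p : chain_map F E),
  [/\ pure_minimal E, semiflat E & quasi_iso p].
Proof.
have [L [Lrem Lmax]] := removable_maximal.
exists (quot_complex L), (quot_proj L); split; last exact: removable_quasi_iso.
  move=> K Kpure [Kacy _] i z zK; have [x zx] := quotmod_piP z.
  have [L' [L'rem LL' L'P]] := removable_preimage Lrem Kpure Kacy.
  by rewrite zx; apply/quotmod_pi_eq0/(Lmax L' L'rem LL')/L'P; rewrite /= -zx.
by have [] := Lrem.
Qed.

End MaximalSubcomplex.

(** * The derived category and flat dimension *)

Section DerivedIso.
Variable R : pzRingType.

Lemma derived_iso_sym (M N : complex R) : derived_iso M N -> derived_iso N M.
Proof. by move=> [a [b [ba ab]]]; exists b, a. Qed.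

Lemma dhom_cancel (L M N : complex R) (a : dhom L M) (c : dhom M N) (d : dhom N M)
    (b : dhom M L) :
  dhom_eq (DComp b a) (did L) -> dhom_eq (DComp d c) (did M) ->
  dhom_eq (DComp (DComp b d) (DComp c a)) (did L).
Proof.
move=> ba dc; apply: DTrans (DSym (DCompA _ _ _)) _; apply: DTrans ba.
apply: DCompEq; first exact: DRefl.
apply: DTrans (DCompA _ _ _) _; apply: DTrans (DComp1l a).
by apply: DCompEq => //; exact: DRefl.
Qed.

Lemma derived_iso_trans (L M N : complex R) :
  derived_iso L M -> derived_iso M N -> derived_iso L N.
Proof.
move=> [a [b [ba ab]]] [c [d [dc cd]]]; exists (DComp c a), (DComp b d).
by split; exact: dhom_cancel.
Qed.

Lemma quasi_iso_derived (M N : complex R) (f : chain_map M N) :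
  quasi_iso f -> derived_iso M N.
Proof.
move=> fq; exists (DMap f), (DInv fq); split; [exact: DInvl | exact: DInvr].
Qed.

End DerivedIso.

Section IntBounds.
Local Open Scope classical_set_scope.
Local Open Scope ereal_scope.

Lemma infimum_eq (A : set (\bar int)) x0 v :
  A !=set0 -> lbound A v -> (forall u, lbound A u -> u <= v) -> infimum x0 A = v.
Proof.
move=> A0 Av vmax; rewrite /infimum ifF; last exact/negbTE/set0P.
have vinf : infimums A v by split=> // u; exact: vmax.
by case: xgetP => [w _ winf|/(_ v)//]; exact: is_subset1_infimums winf vinf.
Qed.

Lemma supremum_eq (A : set (\bar int)) x0 v :
  A !=set0 -> ubound A v -> (forall u, ubound A u -> v <= u) -> supremum x0 A = v.
Proof.
move=> A0 Av vmin; rewrite /supremum ifF; last exact/negbTE/set0P.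
have vsup : supremums A v by split=> // u; exact: vmin.
by case: xgetP => [w _ wsup|/(_ v)//]; exact: is_subset1_supremums wsup vsup.
Qed.

Lemma int_max (I : set int) i0 n : I i0 -> ubound I n -> exists m, I m /\ ubound I m.
Proof.
move=> Ii0; have [k] : exists k : nat, (n <= i0 + k%:Z)%R.
  by exists `|(n - i0)%R|%N; lia.
elim: k n => [|k IHk] n nk nI.
  exists i0; split=> // i /nI; lia.
have [In|nIn] := pselect (I n); first by exists n.
apply: (IHk (n - 1)%R); first by lia.
move=> i Ii; have := nI i Ii; rewrite le_eqVlt => /orP[/eqP E|]; last by lia.
by case: nIn; rewrite -E.
Qed.

Lemma infimum_ubound (I : set int) :
  infimum +oo [set n%:E | n in ubound I] = supremum -oo [set i%:E | i in I].
Proof.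
have [[i0 Ii0]|I0] := pselect (exists i, I i); last first.
  have -> : [set i%:E | i in I] = set0.
    by rewrite -subset0 => x [i Ii _]; case: I0; exists i.
  rewrite supremum0; apply: infimum_eq.
  - by exists 0%:E, 0%R => // i Ii; case: I0; exists i.
  - by move=> x _; exact: leNye.
  - move=> [r|//|//] rI; last first.
      suff : +oo <= 0%:E :> \bar int by [].
      by apply: rI; exists 0%R => // i Ii; case: I0; exists i.
    have : r%:E <= (r - 1)%:E by apply: rI; exists (r - 1)%R => // i Ii; case: I0; exists i.
    by rewrite lee_fin; lia.
have [[n nI]|noub] := pselect (exists n, ubound I n); last first.
  have -> : [set n%:E | n in ubound I] = set0.
    by rewrite -subset0 => x [n nI _]; case: noub; exists n.
  rewrite /infimum eqxx; apply/esym/supremum_eq.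
  - by exists i0%:E, i0.
  - by move=> x _; exact: leey.
  - move=> [r|//|] rI; last first.
      by have : i0%:E <= -oo :> \bar int by apply: rI; exists i0.
    case: noub; exists r => i Ii; rewrite -lee_fin; apply: rI; by exists i.
have [m [Im mI]] := int_max Ii0 nI.
transitivity (m%:E : \bar int).
  apply: infimum_eq; first by exists m%:E, m.
    by move=> _ [k kI <-]; rewrite lee_fin; exact: kI.
  by move=> u; apply; exists m.
apply/esym/supremum_eq; first by exists m%:E, m.
  by move=> _ [k kI <-]; rewrite lee_fin; exact: mI.
by move=> u; apply; exists m.
Qed.

End IntBounds.

Theorem mainTheorem5 (R : pzRingType) (M : complex R) :
  (exists F : complex R,
     [/\ pure_minimal F, semiflat F & derived_iso F M]) /\
  (forall F : complex R,
     pure_minimal F -> semiflat F -> derived_iso F M ->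
     flat_dim M = sup_degree F).
Proof.
split.
  have Psemi := semifree_semiflat (resolution_semifree M).
  have [E [p [Emin Esemi pq]]] := semiflat_pure_minimal_quotient Psemi.
  exists E; split=> //; apply: derived_iso_trans (quasi_iso_derived (resolution_quasi_iso M)).
  exact/derived_iso_sym/(quasi_iso_derived pq).
move=> F Fmin Fsemi FM; rewrite /flat_dim /sup_degree -infimum_ubound.
congr (infimum _ (image _ _)); apply/seteqP; split=> [n [G [Gsemi MG G0]] i [x]|n nF] /=.
  move=> x0; rewrite leNgt; apply/negP => ni; move/eqP: x0; apply.
  exact: pure_minimal_bounded Fsemi Gsemi (derived_iso_trans FM MG) G0 Fmin i ni x.
exists F; split=> //; first exact: derived_iso_sym.
move=> i ni x; apply/eqP; apply: contraTT ni => x0.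
by rewrite -leNgt; apply: nF; exists x.
Qed.
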